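(* Let $R$ be the valuation domain of an archimedean non-discrete valuation $v\colon Q\to\mathbb R\cup\{\infty\}$ on its field of quotients $Q$, and let $L_v$ be the induced non-discrete length function on $\mathrm{Mod}(R)$. The intrinsic valuation entropy $\widetilde{\mathrm{ent}}_v$ is the unique length function $L_X\colon\mathrm{Mod}(R[X])\to\mathbb R^*$ such that: (1) $L_X(M\otimes_R R[X])=L_v(M)$ for all $R$-modules $M$ with $L_v(M)<\infty$; (2) $L_X(M_\phi)=v(s)$ for any linear transformation $\phi\colon M\to M$ of a finite dimensional $Q$-vector space $M$, where $s$ is the leading coefficient of the characteristic polynomial of $\phi$ over $R$.
   Context: Archimedean non-discrete means that the value group of $v$ is a dense subgroup of the ordered additive group $\mathbb R$. Put $\mathbb R^*=\mathbb R_{\ge 0}\cup\{\infty\}$. For a ring $S$, a function $L\colon \mathrm{Mod}(S)\to\mathbb R^*$ is an invariant if $L(0)=0$ and $L(M)=L(M')$ whenever $M\cong M'$; it is additive if $L(M)=L(M')+L(M'')$ for every short exact sequence $0\to M'\to M\to M''\to 0$; it is upper continuous if $L(M)=\sup\{L(F): F\le M \text{ finitely generated}\}$. A length function is an additive and upper continuous invariant. $L_v\colon\mathrm{Mod}(R)\to\mathbb R^*$ denotes the (unique) length function with $L_v(R/I)=\inf_{r\in I}v(r)$ for every ideal $I$ of $R$ (Northcott–Reufel). For an $R$-module $M$ and $\phi\in\mathrm{End}_R(M)$, $M_\phi$ denotes the $R[X]$-module $M$ on which $X$ acts as $\phi$; every $R[X]$-module is of this form. For an $R$-submodule $K\le M$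 and $n\ge1$, $T_n(\phi,K)=K+\phi K+\dots+\phi^{n-1}K$. An $R$-submodule $H\le M$ is $\phi$-inert if $L_v((H+\phi H)/H)<\infty$; $\mathcal I_\phi(M)$ is the set of $\phi$-inert submodules of $M$. For $H\in\mathcal I_\phi(M)$, $\widetilde{\mathrm{ent}}_v(\phi,H)=\lim_{n\to\infty}\frac{L_v(T_n(\phi,H)/H)}{n}$ (the limit exists and is finite). The intrinsic valuation entropy is $\widetilde{\mathrm{ent}}_v(M_\phi)=\sup_{H\in\mathcal I_\phi(M)}\widetilde{\mathrm{ent}}_v(\phi,H)$. For a linear transformation $\phi$ of a finite dimensional $Q$-vector space, with monic characteristic polynomial $p_\phi(X)\in Q[X]$, let $s\in R$ be an element of minimal value such that $s\,p_\phi(X)\in R[X]$; the primitive polynomial $s\,p_\phi(X)$, with leading coefficient $s$, is called the characteristic polynomial of $\phi$ over $R$. *)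

(* Defs.v *)
From HB Require Import structures.
From mathcomp Require Import all_boot all_order all_algebra.
From mathcomp Require Import generic_quotient ring_quotient sesquilinear.
From mathcomp Require Import all_classical all_reals all_analysis.

Set Implicit Arguments.
Unset Strict Implicit.
Unset Printing Implicit Defensive.

Import Order.TTheory GRing.Theory Num.Theory.
Import numFieldNormedType.Exports.

Local Open Scope classical_set_scope.
Local Open Scope ring_scope.
Local Open Scope quotient_scope.

(* Values lie in K u {+oo}, encoded as extended reals different from -oo. *)
Record valuation (K : realType) (Q : fieldType) := Valuation {
  val_fun :> Q -> \bar K;
  val_neqNy : forall x, val_fun x != -oo%E;
  val_eqy : forall x, val_fun x = +oo%E <-> x = 0;
  valM : forall x y, val_fun (x * y) = (val_fun x + val_fun y)%E;
  valD : forall x y, (Order.min (val_fun x) (val_fun y) <= val_fun (x + y)%R)%E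
}.

Section ValuationRing.
Variables (K : realType) (Q : fieldType) (v : valuation K Q).

Definition value_group : set K := [set a | exists2 x : Q, x != 0 & v x = a%:E].

Definition non_discrete := dense value_group.

Lemma val1 : v 1 = 0%E.
Proof.
have := valM v 1 1; rewrite mulr1.
have := val_neqNy v 1; have : v 1 <> +oo%E by move/val_eqy/eqP; rewrite oner_eq0.
case: (v 1) => // a _ _ [] /eqP; rewrite -subr_eq subrr => /eqP <- //.
Qed.

Lemma valN x : v (- x) = v x.
Proof.
have vN1 : v (-1) = 0%E.
  have := valM v (-1) (-1); rewrite mulrNN mulr1 val1.
  have := val_neqNy v (-1); case: (v (-1)) => // a _ [] /esym/eqP.
  by rewrite -mulr2n mulrn_eq0 /= => /eqP ->.
by rewrite -mulN1r valM vN1 add0e.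
Qed.

Definition integral_pred : {pred Q} := fun x => (0%E <= v x)%E.

Lemma integral_subring : subring_closed integral_pred.
Proof.
split=> [|x y|x y]; rewrite !unfold_in.
- by rewrite val1.
- by move=> vx vy; apply: le_trans (valD v _ _); rewrite le_min vx valN vy.
- by move=> vx vy; rewrite valM adde_ge0.
Qed.

HB.instance Definition _ :=
  GRing.isSubringClosed.Build Q integral_pred integral_subring.

Definition valring : Type := {x : Q | x \in integral_pred}.

HB.instance Definition _ := SubChoice.on valring.
HB.instance Definition _ := [SubChoice_isSubComNzRing of valring by <:].

(* The inclusion of R into its field of quotients. *)
Definition valring_val : {rmorphism valring -> Q} := val.

End ValuationRing.

Section Submodules.
Variables (R : pzRingType) (M : lmodType R).
Implicit Types (H K : submodClosed M).

Definition submod H : Type := {x : M | x \in H}.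

HB.instance Definition _ H := SubChoice.on (submod H).
HB.instance Definition _ H := GRing.SubChoice_isSubLmodule.Build R M (mem H)
  (submod H) (GRing.subsemimodClosedP H).

(* submodClosed does not carry closure under opposites, which zmodule
   quotients ask for. *)
Definition submod_pred H : {pred M} := mem H.

Lemma submod_pred_zmod H : zmod_closed (submod_pred H).
Proof.
split=> [|x y Hx Hy]; first exact: rpred0.
by rewrite -scaleN1r; apply: rpredD => //; apply: rpredZ.
Qed.

HB.instance Definition _ H :=
  GRing.isZmodClosed.Build M (submod_pred H) (submod_pred_zmod H).

Definition quotmod H : Type := Quotient.quot (submod_pred H).

HB.instance Definition _ H := GRing.Zmodule.on (quotmod H).

Definition quot_pi H (x : M) : quotmod H :=
  \pi_(Quotient.quot (submod_pred H)) x.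

Lemma quot_piP H (x : quotmod H) : exists y, x = quot_pi H y.
Proof. by exists (repr x); rewrite /quot_pi reprK. Qed.

Lemma quot_pi_eq H (x y : M) : quot_pi H x = quot_pi H y <-> x - y \in H.
Proof.
split=> [/eqP|xy].
  by change (quot_pi H x == quot_pi H y -> x - y \in submod_pred H);
     rewrite Quotient.idealrBE.
by apply/eqP; rewrite /quot_pi -Quotient.idealrBE.
Qed.

Lemma quot_piD H (x y : M) : quot_pi H (x + y) = quot_pi H x + quot_pi H y.
Proof. exact: pi_addr. Qed.

Definition quot_scale H (a : R) (x : quotmod H) : quotmod H :=
  quot_pi H (a *: repr x).

Lemma quot_piZ H a (x : M) : quot_scale a (quot_pi H x) = quot_pi H (a *: x).
Proof.
apply/quot_pi_eq; rewrite -scalerBr; apply/rpredZ/quot_pi_eq.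
by rewrite /quot_pi reprK.
Qed.

Lemma quot_scalerA H a b (x : quotmod H) :
  quot_scale a (quot_scale b x) = quot_scale (a * b) x.
Proof. by have [y ->] := quot_piP x; rewrite !quot_piZ scalerA. Qed.

Lemma quot_scale1r H : left_id 1 (@quot_scale H).
Proof. by move=> x; have [y ->] := quot_piP x; rewrite quot_piZ scale1r. Qed.

Lemma quot_scalerDr H : right_distributive (@quot_scale H) +%R.
Proof.
move=> a x y; have [x' ->] := quot_piP x; have [y' ->] := quot_piP y.
by rewrite -quot_piD !quot_piZ scalerDr quot_piD.
Qed.

Lemma quot_scalerDl H (x : quotmod H) :
  {morph (@quot_scale H)^~ x : a b / a + b}.
Proof.
by move=> a b; have [y ->] := quot_piP x; rewrite !quot_piZ scalerDl quot_piD.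
Qed.

HB.instance Definition _ H := GRing.Zmodule_isLmodule.Build R (quotmod H)
  (@quot_scalerA H) (@quot_scale1r H) (@quot_scalerDr H) (@quot_scalerDl H).

End Submodules.

Section SubmoduleConstructions.
Variables (R : pzRingType) (M : lmodType R).
Implicit Types (H K : submodClosed M).

(* For H <= K this is K / H; in general it is K / (K :&: H) = (K + H) / H. *)
Definition comap_pred K H : {pred submod K} := fun x => val x \in H.
Arguments comap_pred : clear implicits.

Lemma comap_submod K H : submod_closed (comap_pred K H).
Proof.
have E z : (z \in comap_pred K H) = (val z \in H) by [].
split=> [|a x y]; rewrite !E; first by rewrite raddf0; apply: rpred0.
by move=> Hx Hy; rewrite linearP; apply: rpredD => //; apply: rpredZ.
Qed.

HB.instance Definition _ K H :=
  GRing.isSubmodClosed.Build R (submod K) (comap_pred K H)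
    (GRing.submod_closed_semi (comap_submod K H)).

Definition subquot K H : lmodType R :=
  quotmod (comap_pred K H : submodClosed (submod K)).

Definition zeroS_pred : {pred M} := pred1 0.

Lemma zeroS_submod : submod_closed zeroS_pred.
Proof.
split=> [|a x y]; rewrite !unfold_in // => /eqP-> /eqP->.
by rewrite scaler0 addr0.
Qed.

HB.instance Definition _ := GRing.isSubmodClosed.Build R M zeroS_pred
  (GRing.submod_closed_semi zeroS_submod).

Definition zeroS : submodClosed M := zeroS_pred.

Definition addS_pred H K : {pred M} :=
  fun x => `[< exists y z, [/\ y \in H, z \in K & x = y + z] >].

Lemma addS_submod H K : submod_closed (addS_pred H K).
Proof.
split=> [|a x y]; rewrite !unfold_in.
  by apply/asboolP; exists 0, 0; rewrite !rpred0 addr0.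
move=> /asboolP[x1 [x2 [Hx1 Kx2 ->]]] /asboolP[y1 [y2 [Hy1 Ky2 ->]]].
apply/asboolP; exists (a *: x1 + y1), (a *: x2 + y2).
by rewrite !rpredD ?rpredZ// scalerDr addrACA.
Qed.

HB.instance Definition _ H K := GRing.isSubmodClosed.Build R M (addS_pred H K)
  (GRing.submod_closed_semi (addS_submod H K)).

Definition addS H K : submodClosed M := addS_pred H K.

Definition imS_pred (phi : {linear M -> M}) H : {pred M} :=
  fun x => `[< exists2 y, y \in H & x = phi y >].

Lemma imS_submod phi H : submod_closed (imS_pred phi H).
Proof.
split=> [|a x y]; rewrite !unfold_in.
  by apply/asboolP; exists 0; rewrite ?rpred0 ?raddf0.
move=> /asboolP[x' Hx ->] /asboolP[y' Hy ->]; apply/asboolP.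
by exists (a *: x' + y'); rewrite ?linearP // rpredD ?rpredZ.
Qed.

HB.instance Definition _ phi H :=
  GRing.isSubmodClosed.Build R M (imS_pred phi H)
    (GRing.submod_closed_semi (imS_submod phi H)).

Definition imS phi H : submodClosed M := imS_pred phi H.

Definition fingenS H := exists n (g : 'I_n -> M),
  forall x, x \in H <-> exists c : 'I_n -> R, x = \sum_i c i *: g i.

End SubmoduleConstructions.

Section LengthFunctions.
Variables (K : realType) (S : pzRingType).

Definition additive_fun (L : lmodType S -> \bar K) :=
  forall (M' M M'' : lmodType S) (f : {linear M' -> M}) (g : {linear M -> M''}),
    injective f -> range g = setT -> range f = [set x | g x = 0] ->
    L M = (L M' + L M'')%E.

Record length_function (L : lmodType S -> \bar K) : Prop := {
  length_ge0 : forall M, (0 <= L M)%E;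
  length_zero : forall M : lmodType S, (forall x : M, x = 0) -> L M = 0%E;
  length_iso : forall (M M' : lmodType S) (f : {linear M -> M'}),
    bijective f -> L M = L M';
  length_additive : additive_fun L;
  length_upper_continuous : forall M : lmodType S,
    L M = ereal_sup [set L (submod F) | F in [set F : submodClosed M | fingenS F]]
}.

End LengthFunctions.

(* Restriction of scalars along f; on the carrier it is the identity. *)
Definition restr (A B : pzRingType) (f : {rmorphism A -> B}) (M : lmodType B)
  : Type := M.

Section Restriction.
Variables (A B : pzRingType) (f : {rmorphism A -> B}) (M : lmodType B).

HB.instance Definition _ := GRing.Zmodule.on (restr f M).

Definition restr_scale (a : A) (x : restr f M) : restr f M := f a *: (x : M).

Lemma restr_scalerA a b x :
  restr_scale a (restr_scale b x) = restr_scale (a * b) x.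
Proof. by rewrite /restr_scale scalerA rmorphM. Qed.

Lemma restr_scale1r : left_id 1 restr_scale.
Proof. by move=> x; rewrite /restr_scale rmorph1 scale1r. Qed.

Lemma restr_scalerDr : right_distributive restr_scale +%R.
Proof. by move=> a x y; rewrite /restr_scale scalerDr. Qed.

Lemma restr_scalerDl x : {morph restr_scale^~ x : a b / a + b}.
Proof. by move=> a b; rewrite /restr_scale rmorphD scalerDl. Qed.

HB.instance Definition _ := GRing.Zmodule_isLmodule.Build A (restr f M)
  restr_scalerA restr_scale1r restr_scalerDr restr_scalerDl.

End Restriction.

Section RestrictionMorphism.
Variables (A B : pzRingType) (f : {rmorphism A -> B}) (M N : lmodType B).

Definition restr_map (phi : {linear M -> N}) : restr f M -> restr f N := phi.

Lemma restr_map_linear phi : linear (restr_map phi).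
Proof. by move=> a x y; rewrite /restr_map linearP. Qed.

HB.instance Definition _ phi :=
  GRing.isLinear.Build A (restr f M) (restr f N) _ (restr_map phi)
    (restr_map_linear phi).

End RestrictionMorphism.

Arguments restr_map {A B} f {M N} phi x.

(* M with 'X acting as phi, see polymodX and polymodC below. *)
Definition polymod (R : comNzRingType) (M : lmodType R) (phi : {linear M -> M})
  : Type := M.

Section PolyModule.
Variables (R : comNzRingType) (M : lmodType R) (phi : {linear M -> M}).

HB.instance Definition _ := GRing.Zmodule.on (polymod phi).

Definition polymod_scale (p : {poly R}) (x : polymod phi) : polymod phi :=
  \sum_(i < size p) p`_i *: (iter i phi x : M).

Lemma polymod_scaleE n (p : {poly R}) x : (size p <= n)%N ->
  polymod_scale p x = \sum_(i < n) p`_i *: (iter i phi x : M).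
Proof.
move=> pn; rewrite /polymod_scale.
rewrite (big_ord_widen _ (fun i => p`_i *: (iter i phi x : M)) pn) big_mkcond /=.
by apply: eq_bigr => i _; case: ltnP => // /(nth_default 0) ->; rewrite scale0r.
Qed.

Lemma iter_linear i : linear (iter i phi).
Proof. by elim: i => [|i IH] a x y //=; rewrite IH linearP. Qed.

HB.instance Definition _ i := GRing.isLinear.Build R M M _ (iter i phi)
  (iter_linear i).

Lemma polymod_scalerDr : right_distributive polymod_scale +%R.
Proof.
move=> p x y; rewrite /polymod_scale -big_split /=; apply: eq_bigr => i _.
by rewrite linearD scalerDr.
Qed.

Lemma polymod_scalerDl x : {morph polymod_scale^~ x : p q / p + q}.
Proof.
move=> p q; pose n := maxn (size p) (size q).
rewrite (@polymod_scaleE n (p + q)) ?size_polyD// (@polymod_scaleE n p) ?leq_maxl//.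
rewrite (@polymod_scaleE n q) ?leq_maxr// -big_split /=; apply: eq_bigr => i _.
by rewrite coefD scalerDl.
Qed.

Lemma polymod_scaleC a x : polymod_scale a%:P x = a *: (x : M).
Proof.
by rewrite (@polymod_scaleE 1) ?size_polyC_leq1// big_ord1 coefC.
Qed.

Lemma polymod_scaleMX p x : polymod_scale (p * 'X) x = polymod_scale p (phi x).
Proof.
rewrite (@polymod_scaleE (size p).+1) ?size_polyMleq//; last first.
  by rewrite (leq_trans (size_polyMleq _ _))// size_polyX addn2.
rewrite big_ord_recl coefMX /= scale0r add0r; apply: eq_bigr => i _.
by rewrite coefMX /= -iterSr.
Qed.

Lemma polymod_scale1r : left_id 1 polymod_scale.
Proof. by move=> x; rewrite polymod_scaleC scale1r. Qed.

Lemma polymod_scale_phi p x : polymod_scale p (phi x) = phi (polymod_scale p x).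
Proof.
rewrite /polymod_scale linear_sum; apply: eq_bigr => i _.
by rewrite linearZ -iterSr.
Qed.

Lemma polymod_scaleZ p a x :
  polymod_scale p (a *: (x : M)) = a *: (polymod_scale p x : M).
Proof.
rewrite /polymod_scale scaler_sumr; apply: eq_bigr => i _.
by rewrite linearZ /= !scalerA mulrC.
Qed.

Lemma polymod_scalerA p q x :
  polymod_scale p (polymod_scale q x) = polymod_scale (p * q) x.
Proof.
move: p x; apply: poly_ind => [|p c IH] x.
  by rewrite mul0r /polymod_scale size_poly0 !big_ord0.
rewrite polymod_scalerDl polymod_scaleMX polymod_scaleC mulrDl polymod_scalerDl.
rewrite -mulrA (mulrC 'X) mulrA polymod_scaleMX -IH.
rewrite (polymod_scale_phi q); congr (_ + _).
rewrite mul_polyC (@polymod_scaleE (size q) (c *: q)) ?size_scale_leq//.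
by rewrite scaler_sumr; apply: eq_bigr => i _; rewrite coefZ scalerA.
Qed.

HB.instance Definition _ := GRing.Zmodule_isLmodule.Build {poly R} (polymod phi)
  polymod_scalerA polymod_scale1r polymod_scalerDr polymod_scalerDl.

Lemma polymodX (x : polymod phi) : 'X *: x = phi x.
Proof. by rewrite -['X]mul1r [LHS]polymod_scaleMX polymod_scale1r. Qed.

Lemma polymodC a (x : polymod phi) : a%:P *: x = a *: (x : M).
Proof. exact: polymod_scaleC. Qed.

End PolyModule.

Section PolyRestriction.
Variables (R : comNzRingType) (N : lmodType {poly R}).

Definition restrC : lmodType R := restr (@polyC R) N.

Definition mulX (x : restrC) : restrC := 'X *: (x : N).

Lemma mulX_linear : linear mulX.
Proof.
move=> a x y; rewrite /mulX scalerDr; congr (_ + _).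
by rewrite [LHS]scalerA mulrC -scalerA.
Qed.

HB.instance Definition _ := GRing.isLinear.Build R restrC restrC _ mulX
  mulX_linear.

End PolyRestriction.

(* The tensor product of M and A over R, as a left A-module. *)
Section Tensor.
Variables (R : comNzRingType) (M : lmodType R) (A : algType R).

(* A list [:: (m1, a1); ...] stands for the formal sum m1 (x) a1 + ... ; two
   formal sums are the same tensor iff no R-bilinear map separates them. *)
Definition tensor_eq (s t : seq (M * A)) : bool :=
  `[< forall (T : lmodType R) (b : {bilinear M -> A -> T}),
        \sum_(u <- s) b u.1 u.2 = \sum_(u <- t) b u.1 u.2 >].

Lemma tensor_eq_is_equiv : equiv_class_of tensor_eq.
Proof.
split=> [s|s t|t s r]; first by apply/asboolP.
  by apply/asboolP/asboolP => st T b; rewrite st.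
by move=> /asboolP st /asboolP tr; apply/asboolP => T b; rewrite st tr.
Qed.

Canonical tensor_equiv := EquivRelPack tensor_eq_is_equiv.

Definition tensor : Type := {eq_quot tensor_eq}.

HB.instance Definition _ := Choice.on tensor.

Definition tpi (s : seq (M * A)) : tensor := \pi_({eq_quot tensor_eq}) s.

Definition tmk (m : M) (a : A) : tensor := tpi [:: (m, a)].

Lemma tpiP (x : tensor) : exists s, x = tpi s.
Proof. by exists (repr x); rewrite /tpi reprK. Qed.

Lemma tpi_eq s t : tpi s = tpi t <->
  forall (T : lmodType R) (b : {bilinear M -> A -> T}),
    \sum_(u <- s) b u.1 u.2 = \sum_(u <- t) b u.1 u.2.
Proof.
split=> [/eqmodP /asboolP //|st].
by apply/eqmodP/asboolP.
Qed.

Lemma repr_tpi s (T : lmodType R) (b : {bilinear M -> A -> T}) :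
  \sum_(u <- repr (tpi s)) b u.1 u.2 = \sum_(u <- s) b u.1 u.2.
Proof. by apply: (tpi_eq _ _).1; rewrite {1}/tpi reprK. Qed.

Definition topp_seq (s : seq (M * A)) := [seq (- u.1, u.2) | u <- s].
Definition tscale_seq (c : A) (s : seq (M * A)) := [seq (u.1, c * u.2) | u <- s].

Definition tzero : tensor := tpi [::].
Definition tadd (x y : tensor) : tensor := tpi (repr x ++ repr y).
Definition topp (x : tensor) : tensor := tpi (topp_seq (repr x)).
Definition tscale (c : A) (x : tensor) : tensor := tpi (tscale_seq c (repr x)).

Definition bil_mull (c : A) (T : lmodType R) (b : {bilinear M -> A -> T})
  (m : M) (a : A) : T := b m (c * a).

Lemma bil_mull_bilinear c (T : lmodType R) (b : {bilinear M -> A -> T}) :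
  bilinear_for *:%R *:%R (bil_mull c b).
Proof.
split=> [a r x y|m r x y]; rewrite /bil_mull; first by rewrite linearPl.
by rewrite mulrDr -scalerAr linearPr.
Qed.

HB.instance Definition _ c (T : lmodType R) (b : {bilinear M -> A -> T}) :=
  bilinear_isBilinear.Build R M A T _ _ (bil_mull c b) (bil_mull_bilinear c b).

Lemma tpiD s t : tadd (tpi s) (tpi t) = tpi (s ++ t).
Proof. by apply/tpi_eq => T b; rewrite !big_cat /= !repr_tpi. Qed.

Lemma tpiN s : topp (tpi s) = tpi (topp_seq s).
Proof.
apply/tpi_eq => T b; rewrite !big_map /=.
have E t : \sum_(u <- t) b (- u.1) u.2 = - \sum_(u <- t) b u.1 u.2.
  by rewrite -sumrN; apply: eq_bigr => u _; rewrite linearNl.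
by rewrite !E repr_tpi.
Qed.

Lemma tpiZ c s : tscale c (tpi s) = tpi (tscale_seq c s).
Proof.
by apply/tpi_eq => T b; rewrite !big_map /= (repr_tpi s (bil_mull c b)).
Qed.

Lemma taddA : associative tadd.
Proof.
move=> x y z; have [r ->] := tpiP x; have [s ->] := tpiP y.
by have [t ->] := tpiP z; rewrite !tpiD catA.
Qed.

Lemma taddC : commutative tadd.
Proof.
move=> x y; have [r ->] := tpiP x; have [s ->] := tpiP y; rewrite !tpiD.
by apply/tpi_eq => T b; rewrite !big_cat /= addrC.
Qed.

Lemma tadd0 : left_id tzero tadd.
Proof. by move=> x; have [r ->] := tpiP x; rewrite tpiD. Qed.

Lemma taddN : left_inverse tzero topp tadd.
Proof.
move=> x; have [r ->] := tpiP x; rewrite tpiN tpiD; apply/tpi_eq => T b.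
rewrite big_cat big_map big_nil /= -big_split /=; apply: big1 => u _.
by rewrite linearNl addNr.
Qed.

HB.instance Definition _ := GRing.isZmodule.Build tensor taddA taddC tadd0 taddN.

Lemma tscaleA c d x : tscale c (tscale d x) = tscale (c * d) x.
Proof.
have [s ->] := tpiP x; rewrite !tpiZ; congr tpi.
by rewrite /tscale_seq -map_comp; apply: eq_map => u /=; rewrite mulrA.
Qed.

Lemma tscale1 : left_id 1 tscale.
Proof.
move=> x; have [s ->] := tpiP x; rewrite tpiZ; congr tpi.
by rewrite /tscale_seq -[RHS]map_id; apply: eq_map => -[u a] /=; rewrite mul1r.
Qed.

Lemma tscaleDr : right_distributive tscale +%R.
Proof.
move=> c x y; have [r ->] := tpiP x; have [s ->] := tpiP y.
by rewrite [_ + _]tpiD !tpiZ [RHS]tpiD /tscale_seq map_cat.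
Qed.

Lemma tscaleDl x : {morph tscale^~ x : c d / c + d}.
Proof.
move=> c d; have [s ->] := tpiP x; rewrite !tpiZ [RHS]tpiD.
apply/tpi_eq => T b; rewrite big_cat !big_map /= -big_split /=.
by apply: eq_bigr => u _; rewrite mulrDl linearDr.
Qed.

HB.instance Definition _ := GRing.Zmodule_isLmodule.Build A tensor
  tscaleA tscale1 tscaleDr tscaleDl.

End Tensor.

Section Entropy.
Variables (K : realType) (R : comNzRingType) (Lv : lmodType R -> \bar K).

Section Endomorphism.
Variables (M : lmodType R) (phi : {linear M -> M}).

(* H + phi H + ... + phi^(n-1) H *)
Definition traj (H : submodClosed M) (n : nat) : submodClosed M :=
  \big[@addS R M/zeroS M]_(i < n) iter i (imS phi) H.

Definition inert : set (submodClosed M) :=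
  [set H | (Lv (subquot (addS H (imS phi H)) H) < +oo)%E].

Definition ent_at (H : submodClosed M) : \bar K :=
  lim ((fun n => Lv (subquot (traj H n) H) * (n%:R^-1)%:E)%E @ \oo).

Definition ent_phi : \bar K := ereal_sup [set ent_at H | H in inert].

End Endomorphism.

(* Every R[X]-module N is its restriction to R with the action of 'X. *)
Definition intrinsic_entropy (N : lmodType {poly R}) : \bar K :=
  ent_phi (@mulX R N).

End Entropy.

Section ValuationLength.
Variables (K : realType) (Q : fieldType) (v : valuation K Q).
Local Notation R := (valring v).

(* By Northcott and Reufel exactly one function satisfies this predicate. *)
Definition valuation_length (Lv : lmodType R -> \bar K) :=
  length_function Lv /\
  forall I : submodClosed R^o,
    Lv (quotmod I) = ereal_inf [set v (valring_val v r) | r in [set r : R | r \in I]].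

Definition charpoly (V : vectType Q) (phi : {linear V -> V}) : {poly Q} :=
  char_poly (passmx.mxof (vbasis {:V}) (vbasis {:V}) (linfun phi)).

(* P is the polynomial s p, which thus has its coefficients in R. *)
Definition clears (p : {poly Q}) (s : R) (P : {poly R}) :=
  map_poly (valring_val v) P = valring_val v s *: p.

(* s has minimal value among the elements of R that clear the denominators of
   the characteristic polynomial; s, hence P, is unique up to a unit of R. *)
Definition charpoly_over (V : vectType Q) (phi : {linear V -> V})
    (P : {poly R}) :=
  exists s : R, clears (charpoly phi) s P /\
    forall (t : R) (P' : {poly R}), clears (charpoly phi) t P' ->
      (v (valring_val v s) <= v (valring_val v t))%E.

Definition restrQ (V : lmodType Q) (phi : {linear V -> V}) : lmodType {poly R} :=
  @polymod R (restr (valring_val v) V) (restr_map (valring_val v) phi).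

End ValuationLength.

(* Main.v *)
Require Import Defs.
From HB Require Import structures.
From mathcomp Require Import all_boot all_order all_algebra.
From mathcomp Require Import sesquilinear lra.
From mathcomp Require Import all_classical all_reals all_analysis.

Set Implicit Arguments.
Unset Strict Implicit.
Unset Printing Implicit Defensive.

Import Order.TTheory GRing.Theory Num.Theory.
Import numFieldNormedType.Exports.

Local Open Scope classical_set_scope.
Local Open Scope ring_scope.

(** The intrinsic entropy is controlled by growth rates.  Write X for the
    endomorphism and T_n for H + X H + ... + X^(n-1) H.  Multiplication by X
    maps T_(n+1) / T_n onto T_(n+2) / T_(n+1), so the lengths of these
    quotients decrease ([rateS]); if H is inert they are finite, and by the
    Cesaro theorem the entropy at H is their infimum ([ent_atE]).

    The entropy is a length function.  Subadditivity on an exact sequence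
    N' -> N -> N'' comes from one inequality ([rate_subadd]): if A is the part
    of T_(j+2) that lies in N', then the rate of H at index n + j + 1 is at most
    the rate of A at n plus the rate of the image of H at j.  An inert H can
    be replaced, up to e, by a finitely generated submodule
    ([rate_fg_approx], [ent_fg_le]), whence upper continuity.  For
    superadditivity two cases are distinguished.  If some x in N generates a
    free R[X]-module, then R x + r R[X] x has growth rate v(r) for every
    non-zero r, so the entropy is infinite ([ent_free]).  Otherwise every
    finitely generated R-submodule has finite rates from some index on
    ([span_rate_fin]).  One lifts generators and compares the lengths of the
    trajectories themselves, which grow linearly: the error is the length of a
    torsion subquotient of a finitely generated module, and it is bounded
    ([tors_bounded], [limrate_superadd]).

    In M (x) R[X] the submodule M (x) 1 generates and has constant rate L_v(M)
    ([ent_tensor]).  For a transformation of a finite dimensional space,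
    additivity and a block triangular form reduce the claim to the cyclic
    case ([ent_mx]).  There T_(m+1) / T_m for a cyclic vector x is R modulo
    the leading coefficients of the integral multiples of the characteristic
    polynomial p, and by Gauss's lemma this ideal is s R when s p is primitive
    ([cyc_lead]).

    For uniqueness let L satisfy the same conditions.  If N is R-torsion and
    generated by a finitely generated R-module F, then N is a quotient of the
    cokernel of the injection t |-> t X - X t from T_(n+1) (x) R[X] to
    T_(n+2) (x) R[X], so L(N) is at most the n-th rate of F ([L_le_rate]).
    Hence L is at most the entropy on R-torsion modules.  Both take the same
    finite value on F (x) R[X], which is an extension of N by the kernel of
    F (x) R[X] -> N, hence they agree on N ([eq_tors]).  A cyclic module that
    is not free maps, with R-torsion kernel and cokernel, to a finite
    dimensional space Q[X] / (p) ([eq_cyclic]), where the values are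
    prescribed and finite; additivity and upper continuity do the rest. *)

(** * Submodules and linear maps *)

Section SubmoduleToolkit.
Variable R : pzRingType.

Lemma addSP (M : lmodType R) (H K : submodClosed M) x :
  reflect (exists y z, [/\ y \in H, z \in K & x = y + z]) (x \in addS H K).
Proof. exact: asboolP. Qed.

Lemma zeroSP (M : lmodType R) x : reflect (x = 0) (x \in zeroS M).
Proof. exact: eqP. Qed.

Lemma addSl (M : lmodType R) (H K : submodClosed M) x : x \in H -> x \in addS H K.
Proof. by move=> Hx; apply/addSP; exists x, 0; rewrite rpred0 addr0. Qed.

Lemma addSr (M : lmodType R) (H K : submodClosed M) x : x \in K -> x \in addS H K.
Proof. by move=> Kx; apply/addSP; exists 0, x; rewrite rpred0 add0r. Qed.

Lemma memSN (M : lmodType R) (H : submodClosed M) x : x \in H -> - x \in H.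
Proof. by move=> Hx; rewrite -scaleN1r rpredZ. Qed.

Lemma memSB (M : lmodType R) (H : submodClosed M) x y :
  x \in H -> y \in H -> x - y \in H.
Proof. by move=> Hx Hy; rewrite rpredD ?memSN. Qed.

Section Maps.
Variables (M N : lmodType R) (f : {linear M -> N}).

(** Membership predicates are given a name of their own because submodules
    are inferred from predicates through canonical structures. *)
Definition preS_pred (H : submodClosed N) : {pred M} := fun x => f x \in H.

Lemma preS_submod H : submod_closed (preS_pred H).
Proof.
have E z : (z \in preS_pred H) = (f z \in H) by [].
split=> [|a x y]; rewrite !E; first by rewrite raddf0 rpred0.
by move=> Hx Hy; rewrite linearP rpredD ?rpredZ.
Qed.

HB.instance Definition _ H := GRing.isSubmodClosed.Build R M (preS_pred H)
  (GRing.submod_closed_semi (preS_submod H)).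

Definition preS H : submodClosed M := preS_pred H.

Lemma preSE (H : submodClosed N) x : (x \in preS H) = (f x \in H).
Proof. by []. Qed.

Definition imgS_pred (H : submodClosed M) : {pred N} :=
  fun y => `[< exists2 x, x \in H & y = f x >].

Lemma imgS_submod H : submod_closed (imgS_pred H).
Proof.
split=> [|a x y]; rewrite !unfold_in.
  by apply/asboolP; exists 0; rewrite ?rpred0 ?raddf0.
move=> /asboolP[x' Hx ->] /asboolP[y' Hy ->]; apply/asboolP.
by exists (a *: x' + y'); rewrite ?linearP // rpredD ?rpredZ.
Qed.

HB.instance Definition _ H := GRing.isSubmodClosed.Build R N (imgS_pred H)
  (GRing.submod_closed_semi (imgS_submod H)).

Definition imgS H : submodClosed N := imgS_pred H.

Lemma imgSP (H : submodClosed M) y : reflect (exists2 x, x \in H & y = f x) (y \in imgS H).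
Proof. exact: asboolP. Qed.

Lemma imgS_f (H : submodClosed M) x : x \in H -> f x \in imgS H.
Proof. by move=> Hx; apply/imgSP; exists x. Qed.

End Maps.

Section Basic.
Variable M : lmodType R.

Definition fullS_pred : {pred M} := predT.

Lemma fullS_submod : submod_closed fullS_pred.
Proof. by []. Qed.

HB.instance Definition _ := GRing.isSubmodClosed.Build R M fullS_pred
  (GRing.submod_closed_semi fullS_submod).

Definition fullS : submodClosed M := fullS_pred.

Lemma fullSE x : x \in fullS. Proof. by []. Qed.

Definition capS_pred (H K : submodClosed M) : {pred M} :=
  fun x => (x \in H) && (x \in K).

Lemma capS_submod H K : submod_closed (capS_pred H K).
Proof.
have E z : (z \in capS_pred H K) = (z \in H) && (z \in K) by [].
split=> [|a x y]; rewrite !E ?rpred0 //.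
by move=> /andP[Hx Kx] /andP[Hy Ky]; rewrite !rpredD ?rpredZ.
Qed.

HB.instance Definition _ H K := GRing.isSubmodClosed.Build R M (capS_pred H K)
  (GRing.submod_closed_semi (capS_submod H K)).

Definition capS H K : submodClosed M := capS_pred H K.

Lemma capSE (H K : submodClosed M) x : (x \in capS H K) = (x \in H) && (x \in K).
Proof. by []. Qed.

Definition lineS_pred (x : M) : {pred M} := fun y => `[< exists a : R, y = a *: x >].

Lemma lineS_submod x : submod_closed (lineS_pred x).
Proof.
split=> [|a y z]; rewrite !unfold_in.
  by apply/asboolP; exists 0; rewrite scale0r.
move=> /asboolP[b ->] /asboolP[c ->]; apply/asboolP.
by exists (a * b + c); rewrite scalerDl scalerA.
Qed.

HB.instance Definition _ x := GRing.isSubmodClosed.Build R M (lineS_pred x)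
  (GRing.submod_closed_semi (lineS_submod x)).

Definition lineS x : submodClosed M := lineS_pred x.

Lemma lineSP x y : reflect (exists a : R, y = a *: x) (y \in lineS x).
Proof. exact: asboolP. Qed.

Definition spanS (s : seq M) : submodClosed M :=
  foldr (fun x H => addS (lineS x) H) (zeroS M) s.

Lemma spanS_le s (H : submodClosed M) :
  (forall x, x \in s -> x \in H) -> forall y, y \in spanS s -> y \in H.
Proof.
elim: s => [_ y /zeroSP -> |x s IH sH y]; first exact: rpred0.
move=> /addSP[_ [z [/lineSP[a ->] zs ->]]]; rewrite rpredD ?rpredZ ?(sH x) ?mem_head //.
by apply: (IH _ z zs) => w ws; rewrite sH // inE ws orbT.
Qed.

Lemma mem_spanS s x : x \in s -> x \in spanS s.
Proof.
elim: s => //= y s IH; rewrite inE => /orP[/eqP ->|/IH xs]; last exact: addSr.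
by apply: addSl; apply/lineSP; exists 1; rewrite scale1r.
Qed.

Lemma fingen_spanS s : fingenS (spanS s).
Proof.
exists (size s), (tnth (in_tuple s)) => x; split.
- elim: s x => [|y s IH] x /=.
    by move=> /zeroSP ->; exists (fun=> 0); rewrite big_ord0.
  move=> /addSP[_ [z [/lineSP[a ->] /IH[c ->] ->]]].
  exists (fun i => if unlift ord0 i is Some j then c j else a).
  rewrite big_ord_recl unlift_none; congr (_ + _).
  by apply: eq_bigr => i _; rewrite liftK !(tnth_nth 0).
- move=> [c ->]; apply: rpred_sum => i _; apply: rpredZ; apply: mem_spanS.
  exact: mem_tnth.
Qed.

Lemma fingenP (F : submodClosed M) : fingenS F -> exists s, F =i spanS s.
Proof.
move=> [n [g Fg]]; exists [seq g i | i <- enum 'I_n] => x.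
apply/idP/idP => [/Fg[c ->]|].
  apply: rpred_sum => i _; apply/rpredZ/mem_spanS/map_f.
  by rewrite mem_enum.
apply: spanS_le => {}x /mapP[i _ ->]; apply/Fg.
exists (fun j => (j == i)%:R); rewrite (bigD1 i) //= eqxx scale1r big1 ?addr0//.
by move=> j /negPf ->; rewrite scale0r.
Qed.

End Basic.

Section Classes.
Variables (M : lmodType R) (A B : submodClosed M).

Definition cls (x : submod A) : subquot A B := quot_pi (comap_pred B) x.

Lemma cls_eq x y : cls x = cls y <-> val x - val y \in B.
Proof. by rewrite /cls quot_pi_eq unfold_in /comap_pred raddfB. Qed.

Lemma clsP (u : subquot A B) : exists x, u = cls x.
Proof. exact: quot_piP. Qed.

Lemma cls_linear : linear cls.
Proof. by move=> a x y; rewrite /cls quot_piD -quot_piZ. Qed.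

HB.instance Definition _ := GRing.isLinear.Build R (submod A) (subquot A B) _
  cls cls_linear.

Lemma cls_eq0 x : cls x = 0 <-> val x \in B.
Proof. by rewrite -(raddf0 cls) cls_eq !raddf0 addr0. Qed.

End Classes.

(** Subquotients are quotients of subtypes, so a map between them has to choose
    representatives; the equation in the conclusion is all that is used of
    the map. *)
Lemma subquot_map (M N : lmodType R) (f : {linear M -> N})
    (A B : submodClosed M) (A' B' : submodClosed N) :
  (forall x, x \in A -> f x \in A') ->
  (forall x, x \in A -> x \in B -> f x \in B') ->
  exists g : {linear subquot A B -> subquot A' B'},
    forall (x : submod A) (y : submod A'), f (val x) = val y ->
      g (cls B x) = cls B' y.
Proof.
move=> fA fB.
have fA' (x : submod A) : f (val x) \in A' by exact/fA/valP.
pose g0 (x : subquot A B) : subquot A' B' :=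
  cls B' (Sub (f (val (repr x))) (fA' (repr x)) : submod A').
have g0E (x : submod A) (y : submod A') : f (val x) = val y ->
    g0 (cls B x) = cls B' y.
  move=> fxy; apply/cls_eq; rewrite SubK -fxy -raddfB; apply: fB.
    by apply: memSB; apply: valP.
  by apply/cls_eq; rewrite /cls /quot_pi reprK.
have g0_lin : linear g0.
  move=> a x y; have [x' ->] := clsP x; have [y' ->] := clsP y.
  pose z u : submod A' := Sub (f (val u)) (fA' u).
  have zE u : f (val u) = val (z u) by rewrite SubK.
  rewrite -linearP (g0E x' (z x')) // (g0E y' (z y')) // -linearP.
  by apply: g0E; rewrite !linearP !zE.
pose g1 := GRing.isLinear.Build _ _ _ _ g0 g0_lin.
pose g : {linear subquot A B -> subquot A' B'} := HB.pack g0 g1.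
by exists g.
Qed.

Lemma submod_scale_eq0 (M : lmodType R) (H : submodClosed M) a (x : submod H) :
  a *: val x = 0 -> a *: x = 0.
Proof.
move=> ax; have E : val (a *: x) = a *: val x by exact: linearZ.
by apply: val_inj; rewrite [LHS]E ax; exact/esym/raddf0.
Qed.

Definition scalev (M : lmodType R) (x : M) : R^o -> M := fun a => (a : R) *: x.

Lemma scalev_linear (M : lmodType R) (x : M) : linear (scalev x).
Proof. by move=> a b c; rewrite /scalev scalerDl scalerA. Qed.

HB.instance Definition _ (M : lmodType R) (x : M) :=
  GRing.isLinear.Build R R^o M _ (scalev x) (scalev_linear x).

End SubmoduleToolkit.

Section SpanImages.
Variables (R : pzRingType).

Lemma spanS_sub (M : lmodType R) (s t : seq M) :
  {subset s <= t} -> {subset spanS s <= spanS t}.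
Proof. by move=> st; apply: spanS_le => x /st; exact: mem_spanS. Qed.

Lemma imgS_spanS (M N : lmodType R) (f : {linear M -> N}) (s : seq M) (H : submodClosed N) :
  (forall x, x \in s -> f x \in H) -> {subset imgS f (spanS s) <= H}.
Proof.
move=> sH y /imgSP[x xs ->]; suff : x \in preS f H by [].
exact: spanS_le xs.
Qed.

End SpanImages.

Lemma spanS_lift (R : pzRingType) (M : lmodType R) (F : submodClosed M) (s : seq M) :
  F =i spanS s -> exists t : seq (submod F), forall x, x \in spanS t.
Proof.
move=> Fs; exists [seq insubd (0 : submod F) x | x <- s] => x.
suff : {subset F <= imgS (val : {linear submod F -> M})
    (spanS [seq insubd (0 : submod F) x | x <- s])}.
  by move=> /(_ _ (valP x)) /imgSP[y yt /val_inj ->].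
move=> y; rewrite Fs; apply: spanS_le => {x}z zs; apply/imgSP.
exists (insubd 0 z); first exact/mem_spanS/map_f.
have zF : z \in F by rewrite Fs mem_spanS.
exact/esym/(insubdK 0).
Qed.

Section SubMap.
Variables (R : pzRingType) (M N : lmodType R) (f : {linear M -> N}).

Lemma sub_map (A : submodClosed M) (B : submodClosed N) :
  (forall x, x \in A -> f x \in B) ->
  exists g : {linear submod A -> submod B}, forall x, val (g x) = f (val x).
Proof.
move=> fA; pose g0 (x : submod A) : submod B := Sub (f (val x)) (fA _ (valP x)).
have gE x : val (g0 x) = f (val x) by exact: SubK.
have g_lin : linear g0.
  move=> a x y; have : val (g0 (a *: x + y)) = val (a *: g0 x + g0 y).
    transitivity (a *: f (val x) + f (val y)); first by rewrite gE !linearP.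
    by rewrite linearP; congr (_ *: _ + _); exact/esym/gE.
  exact: val_inj.
pose g : {linear submod A -> submod B} :=
  HB.pack g0 (GRing.isLinear.Build _ _ _ _ g0 g_lin).
by exists g.
Qed.

End SubMap.

Section ScaleMap.
Variables (R : comNzRingType) (M : lmodType R) (r : R).

Definition scaleS (x : M) : M := r *: x.

Lemma scaleS_linear : linear scaleS.
Proof. by move=> a x y; rewrite /scaleS scalerDr !scalerA mulrC. Qed.

HB.instance Definition _ := GRing.isLinear.Build R M M _ scaleS scaleS_linear.

Lemma scaleSC (f : {linear M -> M}) x : scaleS (f x) = f (scaleS x).
Proof. by rewrite /scaleS linearZ. Qed.

End ScaleMap.

(** * Lengths of subquotients *)

(** Adding y commutes with the infimum because neither side takes the value
    -oo; y = +oo is the case that has to be separated. *)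
Lemma le_add_ereal_inf (K : realType) (x y : \bar K) (u : nat -> \bar K) :
  (0 <= y)%E -> (forall n, 0 <= u n)%E -> (forall n, x <= y + u n)%E ->
  (x <= y + ereal_inf (range u))%E.
Proof.
case: y => [y| |] // y0 u0 xu.
  rewrite addeC -leeBlDr //; apply: le_ereal_inf_tmp => _ [n _ <-].
  by rewrite leeBlDr // addeC.
rewrite addye ?leey //.
have : (0 <= ereal_inf (range u))%E by apply: le_ereal_inf_tmp => _ [n _ <-].
by case: ereal_inf.
Qed.

(** Two inequalities that add up to an equality of finite numbers are
    equalities. *)
Lemma add_eq_le (K : realType) (a a' b b' : \bar K) :
  (a <= a')%E -> (b <= b')%E -> (0 <= a)%E -> (0 <= b)%E -> (a + b < +oo)%E ->
  (a + b = a' + b')%E -> b = b'.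
Proof.
case: a a' b b' => [a| |] [a'| |] [b| |] [b'| |] //.
rewrite -!EFinD !lee_fin => aa bb _ _ _ [] ab; congr (_%:E).
apply/eqP; rewrite eq_le bb /=; have : a + b' <= a' + b' by rewrite lerD2r.
by rewrite -ab lerD2l.
Qed.

Section LengthToolkit.
Variables (K : realType) (S : pzRingType) (L : lmodType S -> \bar K).
Hypothesis HL : length_function L.
Implicit Types M N : lmodType S.

Lemma lin_inj M N (f : {linear M -> N}) :
  (forall x, f x = 0 -> x = 0) -> injective f.
Proof.
move=> f0 x y /eqP; rewrite -subr_eq0 -raddfB => /eqP/f0/eqP.
by rewrite subr_eq0 => /eqP.
Qed.

Lemma L_ge0 M : (0 <= L M)%E. Proof. exact: length_ge0. Qed.

Lemma quot_pi_linear M (H : submodClosed M) : linear (quot_pi H).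
Proof. by move=> a x y; rewrite quot_piD -quot_piZ. Qed.

Definition qpi M (H : submodClosed M) : {linear M -> quotmod H} :=
  HB.pack (quot_pi H) (GRing.isLinear.Build _ _ _ _ (quot_pi H) (@quot_pi_linear M H)).

Lemma qpi_eq0 M (H : submodClosed M) x : qpi H x = 0 <-> x \in H.
Proof. by rewrite -(raddf0 (qpi H)) quot_pi_eq subr0. Qed.

Lemma qpi_surj M (H : submodClosed M) (y : quotmod H) : exists x, y = qpi H x.
Proof. exact: quot_piP. Qed.

Lemma L_quot M' M (f : {linear M' -> M}) : injective f ->
  L M = (L M' + L (quotmod (imgS f (fullS M'))))%E.
Proof.
move=> f_inj; apply: (length_additive HL (f := f) (g := qpi _)) => //.
  by apply/seteqP; split=> // y _; have [x ->] := qpi_surj y; exists x.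
apply/seteqP; split=> y /=.
  by move=> [x _ <-]; apply/qpi_eq0/imgS_f.
by move=> /qpi_eq0 /imgSP[x _ ->]; exists x.
Qed.

Lemma L_ker M M'' (g : {linear M -> M''}) : (forall y, exists x, y = g x) ->
  L M = (L (submod (preS g (zeroS M''))) + L M'')%E.
Proof.
move=> g_surj.
apply: (length_additive HL (f := val : {linear submod (preS g (zeroS M'')) -> M}) (g := g)) => //.
- by apply/seteqP; split=> // y _; have [x ->] := g_surj y; exists x.
- apply/seteqP; split=> y /=.
    by move=> [x _ <-]; have := valP x; rewrite preSE => /zeroSP.
  move=> gy; have ky : y \in preS g (zeroS M'') by rewrite preSE; apply/zeroSP.
  by exists (Sub y ky) => //; rewrite SubK.
Qed.

Lemma L_inj M' M (f : {linear M' -> M}) : injective f -> (L M' <= L M)%E.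
Proof. by move=> /L_quot ->; rewrite leeDl ?L_ge0. Qed.

Lemma L_surj M M'' (g : {linear M -> M''}) : (forall y, exists x, y = g x) ->
  (L M'' <= L M)%E.
Proof. by move=> /L_ker ->; rewrite leeDr ?L_ge0. Qed.

(** As in the underlying subquotient, B need not lie in A: this is the length
    of A / (A :&: B). *)
Definition len M (A B : submodClosed M) : \bar K := L (subquot A B).

Lemma len_ge0 M (A B : submodClosed M) : (0 <= len A B)%E.
Proof. exact: L_ge0. Qed.

Section TwoModules.
Variables (M N : lmodType S) (f : {linear M -> N}).
Variables (A B : submodClosed M) (A' B' : submodClosed N).
Hypothesis fA : forall x, x \in A -> f x \in A'.
Hypothesis fB : forall x, x \in A -> x \in B -> f x \in B'.

(** With [len_inj] the only way in which lengths in different modules are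
    compared: the induced map of subquotients is onto, so the length drops. *)
Lemma len_surj : (forall y, y \in A' -> exists2 x, x \in A & y - f x \in B') ->
  (len A' B' <= len A B)%E.
Proof.
move=> fS; have [g gE] := subquot_map fA fB.
apply: (@L_surj _ _ g) => y; have [y' ->] := clsP y.
have [x Ax xy] := fS _ (valP y').
exists (cls B (Sub x Ax : submod A)).
rewrite (gE _ (Sub (f x) (fA Ax) : submod A')) ?SubK //.
by apply/cls_eq; rewrite SubK.
Qed.

Lemma len_inj : (forall x, x \in A -> f x \in B' -> x \in B) ->
  (len A B <= len A' B')%E.
Proof.
move=> fI; have [g gE] := subquot_map fA fB.
apply: (@L_inj _ _ g); apply: lin_inj => y; have [x ->] := clsP y.
rewrite (gE _ (Sub (f (val x)) (fA (valP x)) : submod A')) ?SubK //.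
by move=> /cls_eq0; rewrite SubK => /fI H; apply/cls_eq0/H/valP.
Qed.

End TwoModules.

Lemma len_add M (A B C : submodClosed M) :
  {subset B <= A} -> {subset C <= B} -> len A C = (len B C + len A B)%E.
Proof.
move=> BA CB.
have [f fE] := @subquot_map _ _ _ idfun B C A C BA (fun x _ => id).
have [g gE] := @subquot_map _ _ _ idfun A C A B (fun x => id) (fun x _ => @CB x).
have fE' (x : submod B) : f (cls C x) = cls C (Sub (val x) (BA _ (valP x)) : submod A).
  by apply: fE; rewrite SubK.
apply: (length_additive HL (f := f) (g := g)).
- apply: lin_inj => y; have [x ->] := clsP y.
  by rewrite fE' => /cls_eq0; rewrite SubK => ?; apply/cls_eq0.
- by apply/seteqP; split=> // y _; have [x ->] := clsP y; exists (cls C x); rewrite ?(gE _ x).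
- apply/seteqP; split=> y /=.
    move=> [u _ <-]; have [x ->] := clsP u; rewrite fE'.
    by rewrite (gE _ (Sub (val x) (BA _ (valP x)) : submod A)) //; apply/cls_eq0; rewrite SubK; exact: valP.
  have [x ->] := clsP y; rewrite (gE _ x) // => /cls_eq0 Bx.
  by exists (cls C (Sub (val x) Bx : submod B)) => //; apply: fE; rewrite SubK.
Qed.

Lemma len0 M (A B : submodClosed M) : {subset A <= B} -> len A B = 0%E.
Proof.
move=> AB; apply: (length_zero HL) => y; have [x ->] := clsP y.
by apply/cls_eq0/AB/valP.
Qed.

Lemma len_le M (A B A' B' : submodClosed M) :
  {subset A <= A'} -> {subset B' <= B} -> {subset B <= A'} ->
  (len A B <= len A' B')%E.
Proof.
move=> AA BB BA.
have /(len_add (A := A') (B := B)) /(_ BB) -> := BA.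
apply: (@le_trans _ _ (len A' B)); last by rewrite leeDr // len_ge0.
exact: (@len_inj _ _ idfun).
Qed.

Lemma len_eqm M (A B A' B' : submodClosed M) :
  A =i A' -> B =i B' -> len A B = len A' B'.
Proof.
move=> AA BB; apply/eqP; rewrite eq_le; apply/andP; split;
 by apply: (@len_inj _ _ idfun) => x /=; rewrite -?AA -?BB ?AA ?BB.
Qed.

Lemma len_submod M (A : submodClosed M) : len A (zeroS M) = L (submod A).
Proof.
apply/esym; apply: (@length_iso _ _ _ HL _ _ (cls (zeroS M) : {linear submod A -> subquot A (zeroS M)})).
apply: (@Bijective _ _ _ repr) => [x|x].
  apply: val_inj; apply/eqP; rewrite -subr_eq0; apply/eqP/zeroSP.
  by apply/cls_eq; apply: reprK.
exact: reprK.
Qed.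

Lemma len_full M : len (fullS M) (zeroS M) = L M.
Proof.
rewrite len_submod; apply: (@length_iso _ _ _ HL _ _ (val : {linear submod (fullS M) -> M})).
by exists (fun x => Sub x (fullSE x)) => x; rewrite ?SubK //; apply: val_inj; rewrite SubK.
Qed.

Lemma len_quot M (H : submodClosed M) : len (fullS M) H = L (quotmod H).
Proof.
rewrite -(len_full (quotmod H)); apply/eqP; rewrite eq_le; apply/andP; split.
  apply: (@len_inj _ _ (qpi H)) => x // _; first by move=> /qpi_eq0 /zeroSP.
  by move=> /zeroSP /qpi_eq0.
apply: (@len_surj _ _ (qpi H)) => // [x _|y _].
  by move=> /qpi_eq0 /zeroSP.
by have [x ->] := qpi_surj y; exists x => //; rewrite subrr rpred0.
Qed.

(** Upper continuity of L on A / B, with the generators lifted to A. *)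
Lemma len_approx M (A B : submodClosed M) (e : K) : (0 < e)%R ->
  (len A B < +oo)%E ->
  exists s : seq M, (forall x, x \in s -> x \in A) /\
    (len A (addS (spanS s) B) <= e%:E)%E.
Proof.
move=> e0 AB; pose Q := subquot A B.
have LQ : len A B \is a fin_num by rewrite ge0_fin_numE ?len_ge0.
have := length_upper_continuous HL Q; rewrite -/(len A B) => LQE.
have := LQ; rewrite LQE => /(ub_ereal_sup_adherent e0); rewrite -LQE.
move=> [_ [F Ffg <-]]; have [t Ft] := fingenP Ffg; rewrite -len_submod => ltF.
exists [seq val (repr u) | u <- t]; split.
  by move=> _ /mapP[u _ ->]; apply: valP.
set C := addS _ _.
have CF : (len A C <= len (fullS Q) F)%E.
  apply: (@le_trans _ _ (len (fullS (submod A)) (preS (cls B) F))); last first.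
    exact: (@len_inj _ _ (cls B)).
  apply: (@len_surj _ _ (val : {linear submod A -> M})).
  - by move=> x _; exact: valP.
  - move=> x _; rewrite preSE Ft => xF.
    have : cls B x \in imgS (cls B) (preS (val : {linear submod A -> M}) C).
      apply: spanS_le xF => u ut; apply/imgSP; exists (repr u); last exact/esym/reprK.
      by rewrite preSE; apply/addSl/mem_spanS/map_f.
    move=> /imgSP[x' Cx' /cls_eq xx']; suff: val x \in C by []; rewrite -[val x](subrK (val x')).
    by rewrite rpredD // addSr.
  - move=> y Ay; exists (Sub y Ay) => //.
    by rewrite [X in y - X]SubK subrr rpred0.
apply: le_trans CF _.
have Q0 : {subset zeroS Q <= F} by move=> x /zeroSP ->; exact: rpred0.
have := len_add (A := fullS Q) (B := F) (fun x _ => isT) Q0.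
rewrite (len_full Q) -/(len A B) => LQ2.
have F1 : len F (zeroS Q) \is a fin_num.
  by rewrite ge0_fin_numE ?len_ge0 //; apply: le_lt_trans AB; rewrite LQ2 leeDl ?len_ge0.
have F2 : len (fullS Q) F \is a fin_num.
  by rewrite ge0_fin_numE ?len_ge0 //; apply: le_lt_trans AB; rewrite LQ2 leeDr ?len_ge0.
move: ltF; rewrite LQ2; move: F1 F2.
case: (len F _) (len _ F) => [a| |] // [b| |] // _ _.
by rewrite -!EFinD !(lte_fin, lee_fin) ltrBlDr ltrD2l => /ltW.
Qed.

End LengthToolkit.

(** * Partial trajectories and their growth rates *)

Section Trajectories.
Variables (R : comNzRingType).
Implicit Types M N : lmodType R.

Lemma iterSP M (phi : {linear M -> M}) (H : submodClosed M) i x :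
  reflect (exists2 y, y \in H & x = iter i phi y) (x \in iter i (imS phi) H).
Proof.
apply: (iffP idP).
  elim: i x => [|i IH] x /=; first by move=> Hx; exists x.
  by move=> /asboolP[y /IH[z Hz ->] ->]; exists z.
elim: i x => [|i IH] x /= [y Hy ->] //.
by apply/asboolP; exists (iter i phi y) => //; apply: IH; exists y.
Qed.

Lemma trajP M (phi : {linear M -> M}) (H : submodClosed M) n x :
  x \in traj phi H n <->
  exists2 h : nat -> M, (forall i, h i \in H) & x = \sum_(i < n) iter i phi (h i).
Proof.
have P (F : nat -> submodClosed M) m y :
    y \in \big[@addS R M/zeroS M]_(i < m) F i <->
    exists2 h : nat -> M, (forall i, h i \in F i) & y = \sum_(i < m) h i.
  elim: m F y => [|m IH] F y.
    rewrite big_ord0; split; first by move=> /zeroSP ->; exists (fun=> 0) => *; rewrite ?big_ord0 ?rpred0.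
    by move=> [h _ ->]; rewrite big_ord0; apply/zeroSP.
  rewrite big_ord_recl; split.
    move=> /addSP[z [t [Fz /(IH (fun i => F i.+1))[h Fh ->] ->]]].
    exists (fun i => if i is j.+1 then h j else z); first by case.
    by rewrite big_ord_recl.
  move=> [h Fh ->]; apply/addSP; rewrite big_ord_recl.
  exists (h 0), (\sum_(i < m) h i.+1); split=> //; apply/(IH (fun i => F i.+1)).
  by exists (fun i => h i.+1).
rewrite (P (fun i => iter i (imS phi) H)); split.
  move=> [h hF ->].
  have /choice[k kP] : forall i, exists y, y \in H /\ h i = iter i phi y.
    by move=> i; have /iterSP[y Hy ->] := hF i; exists y.
  exists k; first by move=> i; have [] := kP i.
  by apply: eq_bigr => i _; have [] := kP i.
move=> [h hH ->]; exists (fun i => iter i phi (h i)) => // i.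
by apply/iterSP; exists (h i).
Qed.

Lemma traj1 M (phi : {linear M -> M}) (H : submodClosed M) : traj phi H 1 =i H.
Proof.
move=> x; apply/idP/idP => [/trajP[h Hh ->]|Hx]; first by rewrite big_ord1; apply: Hh.
by apply/trajP; exists (fun=> x); rewrite ?big_ord1.
Qed.

Lemma trajS M (phi : {linear M -> M}) (H : submodClosed M) n x :
  x \in traj phi H n.+1 <->
  exists y z, [/\ y \in traj phi H n, z \in H & x = y + iter n phi z].
Proof.
split.
  move=> /trajP[h Hh ->]; exists (\sum_(i < n) iter i phi (h i)), (h n).
  by rewrite big_ord_recr; split=> //; apply/trajP; exists h.
move=> [_ [z [/trajP[h Hh ->] Hz ->]]]; apply/trajP.
exists (fun i => if i == n then z else h i); first by move=> i; case: eqP.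
rewrite big_ord_recr /= eqxx; congr (_ + _); apply: eq_bigr => i _.
by rewrite ltn_eqF.
Qed.

Lemma traj_iter M (phi : {linear M -> M}) (H : submodClosed M) n i x :
  (i < n)%N -> x \in H -> iter i phi x \in traj phi H n.
Proof.
elim: n => // n IH; rewrite ltnS leq_eqVlt => /orP[/eqP ->|/IH{}IH] Hx; apply/trajS.
  by exists 0, x; rewrite rpred0 add0r.
by exists (iter i phi x), 0; rewrite rpred0 raddf0 addr0 IH.
Qed.

Lemma traj_ind M (phi : {linear M -> M}) (H G : submodClosed M) n :
  (forall i x, (i < n)%N -> x \in H -> iter i phi x \in G) ->
  {subset traj phi H n <= G}.
Proof.
by move=> HG x /trajP[h Hh ->]; apply: rpred_sum => i _; apply: HG.
Qed.

Lemma traj_mono M (phi : {linear M -> M}) (H G : submodClosed M) n m :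
  {subset H <= G} -> (n <= m)%N -> {subset traj phi H n <= traj phi G m}.
Proof.
by move=> HG nm; apply: traj_ind => i x ni Hx; apply/traj_iter/HG/Hx/(leq_trans ni).
Qed.

Lemma traj_shift M (phi : {linear M -> M}) (H : submodClosed M) n k x :
  x \in traj phi H n -> iter k phi x \in traj phi H (n + k).
Proof.
move=> /trajP[h Hh ->]; rewrite linear_sum; apply: rpred_sum => i _ /=.
by rewrite -iterD addnC traj_iter // ltn_add2r.
Qed.

(** Trajectories start at index 1 here: the trajectory of length 0 is the zero
    module, for which the formula fails. *)
Lemma traj_traj M (phi : {linear M -> M}) (H : submodClosed M) n m :
  traj phi (traj phi H m.+1) n.+1 =i traj phi H (n + m).+1.
Proof.
move=> x; apply/idP/idP; apply: traj_ind => {}x.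
  move=> y xn /(@traj_shift _ _ _ _ x); apply: traj_mono => //.
  by rewrite addSn ltnS addnC leq_add2r.
move=> y; rewrite ltnS => xnm Hy; case: (leqP x m) => xm.
  apply: (@traj_iter _ _ _ _ 0) => //; exact: traj_iter.
have -> : x = (x - m + m)%N by rewrite subnK // ltnW.
rewrite iterD; apply: traj_iter; last exact: traj_iter.
by rewrite ltnS leq_subLR addnC.
Qed.

Lemma traj2 M (phi : {linear M -> M}) (H : submodClosed M) : traj phi H 2 =i addS H (imS phi H).
Proof.
move=> x; apply/idP/idP.
  move=> /trajS[y [z [yH Hz ->]]]; rewrite traj1 in yH; apply/addSP.
  by exists y, (phi z); split=> //; apply/asboolP; exists z.
move=> /addSP[y [_ [Hy /asboolP[z Hz ->] ->]]]; apply/trajS.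
by exists y, z; rewrite traj1.
Qed.

(** Trajectories form a chain, so finitely many elements lie in one of them. *)
Lemma span_sub_traj M (phi : {linear M -> M}) (H : submodClosed M) (s : seq M) :
  (forall x, exists n, x \in traj phi H n.+1) ->
  exists m, {subset spanS s <= traj phi H m.+1}.
Proof.
move=> HM; elim: s => [|x s [m sm]].
  by exists 0 => x /zeroSP ->; rewrite rpred0.
have [n xn] := HM x; exists (maxn m n) => y.
move=> /addSP[_ [z [/lineSP[a ->] zs ->]]]; apply: rpredD.
  by apply: rpredZ; apply: traj_mono xn => //; rewrite ltnS leq_maxr.
by apply: traj_mono (sm _ zs) => //; rewrite ltnS leq_maxl.
Qed.

Section Commuting.
Variables (M N : lmodType R) (phi : {linear M -> M}) (psi : {linear N -> N}).
Variable g : {linear M -> N}.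
Hypothesis gC : forall x, g (phi x) = psi (g x).

Lemma iterC i x : g (iter i phi x) = iter i psi (g x).
Proof. by elim: i => //= i IH; rewrite gC IH. Qed.

Lemma traj_img (H : submodClosed M) n : traj psi (imgS g H) n =i imgS g (traj phi H n).
Proof.
move=> y; apply/idP/idP; last first.
  move=> /imgSP[x /trajP[h Hh ->] ->]; apply/trajP.
  exists (g \o h); first by move=> i; apply: imgS_f.
  by rewrite linear_sum; apply: eq_bigr => i _; rewrite iterC.
apply: traj_ind => i z ni /imgSP[x Hx ->]; rewrite -iterC.
exact/imgS_f/traj_iter.
Qed.

End Commuting.
End Trajectories.

Lemma traj_spanS (R : comNzRingType) (M : lmodType R) (phi : {linear M -> M}) (s : seq M) n :
  exists t, {subset traj phi (spanS s) n <= spanS t}.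
Proof.
elim: n => [|n [t IH]].
  by exists [::] => x /trajP[h _ ->]; rewrite big_ord0 rpred0.
exists (t ++ [seq iter n phi x | x <- s]) => _ /trajS[y [z [yt zs ->]]].
apply: rpredD.
  by apply: spanS_sub (IH _ yt) => x xt; rewrite mem_cat xt.
apply: (@imgS_spanS _ _ _ (iter n phi) s); last exact: imgS_f.
by move=> x xs; apply: mem_spanS; rewrite mem_cat; apply/orP; right; exact: map_f.
Qed.

Section Rates.
Variables (K : realType) (R : comNzRingType) (L : lmodType R -> \bar K).
Hypothesis HL : length_function L.
Implicit Types M N : lmodType R.

(** The index is shifted by one, so that [rate phi H 0] is the length of
    (H + phi H) / H, the quantity that decides inertness, and so that the
    sequence is decreasing from the start. *)
Definition rate M (phi : {linear M -> M}) (H : submodClosed M) (n : nat) : \bar K :=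
  len L (traj phi H n.+2) (traj phi H n.+1).

Definition limrate M (phi : {linear M -> M}) (H : submodClosed M) : \bar K :=
  ereal_inf (range (rate phi H)).

Lemma rate_ge0 M (phi : {linear M -> M}) (H : submodClosed M) n : (0 <= rate phi H n)%E.
Proof. exact: len_ge0. Qed.

Lemma limrate_ge0 M (phi : {linear M -> M}) (H : submodClosed M) : (0 <= limrate phi H)%E.
Proof. by apply: le_ereal_inf_tmp => _ [n _ <-]; exact: rate_ge0. Qed.

Lemma limrate_le M (phi : {linear M -> M}) (H : submodClosed M) n : (limrate phi H <= rate phi H n)%E.
Proof. by apply: ereal_inf_lbound; exists n. Qed.

(** phi maps T_(n+2) into T_(n+3) and T_(n+1) into T_(n+2), and it is onto
    modulo T_(n+2), because T_(n+3) = T_(n+2) + phi^(n+2) H. *)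
Lemma rateS M (phi : {linear M -> M}) (H : submodClosed M) n : (rate phi H n.+1 <= rate phi H n)%E.
Proof.
apply: (@len_surj _ _ _ HL _ _ phi).
- by move=> x /(@traj_shift _ _ _ _ _ 1); rewrite addn1.
- by move=> x _ /(@traj_shift _ _ _ _ _ 1); rewrite addn1.
- move=> _ /trajS[y [z [yH Hz ->]]]; exists (iter n.+1 phi z); first exact: traj_iter.
  by rewrite -iterS addrK.
Qed.

Lemma rate_noninc M (phi : {linear M -> M}) (H : submodClosed M) n m :
  (n <= m)%N -> (rate phi H m <= rate phi H n)%E.
Proof.
by move=> /subnK <-; elim: (m - n)%N => // k; apply: le_trans; rewrite addSn rateS.
Qed.

Lemma rate_traj M (phi : {linear M -> M}) (H : submodClosed M) n m :
  rate phi (traj phi H m.+1) n = rate phi H (n + m).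
Proof. by apply: len_eqm => // x; rewrite traj_traj. Qed.

Lemma limrate_traj M (phi : {linear M -> M}) (H : submodClosed M) m :
  limrate phi (traj phi H m.+1) = limrate phi H.
Proof.
apply/eqP; rewrite eq_le; apply/andP; split; apply: le_ereal_inf_tmp => _ [n _ <-].
  apply: le_trans (limrate_le _ _ n) _.
  by rewrite rate_traj rate_noninc // leq_addr.
by rewrite rate_traj limrate_le.
Qed.

Lemma inertE M (phi : {linear M -> M}) (H : submodClosed M) : inert L phi H <-> (rate phi H 0 < +oo)%E.
Proof.
rewrite /inert /= /rate.
by rewrite (@len_eqm _ _ _ HL _ _ _ (addS H (imS phi H)) H (@traj2 _ _ phi H) (@traj1 _ _ phi H)).
Qed.

Lemma len_traj M (phi : {linear M -> M}) (H : submodClosed M) n :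
  len L (traj phi H n.+1) H = (\sum_(i < n) rate phi H i)%E.
Proof.
elim: n => [|n IH]; first by rewrite big_ord0 len0 // => x; rewrite traj1.
rewrite (@len_add _ _ _ HL _ _ (traj phi H n.+1)); last 2 first.
- exact: traj_mono.
- by move=> x Hx; apply: (@traj_iter _ _ _ _ _ 0).
by rewrite IH big_ord_recr.
Qed.

Lemma rate_le_len M (phi : {linear M -> M}) (H : submodClosed M) n :
  (rate phi H n <= len L H (zeroS M))%E.
Proof.
apply: (@len_surj _ _ _ HL _ _ (iter n.+1 phi)) => [x xH|x _ /zeroSP ->|].
- exact: traj_iter.
- by rewrite raddf0 rpred0.
- by move=> _ /trajS[y [z [yT zH ->]]]; exists z => //; rewrite addrK.
Qed.

Lemma len_traj0_fin M (phi : {linear M -> M}) (H : submodClosed M) n :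
  (len L H (zeroS M) < +oo)%E -> (len L (traj phi H n.+1) (zeroS M) < +oo)%E.
Proof.
move=> Hfin; elim: n => [|n IH]; first by rewrite (len_eqm HL (traj1 phi H) (fun=> erefl)).
rewrite (len_add HL (B := traj phi H n.+1)) ?lte_add_pinfty //.
- by apply: le_lt_trans Hfin; exact: rate_le_len.
- exact: traj_mono.
- by move=> x /zeroSP ->; exact: rpred0.
Qed.

Section Inert.
Variables (M : lmodType R) (phi : {linear M -> M}) (H : submodClosed M).
Hypothesis H_inert : (rate phi H 0 < +oo)%E.

Lemma rate_fin n : rate phi H n \is a fin_num.
Proof.
rewrite ge0_fin_numE ?rate_ge0 //; apply: le_lt_trans H_inert.
exact: rate_noninc.
Qed.

Lemma limrate_fin : limrate phi H \is a fin_num.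
Proof.
rewrite ge0_fin_numE ?limrate_ge0 //; exact: le_lt_trans (limrate_le _ _ 0) _.
Qed.

Lemma len_traj_fin n : len L (traj phi H n) H \is a fin_num.
Proof.
case: n => [|n]; last by rewrite len_traj; apply/sum_fin_numP => i _ _; exact: rate_fin.
by rewrite len0 // => x /trajP[h _ ->]; rewrite big_ord0 rpred0.
Qed.

(** The lengths of T_(n+1) / H are the partial sums of the rates
    ([len_traj]), so their means converge to the limit of the rates by the
    Cesaro theorem. *)
Lemma growth_cvg :
  (fun n => fine (len L (traj phi H n) H) / n%:R) @ \oo --> fine (limrate phi H).
Proof.
pose a n := fine (rate phi H n).
have aE n : rate phi H n = (a n)%:E by rewrite fineK // rate_fin.
have a_cvg : a @ \oo --> fine (limrate phi H).
  apply: fine_cvg; rewrite fineK ?limrate_fin //.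
  apply: ereal_nonincreasing_cvgn => n m; exact: rate_noninc.
(* shifted by one, so that n + 1 terms of b add up to the length of T_(n+1) / H *)
pose b n := if n is m.+1 then a m else 0.
have b_cvg : b @ \oo --> fine (limrate phi H) by rewrite -cvg_shiftS.
rewrite -cvg_shiftS (_ : [sequence _]_n = arithmetic_mean b); first exact: cesaro.
apply/funext => n; rewrite /arithmetic_mean /= mulrC; congr (_ * _).
rewrite seriesEord /= big_ord_recl /= add0r len_traj.
rewrite (eq_bigr (fun i : 'I_n => (a i)%:E)) ?sumEFin // => i _.
Qed.

Lemma ent_atE : ent_at L phi H = limrate phi H.
Proof.
apply/cvg_lim => //.
have -> : (fun n => L (subquot (traj phi H n) H) * (n%:R^-1)%:E)%E =
          (fun n => (fine (len L (traj phi H n) H) / n%:R)%:E).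
  by apply/funext => n; rewrite EFinM fineK // len_traj_fin.
rewrite -[limrate _ _]fineK ?limrate_fin //.
by apply: cvg_EFin; [exact: nearW|exact: growth_cvg].
Qed.

End Inert.
End Rates.

(** * Comparison of growth rates *)

Section RateComparison.
Variables (K : realType) (R : comNzRingType) (L : lmodType R -> \bar K).
Hypothesis HL : length_function L.
Variables (M N : lmodType R) (phi : {linear M -> M}) (psi : {linear N -> N}).
Implicit Types (H F : submodClosed M).

Section Equivariant.
Variable g : {linear M -> N}.
Hypothesis gC : forall x, g (phi x) = psi (g x).

Lemma rate_inj H n : injective g -> rate L psi (imgS g H) n = rate L phi H n.
Proof.
move=> g_inj; rewrite /rate.
rewrite (len_eqm HL (traj_img gC H n.+2) (traj_img gC H n.+1)).
apply/eqP; rewrite eq_le; apply/andP; split.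
  apply: (@len_surj _ _ _ HL _ _ g) => [x|x _|_ /imgSP[x xH ->]]; try exact: imgS_f.
  by exists x => //; rewrite subrr rpred0.
apply: (@len_inj _ _ _ HL _ _ g) => [x|x _|x _ /imgSP[y yH /g_inj ->]] //; exact: imgS_f.
Qed.

Lemma limrate_inj H : injective g -> limrate L psi (imgS g H) = limrate L phi H.
Proof.
move=> g_inj; rewrite /limrate (_ : rate L psi _ = rate L phi H) //.
by apply/funext => n; rewrite rate_inj.
Qed.

Lemma rate_img H n : (rate L psi (imgS g H) n <= rate L phi H n)%E.
Proof.
rewrite /rate (len_eqm HL (traj_img gC H n.+2) (traj_img gC H n.+1)).
apply: (@len_surj _ _ _ HL _ _ g) => [x|x _|_ /imgSP[x xH ->]]; try exact: imgS_f.
by exists x => //; rewrite subrr rpred0.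
Qed.

(** Insert T + phi^(n+1) A between T_(n+j+3) and T = T_(n+j+2), where A is the
    part of T_(j+2) killed by g.  The lower layer is a quotient of
    T_(n+2)(A) / T_(n+1)(A).  By phi^(n+1), the upper layer is a quotient of
    T_(j+2) / (T_(j+1) + A), which embeds into T_(j+2)(gH) / T_(j+1)(gH). *)
Lemma rate_subadd H n j :
  (rate L phi H (n + j.+1) <=
   rate L phi (capS (traj phi H j.+2) (preS g (zeroS N))) n + rate L psi (imgS g H) j)%E.
Proof.
set A := capS _ _.
have AH : {subset A <= traj phi H j.+2} by move=> x; rewrite capSE => /andP[].
pose T m := traj phi H m.
have AT m : {subset traj phi A m.+1 <= T (m + j.+1).+1}.
  by move=> x xA; rewrite -traj_traj; apply: traj_mono xA.
pose B := addS (T (n + j.+1).+1) (imgS (iter n.+1 phi) A).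
have TB : {subset T (n + j.+1).+1 <= B} by move=> x; exact: addSl.
have BT : {subset B <= T (n + j.+1).+2}.
  move=> x /addSP[y [_ [yT /imgSP[z /AH zT ->] ->]]]; rewrite rpredD //.
    exact: traj_mono yT.
  by move: (traj_shift n.+1 zT); apply: traj_mono; rewrite // addnC addSn addnS.
rewrite /rate (len_add HL BT TB); apply: leeD.
  apply: (@len_surj _ _ _ HL _ _ idfun) => [x|x _|_ /addSP[y [_ [yT /imgSP[z zA ->] ->]]]].
  - move=> /trajS[y [z [yA zA ->]]]; apply: rpredD; last exact/addSr/imgS_f.
    exact/addSl/AT.
  - exact: AT.
  - exists (iter n.+1 phi z); first exact: traj_iter.
    by rewrite addrK.
rewrite (len_eqm HL (traj_img gC H j.+2) (traj_img gC H j.+1)).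
apply: (@le_trans _ _ (len L (T j.+2) (addS (T j.+1) A))).
  apply: (@len_surj _ _ _ HL _ _ (iter n.+1 phi)) => [x|x xT|x].
  - by move=> /(traj_shift n.+1); rewrite addnC addSn addnS.
  - move=> /addSP[y [z [yT zA ->]]]; rewrite linearD; apply: rpredD; last exact/addSr/imgS_f.
    by apply/addSl; have := traj_shift n.+1 yT; rewrite /T addnC addSn.
  - move=> /trajS[y [z [yT zH ->]]]; exists (iter j.+1 phi z); first exact: traj_iter.
    rewrite -[X in _ - X]/(iter n.+1 phi (iter j.+1 phi z)) -iterD addSn addrK.
    exact/addSl.
apply: (@len_inj _ _ _ HL _ _ g) => [x|x xT|x xT].
- exact: imgS_f.
- move=> /addSP[y [z [yT]]]; rewrite capSE => /andP[_]; rewrite preSE => /zeroSP gz ->.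
  by rewrite linearD gz addr0; exact: imgS_f.
- move=> /imgSP[y yT gxy]; rewrite -[x](subrK y) addrC; apply: rpredD; first exact: addSl.
  apply: addSr; rewrite capSE preSE linearB gxy subrr rpred0 andbT memSB //.
  exact: traj_mono yT.
Qed.

(** Rates are not monotone in the submodule, but the length of T_n(F) / F is
    at least that of T_n(gF) / gF plus that of T_n(H) / H, up to the
    constant C; dividing by n removes C. *)
Lemma limrate_superadd (C : K) H F :
  {subset H <= F} -> {subset H <= preS g (zeroS N)} ->
  (rate L phi H 0 < +oo)%E -> (rate L phi F 0 < +oo)%E ->
  (forall n, len L (capS F (traj phi H n)) H <= C%:E)%E ->
  (limrate L phi H + limrate L psi (imgS g F) <= limrate L phi F)%E.
Proof.
move=> HF Hg Hin Fin bnd.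
have gFin : (rate L psi (imgS g F) 0 < +oo)%E by apply: le_lt_trans Fin; exact: rate_img.
rewrite -(fineK (limrate_fin HL Hin)) -(fineK (limrate_fin HL Fin)).
rewrite -(fineK (limrate_fin HL gFin)) -EFinD lee_fin.
pose u n := fine (len L (traj phi H n) H).
pose w n := fine (len L (traj psi (imgS g F) n) (imgS g F)).
pose t n := fine (len L (traj phi F n) F).
have uE n : len L (traj phi H n) H = (u n)%:E by rewrite fineK // len_traj_fin.
have wE n : len L (traj psi (imgS g F) n) (imgS g F) = (w n)%:E.
  by rewrite fineK // len_traj_fin.
have tE n : len L (traj phi F n) F = (t n)%:E by rewrite fineK // len_traj_fin.
have Hgn n : {subset traj phi H n <= preS g (zeroS N)}.
  apply: traj_ind => i x _ /Hg; rewrite !preSE (iterC gC) => /zeroSP ->.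
  by rewrite raddf0 rpred0.
have main n : u n.+1 + w n.+1 - C <= t n.+1.
  pose B := addS F (traj phi H n.+1).
  have FB : {subset F <= B} by move=> x; exact: addSl.
  have BT : {subset B <= traj phi F n.+1}.
    move=> x /addSP[y [z [yF zH ->]]]; rewrite rpredD //.
      exact: (@traj_iter _ _ _ _ _ 0).
    exact: traj_mono zH.
  have := len_add HL BT FB; rewrite tE => tE'.
  have w_le : ((w n.+1)%:E <= len L (traj phi F n.+1) B)%E.
    rewrite -wE (len_eqm HL (traj_img gC F n.+1) (fun=> erefl)).
    apply: (@len_surj _ _ _ HL _ _ g) => [x|x _|_ /imgSP[x xT ->]].
    - exact: imgS_f.
    - move=> /addSP[y [z [yF /Hgn zH ->]]]; rewrite linearD.
      by move: zH; rewrite preSE => /zeroSP ->; rewrite addr0 imgS_f.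
    - by exists x => //; rewrite subrr rpred0.
  pose D := capS F (traj phi H n.+1).
  have HD : {subset H <= D}.
    by move=> x xH; rewrite capSE HF //=; apply: (@traj_iter _ _ _ _ _ 0).
  have DT : {subset D <= traj phi H n.+1} by move=> x; rewrite capSE => /andP[].
  have := len_add HL DT HD; rewrite uE => uE'.
  have u_le : (len L (traj phi H n.+1) D <= len L B F)%E.
    apply: (@len_inj _ _ _ HL _ _ idfun) => [x|x _|x xT xF]; first exact: addSr.
      by rewrite capSE => /andP[].
    by rewrite capSE xF.
  have {}u_le : ((u n.+1)%:E <= C%:E + len L B F)%E by rewrite uE'; apply: leeD u_le; exact: bnd.
  move: w_le u_le tE'; have := len_ge0 HL B F; have := len_ge0 HL (traj phi F n.+1) B.
  case: (len L B F) (len L (traj phi F n.+1) B) => [a| |] // [b| |] // _ _.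
  rewrite -!EFinD !lee_fin => wb uC [->].
  by lra.
have cv : (fun n => u n.+1 / n.+1%:R + w n.+1 / n.+1%:R - C * harmonic n) @ \oo -->
    fine (limrate L phi H) + fine (limrate L psi (imgS g F)) - C * 0.
  apply: cvgB; last by apply: cvgMr; exact: cvg_harmonic.
  by apply: cvgD; [have := growth_cvg HL Hin | have := growth_cvg HL gFin]; rewrite -cvg_shiftS.
have := growth_cvg HL Fin; rewrite -cvg_shiftS => tcv.
rewrite mulr0 subr0 in cv; apply: (ler_cvg_to cv tcv); apply: nearW => n /=.
by rewrite -mulrDl -mulrBl ler_pM2r ?invr_gt0 ?ltr0n.
Qed.

End Equivariant.

(** The summand phi^(j+1) H of T_(j+2)(H) may be replaced by phi^(j+1) F at the
    price of the length of (H + phi H) / (H + phi F), of which phi^j maps onto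
    the difference. *)
Lemma rate_approx H F j : {subset F <= H} ->
  (rate L phi H j <= rate L phi F j + len L (traj phi H 2) (addS H (imgS phi F)))%E.
Proof.
move=> FH; pose B := addS (traj phi H j.+1) (imgS (iter j.+1 phi) F).
have TB : {subset traj phi H j.+1 <= B} by move=> x; exact: addSl.
have BT : {subset B <= traj phi H j.+2}.
  move=> x /addSP[y [_ [yT /imgSP[z /FH zT ->] ->]]]; rewrite rpredD //.
    exact: traj_mono yT.
  exact: traj_iter.
rewrite {1}/rate (len_add HL BT TB); apply: leeD.
  apply: (@len_surj _ _ _ HL _ _ idfun) => [x|x _|_ /addSP[y [_ [yT /imgSP[z zA ->] ->]]]].
  - move=> /trajS[y [z [yA zA ->]]]; apply: rpredD; last exact/addSr/imgS_f.
    by apply: addSl; apply: traj_mono yA.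
  - exact: traj_mono.
  - exists (iter j.+1 phi z); first exact: traj_iter.
    by rewrite addrK.
apply: (@len_surj _ _ _ HL _ _ (iter j phi)) => [x|x xT|x].
- by move=> /(traj_shift j); rewrite addnC addn2.
- move=> /addSP[y [z [yT /imgSP[t tF ->] ->]]]; rewrite linearD /= -iterSr.
  apply: rpredD; last exact/addSr/imgS_f.
  exact/addSl/traj_iter.
- move=> /trajS[y [z [yT zH ->]]]; exists (phi z); first exact: (@traj_iter _ _ _ _ _ 1).
  rewrite -[X in _ - X]/(iter j phi (phi z)) -iterSr addrK; exact/addSl.
Qed.

End RateComparison.

(** (H + phi H) / H is exhausted up to length e by finitely many elements
    y + phi z with y and z in H; only the elements z matter. *)
Lemma rate_fg_approx (K : realType) (R : comNzRingType) (L : lmodType R -> \bar K)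
    (HL : length_function L) (M : lmodType R) (phi : {linear M -> M})
    (H : submodClosed M) (e : K) : (0 < e)%R -> (rate L phi H 0 < +oo)%E ->
  exists t : seq M, {subset spanS t <= H} /\
    forall n, (rate L phi H n <= rate L phi (spanS t) n + e%:E)%E.
Proof.
move=> e0 Hin.
have [|s [sT se]] := len_approx HL (A := traj phi H 2) (B := H) e0.
  apply: le_lt_trans Hin; apply: (len_le HL) => // x; first by rewrite traj1.
  by move=> xH; apply: (@traj_iter _ _ _ _ _ 0).
have [t tH st] : exists2 t : seq M, {subset t <= H} &
    {subset s <= addS H (imgS phi (spanS t))}.
  elim: s sT {se} => [|x s IH] sT; first by exists [::].
  have [t tH st] : exists2 t : seq M, {subset t <= H} &
      {subset s <= addS H (imgS phi (spanS t))}.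
    by apply: IH => y ys; apply: sT; rewrite inE ys orbT.
  have /trajS[y [z [yH zH xE]]] := sT x (mem_head _ _); rewrite traj1 in yH.
  exists (z :: t) => w; rewrite inE => /orP[/eqP ->|] //; first exact: tH.
    by rewrite xE; apply: rpredD; [exact: addSl|apply/addSr/imgS_f/mem_spanS/mem_head].
  move=> /st /addSP[a [_ [aH /imgSP[b bt ->] ->]]]; apply: rpredD; first exact: addSl.
  by apply/addSr/imgS_f; apply: addSr.
have tH' : {subset spanS t <= H} by exact: spanS_le.
exists t; split=> // n; apply: le_trans (rate_approx HL phi n tH') _.
apply: leeD2l; apply: le_trans se; apply: (len_le HL) => // x.
  move=> /addSP[y [z [ys zH ->]]]; rewrite rpredD //; last exact: addSl.
  exact: spanS_le ys.
move=> /addSP[y [z [yH /(imgS_spanS (H := traj phi H 2)) zT ->]]]; rewrite rpredD //.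
  exact: (@traj_iter _ _ _ _ _ 0).
by apply: zT => w /tH wH; apply: (@traj_iter _ _ _ _ _ 1).
Qed.

(** [limrate_superadd] for the zero map: if F has finite length then this length
    bounds the error. *)
Lemma limrate_mono_fin (K : realType) (R : comNzRingType) (L : lmodType R -> \bar K)
    (HL : length_function L) (M : lmodType R) (phi : {linear M -> M})
    (H F : submodClosed M) : {subset H <= F} -> (len L F (zeroS M) < +oo)%E ->
  (limrate L phi H <= limrate L phi F)%E.
Proof.
move=> HF Ffin.
have sub0 (A B : submodClosed M) : {subset A <= F} -> (len L A B <= len L F (zeroS M))%E.
  move=> AF; apply: (@le_trans _ _ (len L A (zeroS M))).
    apply: (@len_surj _ _ _ HL _ _ idfun) => [x|x _ /zeroSP ->|x xA] //.
      exact: rpred0.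
    by exists x; rewrite // subrr rpred0.
  by apply: (len_le HL) => // x /zeroSP ->; rewrite rpred0.
have gC x : (\0 : {linear M -> M}) (phi x) = phi ((\0 : {linear M -> M}) x).
  by rewrite /= raddf0.
have Fin : (rate L phi F 0 < +oo)%E by apply: le_lt_trans Ffin; exact: rate_le_len.
have Hin : (rate L phi H 0 < +oo)%E.
  apply: le_lt_trans (rate_le_len HL phi H 0) _; apply: le_lt_trans Ffin.
  exact: sub0.
have := limrate_superadd HL gC HF _ Hin Fin (C := fine (len L F (zeroS M))).
move=> le1; apply: le_trans (le1 _ _); first by rewrite leeDl // limrate_ge0.
  by move=> x _; rewrite preSE; apply/zeroSP.
move=> n; rewrite fineK; last by rewrite ge0_fin_numE ?len_ge0.
by apply: sub0 => x; rewrite capSE => /andP[].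
Qed.

(** * Modules over a valuation domain of rank one *)

Section ValuationDomain.
Variables (K : realType) (Q : fieldType) (v : valuation K Q).
Hypothesis v_nd : non_discrete v.
Local Notation R := (valring v).
Local Notation io := (valring_val v).
Variable Lv : lmodType R -> \bar K.
Hypothesis Lv_length : valuation_length Lv.
Let HL : length_function Lv := proj1 Lv_length.
Implicit Types M N : lmodType R.

Lemma io_inj : injective io. Proof. exact: val_inj. Qed.

Lemma io_eq0 r : (io r == 0) = (r == 0).
Proof. by rewrite -(inj_eq io_inj) rmorph0. Qed.

Lemma valR_mul_eq0 (a b : R) : a * b = 0 -> a != 0 -> b = 0.
Proof.
move=> /(congr1 io); rewrite rmorphM rmorph0 => /eqP; rewrite mulf_eq0 !io_eq0.
by case/orP => /eqP ->; rewrite ?eqxx.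
Qed.

Lemma valR_mul_neq0 (a b : R) : a != 0 -> b != 0 -> a * b != 0.
Proof. by move=> a0 b0; apply/eqP => /valR_mul_eq0 /(_ a0) /eqP; apply/negP. Qed.

Lemma valR_ge0 (r : R) : (0 <= v (io r))%E.
Proof. exact: (valP r). Qed.

Lemma val_fin (x : Q) : x != 0 -> v x \is a fin_num.
Proof.
move=> x0; rewrite fin_numE val_neqNy /=; apply/eqP => /val_eqy.
by apply/eqP.
Qed.

(** Non-discreteness enters only here: there are non-zero elements of
    positive finite value. *)
Lemma exists_small_val : exists2 r : R, (0 < v (io r))%E & (v (io r) < +oo)%E.
Proof.
have ne : (`]0 : K, 1[%classic !=set0).
  by exists 2^-1; rewrite /= in_itv /= invr_gt0 ltr0n invf_lt1 ?ltr1n ?ltr0n.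
have [a [+ [x x0 vx]]] := v_nd ne (@interval_open K (BRight 0) (BLeft 1) isT isT).
rewrite /= in_itv /= => /andP[a0 _].
have ix : x \in integral_pred v by rewrite unfold_in vx lee_fin ltW.
by exists (Sub x ix); rewrite /valring_val SubK vx ?lte_fin // ltry.
Qed.

(** The value of L_v at R / rR, as the elements of rR have value at least v(r). *)
Lemma len_lineS (r : R) : len Lv (fullS R^o) (lineS (r : R^o)) = v (io r).
Proof.
rewrite (len_quot HL) (proj2 Lv_length); apply/eqP; rewrite eq_le; apply/andP; split.
  apply: ereal_inf_lbound; exists r => //=.
  by apply/lineSP; exists 1; rewrite scale1r.
apply: le_ereal_inf_tmp => _ [_ /= /lineSP[a ->] <-].
have : (v (io r) <= v (io (a * r)%R))%E by rewrite rmorphM Defs.valM leeDr // valR_ge0.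
by [].
Qed.

Lemma len_R : len Lv (fullS R^o) (zeroS R^o) = +oo%E.
Proof.
rewrite (len_quot HL) (proj2 Lv_length).
apply/ereal_inf_pinfty => _ [_ /= /zeroSP -> <-] /=.
by apply/val_eqy; exact: (rmorph0 io).
Qed.

Lemma len_line_le M (B : submodClosed M) x (r : R) : r *: x \in B ->
  (len Lv (addS (lineS x) B) B <= v (io r))%E.
Proof.
move=> rx; rewrite -len_lineS.
apply: (@len_surj _ _ _ HL _ _ (scalev x)) => [a _|a _|].
- by apply/addSl/lineSP; exists a.
- move=> /lineSP[b ->]; suff: b *: (r *: x) \in B by rewrite scalerA.
  exact: rpredZ.
- move=> y /addSP[_ [z [/lineSP[a ->] zB ->]]]; exists a => //.
  by rewrite addrAC subrr add0r.
Qed.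

(** Otherwise R would embed into A / B, but R has infinite length. *)
Lemma len_tors M (A B : submodClosed M) x : (len Lv A B < +oo)%E -> x \in A ->
  exists2 r : R, r != 0 & r *: x \in B.
Proof.
move=> AB Ax; apply: contrapT => H.
have : (+oo <= len Lv A B)%E.
  rewrite -len_R; apply: (@len_inj _ _ _ HL _ _ (scalev x)) => [a _|a _|a _].
  - exact: rpredZ.
  - by move=> /zeroSP ->; rewrite raddf0 rpred0.
  - move=> ax; apply/zeroSP/eqP/negPn/negP => a0; apply: H.
    by exists a.
by rewrite leye_eq => /eqP E; rewrite E in AB.
Qed.

Lemma len_span_fin M (B : submodClosed M) s :
  (forall x, x \in s -> exists2 r : R, r != 0 & r *: x \in B) ->
  (len Lv (addS (spanS s) B) B < +oo)%E.
Proof.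
elim: s => [_|x s IH sB].
  by rewrite (len0 HL) // => x /addSP[y [z [/zeroSP -> zB ->]]]; rewrite add0r.
have [r r0 rx] := sB x (mem_head _ _).
have CB : {subset B <= addS (spanS s) B} by move=> y; exact: addSr.
have BA : {subset addS (spanS s) B <= addS (spanS (x :: s)) B}.
  move=> y /addSP[z [t [zs tB ->]]]; rewrite rpredD //; last exact: addSr.
  exact/addSl/addSr.
rewrite (len_add HL BA CB) lte_add_pinfty //.
  by apply: IH => y ys; apply: sB; rewrite inE ys orbT.
apply: le_lt_trans (_ : (v (io r) < +oo)%E); last first.
  by rewrite ltey_eq val_fin // io_eq0.
apply: le_trans (len_line_le (addSr (spanS s) rx)).
apply: (len_le HL) => //; last by move=> y; exact: addSr.
move=> y /addSP[_ [t [/addSP[z [u [zx us ->]]] tB ->]]]; rewrite -addrA.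
apply: rpredD; first exact: addSl.
by apply/addSr; apply: rpredD; [exact: addSl|exact: addSr].
Qed.

(** Choose F between B and span s + B such that B has no torsion in F / B and
    the quotient by F has finite length: go through the generators, adjoining
    those that are independent of the earlier ones.  A torsion extension A of
    B then embeds modulo B into the quotient by F. *)
Lemma tors_bounded M (B : submodClosed M) s : exists C : K,
  forall A : submodClosed M, {subset A <= addS (spanS s) B} ->
    (len Lv A B < +oo)%E -> (len Lv A B <= C%:E)%E.
Proof.
have [F [BF Fs Ffin Ftors]] : exists F : submodClosed M,
    [/\ {subset B <= F}, {subset F <= addS (spanS s) B},
        (len Lv (addS (spanS s) B) F < +oo)%E &
        forall x (r : R), x \in F -> r != 0 -> r *: x \in B -> x \in B].
  elim: s => [|x s [F [BF Fs Ffin Ftors]]].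
    exists B; split=> //; first by move=> x; exact: addSr.
    by rewrite (len0 HL) // => x /addSP[y [z [/zeroSP -> zB ->]]]; rewrite add0r.
  have ss : {subset addS (spanS s) B <= addS (spanS (x :: s)) B}.
    move=> y /addSP[z [t [zs tB ->]]]; rewrite rpredD //; last exact: addSr.
    exact/addSl/addSr.
  have sx : {subset addS (spanS (x :: s)) B <= addS (lineS x) (addS (spanS s) B)}.
    move=> y /addSP[_ [t [/addSP[z [u [zx us ->]]] tB ->]]]; rewrite -addrA.
    apply: rpredD; first exact: addSl.
    by apply/addSr; apply: rpredD; [exact: addSl|exact: addSr].
  have [[r r0 rx]|nr] := pselect (exists2 r : R, r != 0 & r *: x \in addS (spanS s) B).
    exists F; split=> //; first by move=> y /Fs /ss.
    rewrite (len_add HL ss Fs) lte_add_pinfty //.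
    apply: le_lt_trans (_ : (v (io r) < +oo)%E); last first.
      by rewrite ltey_eq val_fin // io_eq0.
    apply: le_trans (len_line_le rx); apply: (len_le HL) => //.
    by move=> y; exact: addSr.
  have xF : {subset addS (lineS x) F <= addS (spanS (x :: s)) B}.
    move=> y /addSP[z [t [zx tF ->]]]; rewrite rpredD //; last exact/ss/Fs.
    exact/addSl/addSl.
  exists (addS (lineS x) F); split=> //.
  - by move=> y /BF; exact: addSr.
  - apply: le_lt_trans Ffin; apply: (@len_surj _ _ _ HL _ _ idfun) => [|y _|y].
    + exact: ss.
    + exact: addSr.
    + move=> /sx /addSP[z [t [zx tF ->]]]; exists t => //.
      by rewrite addrK; exact: addSl.
  - move=> _ r /addSP[_ [t [/lineSP[a ->] tF ->]]] r0 rB.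
    have : r * a == 0.
      apply: contrapT => /negP ra; apply: nr; exists (r * a) => //.
      have -> : (r * a) *: x = r *: (a *: x + t) - r *: t.
        by rewrite scalerDr addrK scalerA.
      apply: memSB; first exact: addSr.
      by apply: rpredZ; exact: Fs.
    move=> /eqP /valR_mul_eq0 /(_ r0) a0; move: rB; rewrite a0 scale0r add0r.
    exact: Ftors tF r0.
exists (fine (len Lv (addS (spanS s) B) F)) => A As ABfin.
rewrite fineK ?ge0_fin_numE ?len_ge0 //.
apply: (@len_inj _ _ _ HL _ _ idfun) => [|x _|x Ax xF]; [exact: As|exact: BF|].
by have [r r0 rx] := len_tors ABfin Ax; exact: Ftors xF r0 rx.
Qed.

End ValuationDomain.

(** * The intrinsic entropy of modules over the polynomial ring *)

Section PolynomialModules.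
Variable (R : comNzRingType).
Implicit Types N : lmodType {poly R}.
Local Notation muX := (@mulX R _).

Lemma iter_mulX N i (x : restrC N) : iter i muX x = 'X^i *: (x : N).
Proof.
elim: i => [|i IH]; first by rewrite expr0 scale1r.
by rewrite /= IH /mulX exprS scalerA.
Qed.

Lemma restrC_scale N (a : R) (x : N) : a *: (x : restrC N) = a%:P *: x.
Proof. by []. Qed.

Lemma poly_scaleE N (p : {poly R}) (x : N) n : (size p <= n)%N ->
  p *: x = \sum_(i < n) p`_i *: (iter i muX x : restrC N).
Proof.
move=> pn; rewrite -{1}[p]coefK poly_def scaler_suml.
rewrite (big_ord_widen n (fun i => (p`_i *: 'X^i) *: x) pn) big_mkcond /=.
apply: eq_bigr => i _; rewrite restrC_scale iter_mulX scalerA mul_polyC.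
by case: ltnP => // /(nth_default 0) ->; rewrite !scale0r.
Qed.

(** Solve p x = 0 for the leading term and shift by X^(n - deg p). *)
Lemma lead_iter_traj N (H : submodClosed (restrC N)) (x : restrC N) (p : {poly R}) n :
  x \in H -> p != 0 -> p *: (x : N) = 0 -> (size p <= n)%N ->
  lead_coef p *: iter n muX x \in traj muX H n.
Proof.
move=> xH p0 px pn.
have sz : size p = (size p).-1.+1 by rewrite prednK // lt0n size_poly_eq0.
have := poly_scaleE x (leqnn (size p)); rewrite px sz big_ord_recr /=.
set d := (size p).-1 => /esym/eqP; rewrite addr_eq0 => /eqP E.
have dn : (d <= n)%N by rewrite (leq_trans _ pn) // sz leqnSn.
have -> : lead_coef p *: iter n muX x = iter (n - d) muX (lead_coef p *: iter d muX x).
  by rewrite -[in LHS](subnK dn) iterD linearZ.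
rewrite -{2}(subnKC dn); apply: traj_shift.
rewrite -[_ *: _]opprK -E; apply: memSN; apply: rpred_sum => i _; apply: rpredZ.
exact: traj_iter.
Qed.

Definition restrC_map N N' (f : {linear N -> N'}) : {linear restrC N -> restrC N'} :=
  restr_map (@polyC R) f.

Lemma restrC_mapX N N' (f : {linear N -> N'}) x :
  restrC_map f (muX x) = muX (restrC_map f x).
Proof. exact: linearZ. Qed.

(** Elements that are torsion over R[X]; the others generate a free module. *)
Definition xtors N (x : N) := exists2 p : {poly R}, p != 0 & p *: x = 0.

End PolynomialModules.

Section Entropy.
Variables (K : realType) (Q : fieldType) (v : valuation K Q).
Hypothesis v_nd : non_discrete v.
Local Notation R := (valring v).
Local Notation io := (valring_val v).
Variable Lv : lmodType R -> \bar K.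
Hypothesis Lv_length : valuation_length Lv.
Let HL : length_function Lv := proj1 Lv_length.
Implicit Types N : lmodType {poly R}.
Local Notation muX := (@mulX R _).
Local Notation ent := (intrinsic_entropy Lv).
Local Notation rt := (rate Lv).
Local Notation lrt := (limrate Lv).

(** Finiteness of some rate of H suffices: then a trajectory of H is inert
    and has the same limit rate. *)
Lemma ent_ge N (H : submodClosed (restrC N)) n :
  (rt muX H n < +oo)%E -> (lrt muX H <= ent N)%E.
Proof.
move=> Hn; rewrite -(limrate_traj HL muX H n); apply: ereal_sup_ubound.
have Tn : (rt muX (traj muX H n.+1) 0 < +oo)%E by rewrite (rate_traj HL).
exists (traj muX H n.+1); first exact/(inertE HL).
by rewrite (ent_atE HL).
Qed.

Lemma ent_le N c :
  (forall H : submodClosed (restrC N), (rt muX H 0 < +oo)%E ->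
     (lrt muX H <= c)%E) -> (ent N <= c)%E.
Proof.
move=> Hc; apply: ge_ereal_sup => _ [H /(inertE HL) Hin <-].
by rewrite (ent_atE HL) // Hc.
Qed.

Lemma ent_ge0 N : (0 <= ent N)%E.
Proof.
apply: le_trans (@ent_ge N (zeroS _) 0 _); first exact: limrate_ge0.
rewrite /rate (len0 HL) // => x /trajP[h hH ->].
by apply: rpred_sum => i _; have /zeroSP -> := hH i; rewrite raddf0 rpred0.
Qed.

Lemma ent_inj N N' (f : {linear N' -> N}) : injective f -> (ent N' <= ent N)%E.
Proof.
move=> f_inj; apply: ent_le => H Hin.
have fi : injective (restrC_map f) by [].
rewrite -(limrate_inj HL (restrC_mapX f) H fi).
by apply: (@ent_ge N _ 0); rewrite (rate_inj HL (restrC_mapX f) H 0 fi).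
Qed.

(** The submodule R + r R[X] of R[X]. *)
Definition nearconst_pred (r : R) : {pred restrC ({poly R}^o)} :=
  fun p => `[< forall i, exists a, (p : {poly R})`_i.+1 = a * r >].

Lemma nearconst_submod r : submod_closed (nearconst_pred r).
Proof.
split=> [|a p q]; rewrite !unfold_in.
  by apply/asboolP => i; exists 0; rewrite mul0r coef0.
move=> /asboolP pr /asboolP qr; apply/asboolP => i.
have [b pb] := pr i; have [c qc] := qr i; exists (a * b + c).
have -> : (a *: p + q : {poly R}) = a%:P * (p : {poly R}) + (q : {poly R}) by [].
by rewrite coefD coefCM pb qc mulrDl mulrA.
Qed.

HB.instance Definition _ r := GRing.isSubmodClosed.Build R (restrC ({poly R}^o))
  (nearconst_pred r) (GRing.submod_closed_semi (nearconst_submod r)).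

Definition nearconst r : submodClosed (restrC ({poly R}^o)) := nearconst_pred r.

Lemma nearconstP r (p : {poly R}) :
  p \in nearconst r <-> forall i, exists a, p`_i.+1 = a * r.
Proof. by split=> [/asboolP|] // ?; apply/asboolP. Qed.

Definition coefr i : restrC ({poly R}^o) -> R^o := fun p => (p : {poly R})`_i.

Lemma coefr_linear i : linear (coefr i).
Proof.
move=> a p q; rewrite /coefr.
have -> : (a *: p + q : {poly R}) = a%:P * (p : {poly R}) + (q : {poly R}) by [].
by rewrite coefD coefCM.
Qed.

HB.instance Definition _ i :=
  GRing.isLinear.Build R (restrC ({poly R}^o)) R^o _ (coefr i) (coefr_linear i).

(** Every rate of R + r R[X] is the length v(r) of R / rR: modulo
    T_n = R + ... + R X^(n-1) + r R[X], the monomial X^n has annihilator rR. *)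
Lemma ent_polyring_ge (r : R) : r != 0 -> (v (io r) <= ent ({poly R}^o))%E.
Proof.
move=> r0; pose N : lmodType {poly R} := {poly R}^o.
have C (a : R) (p : {poly R}) : a *: (p : restrC N) = a *: p by rewrite restrC_scale -mul_polyC.
have XM (p : {poly R}) i : iter i muX (p : restrC N) = 'X^i * p by rewrite iter_mulX.
have step n : {subset traj muX (nearconst r) n.+1 <= preS (coefr n.+1) (lineS (r : R^o))}.
  apply: traj_ind => i x; rewrite ltnS => ni /nearconstP /(_ (n - i)%N)[a E].
  suff: ('X^i * (x : {poly R}))`_n.+1 = a * r.
    by rewrite preSE => E'; apply/lineSP; exists a; rewrite -[RHS]E' /= -XM.
  by rewrite coefXnM ltnNge (leq_trans ni) //= subSn.
have rn n : (v (io r) <= rt muX (nearconst r) n)%E.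
  rewrite -(len_lineS Lv_length) /rate.
  have := @len_inj _ _ _ HL R^o (restrC N) (scalev (('X^(n.+1) : {poly R}) : restrC N))
    (fullS R^o) (lineS (r : R^o)) (traj muX (nearconst r) n.+2) (traj muX (nearconst r) n.+1).
  apply=> [a _|a _|a _].
  - rewrite /scalev; apply: rpredZ.
    have -> : 'X^(n.+1) = iter n.+1 muX ((1 : {poly R}) : restrC N) by rewrite XM mulr1.
    apply: traj_iter => //; apply/nearconstP => i.
    by exists 0; rewrite coefC mul0r.
  - move=> /lineSP[b ->].
    suff: (((b * r) *: 'X^(n.+1) : {poly R}) : restrC N) \in traj muX (nearconst r) n.+1.
      by rewrite -C.
    apply: (@traj_iter _ _ _ _ _ 0) => //; apply/nearconstP => i.
    rewrite coefZ coefXn; exists (b * (i.+1 == n.+1)%:R).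
    by rewrite mulrAC.
  - move=> /step; rewrite preSE => ca.
    have E : coefr n.+1 (scalev (('X^(n.+1) : {poly R}) : restrC N) a) = a.
      by rewrite /scalev C /coefr coefZ coefXn eqxx mulr1.
    by rewrite -E; exact: ca.
apply: (@le_trans _ _ (lrt muX (nearconst r))).
  by apply: le_ereal_inf_tmp => _ [n _ <-].
apply: (@ent_ge _ _ 0); apply: (@le_lt_trans _ _ (v (io r))); last first.
  by rewrite ltey_eq val_fin // io_eq0.
rewrite -(len_lineS Lv_length) /rate.
have := @len_surj _ _ _ HL R^o (restrC N) (scalev (('X : {poly R}) : restrC N))
  (fullS R^o) (lineS (r : R^o)) (traj muX (nearconst r) 2) (traj muX (nearconst r) 1).
apply=> [a _|a _|].
- rewrite /scalev; apply: rpredZ.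
  have -> : ('X : {poly R}) = iter 1 muX ((1 : {poly R}) : restrC N) by rewrite XM mulr1.
  by apply: traj_iter => //; apply/nearconstP => i; exists 0; rewrite coefC mul0r.
- move=> /lineSP[b ->]; rewrite traj1.
  suff: (((b * r) *: 'X : {poly R}) : restrC N) \in nearconst r by rewrite -C.
  apply/nearconstP => i; rewrite coefZ coefX; exists (b * (i.+1 == 1)%:R).
  by rewrite mulrAC.
- move=> _ /trajS[p [q [+ /nearconstP qr ->]]]; rewrite traj1 => /nearconstP pr.
  exists ((q : {poly R})`_0) => //; rewrite traj1.
  suff: (p : {poly R}) + 'X * q - q`_0 *: 'X \in nearconst r.
    by rewrite -C => H; exact: H.
  apply/nearconstP => i; rewrite coefB coefD coefZ coefX coefXM /=.
  have [b ->] := pr i; case: i => [|i] /=; first by exists b; rewrite mulr1 addrK.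
  by have [c ->] := qr i; exists (b + c); rewrite mulr0 subr0 mulrDl.
Qed.

Lemma exists_big_val (c : K) : exists2 r : R, r != 0 & (c%:E <= v (io r))%E.
Proof.
have [r r0 ry] := exists_small_val v_nd.
have rn0 : r != 0 by rewrite -io_eq0; apply/eqP => /(val_eqy v) E; rewrite E in ry.
move: r0 ry; case E : (v (io r)) => [a| |] //; rewrite lte_fin => a0 _.
have vX n : v (io (r ^+ n)) = (a *+ n)%:E.
  elim: n => [|n IH]; first by rewrite expr0 rmorph1 Defs.val1.
  by rewrite exprS rmorphM Defs.valM IH E mulrS.
exists (r ^+ (Num.bound `|c / a|)).
  by elim: (Num.bound _) => [|n IH]; rewrite ?oner_eq0 // exprS valR_mul_neq0.
rewrite vX lee_fin -mulr_natl -ler_pdivrMr //.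
by apply: le_trans (ler_norm _) _; exact/ltW/archi_boundP.
Qed.

Lemma ent_free N (x : N) : ~ xtors x -> ent N = +oo%E.
Proof.
move=> xfree; apply/eqP; rewrite -leye_eq.
have f_inj : injective (scalev x : {poly R}^o -> N).
  apply: (@lin_inj _ _ _ (scalev x)) => p px; apply/eqP/negPn/negP => p0.
  by apply: xfree; exists p.
apply: le_trans (ent_inj f_inj).
rewrite leye_eq; apply/eqP/eqyP => c _; have [r r0 cr] := exists_big_val c.
exact: le_trans cr (ent_polyring_ge r0).
Qed.

(** By [lead_iter_traj] a non-zero multiple of X^(n+1) x lies in T_(n+1) once n
    is large enough.  Some n serves all generators x, and then
    T_(n+2) / T_(n+1) is finitely generated and torsion. *)
Lemma span_rate_fin N (s : seq (restrC N)) :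
  (forall x, x \in s -> xtors (x : N)) ->
  exists n, (rt muX (spanS s) n < +oo)%E.
Proof.
move=> sx.
have [n nP] : exists n, forall x, x \in s ->
    exists2 r : R, r != 0 & r *: iter n.+1 muX x \in traj muX (spanS s) n.+1.
  have [n nP] : exists n, forall x, x \in s ->
      exists2 p : {poly R}, p != 0 & p *: (x : N) = 0 /\ (size p <= n)%N.
    elim: s sx => [|x s IH] sx; first by exists 0.
    have [n nP] : exists n, forall x, x \in s ->
        exists2 p : {poly R}, p != 0 & p *: (x : N) = 0 /\ (size p <= n)%N.
      by apply: IH => y ys; apply: sx; rewrite inE ys orbT.
    have [p p0 px] := sx x (mem_head _ _).
    exists (maxn (size p) n) => y; rewrite inE => /orP[/eqP ->|/nP[q q0 [qy qn]]].
      by exists p => //; rewrite leq_maxl.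
    by exists q => //; rewrite (leq_trans qn) ?leq_maxr.
  exists n => x xs; have [p p0 [px pn]] := nP x xs.
  exists (lead_coef p); first by rewrite lead_coef_eq0.
  by apply: lead_iter_traj p0 px (leqW pn); exact: mem_spanS.
exists n; set T := traj muX (spanS s) n.+1.
apply: le_lt_trans (_ : (len Lv (addS (spanS [seq iter n.+1 muX x | x <- s]) T) T < +oo)%E).
  apply: (len_le HL) => //; last by move=> x; exact: addSr.
  move=> _ /trajS[y [z [yT zs ->]]]; apply: rpredD; first exact: addSr.
  apply: addSl; have : z \in preS (iter n.+1 muX) (spanS [seq iter n.+1 muX x | x <- s]).
    by apply: spanS_le zs => x xs; rewrite preSE; exact/mem_spanS/map_f.
  by rewrite preSE.
by apply: (len_span_fin Lv_length) => _ /mapP[x xs ->]; exact: nP.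
Qed.

End Entropy.

(** * Additivity and upper continuity of the entropy *)

Section Entropy.
Variables (K : realType) (Q : fieldType) (v : valuation K Q).
Hypothesis v_nd : non_discrete v.
Local Notation R := (valring v).
Local Notation io := (valring_val v).
Variable Lv : lmodType R -> \bar K.
Hypothesis Lv_length : valuation_length Lv.
Let HL : length_function Lv := proj1 Lv_length.
Implicit Types N : lmodType {poly R}.
Local Notation muX := (@mulX R _).
Local Notation ent := (intrinsic_entropy Lv).
Local Notation rt := (rate Lv).
Local Notation lrt := (limrate Lv).

Lemma limrate_eqm N (H G : submodClosed (restrC N)) : H =i G -> lrt muX H = lrt muX G.
Proof.
move=> HG; rewrite /limrate (_ : rt muX H = rt muX G) //; apply/funext => n.
by apply: (len_eqm HL) => x; apply/idP/idP; apply: traj_mono => // y; rewrite HG.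
Qed.

Lemma ent_fg_le N c :
  (forall s : seq (restrC N), (lrt muX (spanS s) <= c)%E) -> (ent N <= c)%E.
Proof.
move=> Hc; apply: (ent_le Lv_length) => H Hin; apply/lee_addgt0Pr => e e0.
have [t [_ tP]] := rate_fg_approx HL e0 Hin.
apply: (@le_trans _ _ (e%:E + lrt muX (spanS t))%E); last by rewrite addeC leeD2r.
apply: le_add_ereal_inf => [|n|n]; [by rewrite lee_fin ltW|exact: rate_ge0|].
by apply: le_trans (limrate_le _ _ _ n) _; rewrite addeC.
Qed.

Lemma ent_ge_span N (s : seq (restrC N)) : (forall x : N, xtors x) ->
  (lrt muX (spanS s) <= ent N)%E.
Proof.
move=> Nt; have [n sn] := span_rate_fin Lv_length (s := s) (fun x _ => Nt x).
exact: (ent_ge Lv_length) sn.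
Qed.

(** [limrate_superadd] applied to trajectories of H and F that are inert: the
    error is a torsion subquotient of a finitely generated module, hence
    bounded. *)
Lemma limrate_superadd_fg N N'' (g : {linear N -> N''}) (H F : submodClosed (restrC N))
    (t : seq (restrC N)) n1 n2 :
  {subset H <= F} -> {subset F <= spanS t} ->
  {subset H <= preS (restrC_map g) (zeroS _)} ->
  (rt muX H n1 < +oo)%E -> (rt muX F n2 < +oo)%E ->
  (lrt muX H + lrt muX (imgS (restrC_map g) F) <= lrt muX F)%E.
Proof.
move=> HF Ft Hg n1P n2P; pose n := maxn n1 n2.
pose Hn := traj muX H n.+1; pose Fn := traj muX F n.+1.
have Hin : (rt muX Hn 0 < +oo)%E.
  rewrite (rate_traj HL).
  by apply: le_lt_trans n1P; apply: rate_noninc => //; rewrite leq_maxl.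
have Fin : (rt muX Fn 0 < +oo)%E.
  rewrite (rate_traj HL).
  by apply: le_lt_trans n2P; apply: rate_noninc => //; rewrite leq_maxr.
have HFn : {subset Hn <= Fn} by exact: traj_mono.
have Hgn : {subset Hn <= preS (restrC_map g) (zeroS _)}.
  apply: traj_ind => i y _ /Hg; rewrite !preSE (iterC (restrC_mapX g)) => /zeroSP ->.
  by rewrite raddf0 rpred0.
have [w wP] := traj_spanS muX t n.+1.
have [C CP] := tors_bounded Lv_length Hn w.
rewrite -(limrate_traj HL _ H n) -(limrate_traj HL _ F n).
rewrite -(limrate_traj HL _ (imgS (restrC_map g) F) n).
have -> : lrt muX (traj muX (imgS (restrC_map g) F) n.+1) = lrt muX (imgS (restrC_map g) Fn).
  by apply: limrate_eqm => x; rewrite (traj_img (restrC_mapX g)).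
apply: (limrate_superadd HL (restrC_mapX g) HFn Hgn Hin Fin (C := C)) => m.
apply: CP => [x|].
  rewrite capSE => /andP[/(traj_mono Ft (leqnn _)) /wP xt _]; exact: addSl.
have := len_traj_fin HL Hin m; rewrite ge0_fin_numE ?len_ge0 //.
apply: le_lt_trans; apply: (@len_inj _ _ _ HL _ _ idfun) => [x|x|x] //.
by rewrite capSE => /andP[].
Qed.

Lemma limrate_mono_fg N (H F : submodClosed (restrC N)) (t : seq (restrC N)) n1 n2 :
  {subset H <= F} -> {subset F <= spanS t} ->
  (rt muX H n1 < +oo)%E -> (rt muX F n2 < +oo)%E -> (lrt muX H <= lrt muX F)%E.
Proof.
move=> HF Ft n1P n2P.
have := limrate_superadd_fg (g := (\0 : {linear N -> N})) HF Ft _ n1P n2P.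
move=> le1; apply: le_trans (le1 _); first by rewrite leeDl // limrate_ge0.
by move=> x _; rewrite preSE; apply/zeroSP.
Qed.

Section Additivity.
Variables (N' N N'' : lmodType {poly R}) (f : {linear N' -> N}) (g : {linear N -> N''}).
Hypothesis f_inj : injective f.
Hypothesis g_surj : range g = setT.
Hypothesis fg : range f = [set x | g x = 0].

Let gf x : g (f x) = 0.
Proof.
have : range f (f x) by exact: imageT.
by rewrite fg. Qed.

(** The submodules A of [rate_subadd] lie in the image of f, hence come from
    inert submodules of N'; let first n and then j tend to infinity. *)
Lemma ent_subadd : (ent N <= ent N' + ent N'')%E.
Proof.
apply: (ent_le Lv_length) => H Hin.
apply: (@le_trans _ _ (ent N' + lrt muX (imgS (restrC_map g) H))%E); last first.
  apply: leeD2l; apply: (ent_ge Lv_length (n := 0)); apply: le_lt_trans Hin.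
  exact: (rate_img HL (restrC_mapX g)).
apply: le_add_ereal_inf => [|j|j]; [exact: ent_ge0|exact: rate_ge0|].
set A := capS (traj muX H j.+2) (preS (restrC_map g) (zeroS _)).
pose A' := preS (restrC_map f) A.
have AA' : imgS (restrC_map f) A' =i A.
  move=> x; apply/idP/idP; first by move=> /imgSP[y + ->]; rewrite preSE.
  move=> xA; have := xA; rewrite capSE => /andP[_]; rewrite preSE => /zeroSP gx.
  have : range f x by rewrite fg.
  by move=> [y _ yx]; apply/imgSP; exists y => //; rewrite preSE /restrC_map /= /restr_map yx.
apply: (@le_trans _ _ (lrt muX A + rt muX (imgS (restrC_map g) H) j)%E).
  rewrite addeC; apply: le_add_ereal_inf => [|n|n]; [exact: rate_ge0|exact: rate_ge0|].
  apply: le_trans (limrate_le _ _ _ (n + j.+1)) _; rewrite addeC.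
  exact: (rate_subadd HL (restrC_mapX g)).
apply: leeD2r; rewrite -(limrate_eqm AA').
have fi : injective (restrC_map f) by [].
rewrite (limrate_inj HL (restrC_mapX f) A' fi).
apply: (ent_ge Lv_length (n := 0)).
rewrite -(rate_inj HL (restrC_mapX f) A' 0 fi).
apply: le_lt_trans (_ : (rt muX H j.+1 < +oo)%E); last first.
  by apply: le_lt_trans Hin; exact: rate_noninc.
have AH : {subset imgS (restrC_map f) A' <= traj muX H j.+2}.
  by move=> x; rewrite AA' capSE => /andP[].
apply: (@len_inj _ _ _ HL _ _ idfun) => [x|x _|x xA xT].
- move=> /(traj_mono AH (leqnn _)); rewrite traj_traj.
  exact.
- by rewrite traj1; exact: AH.
- rewrite traj1 AA' capSE xT preSE; apply/zeroSP.
  have : x \in preS (restrC_map g) (zeroS _).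
    apply: traj_ind xA => i y _ /imgSP[z _ ->]; rewrite preSE (iterC (restrC_mapX g)).
    by rewrite [restrC_map g _]gf raddf0 rpred0.
  by rewrite preSE => /zeroSP.
Qed.

(** Generators s' in N' and lifts of generators s'' in N'' span a submodule
    of N that contains the image of s' and maps onto the span of s''. *)
Lemma ent_superadd : (forall x : N, xtors x) -> (ent N' + ent N'' <= ent N)%E.
Proof.
move=> Nt.
have Nt' (x : N') : xtors x.
  have [p p0 px] := Nt (f x); exists p => //; apply: f_inj.
  by rewrite linearZ /= px raddf0.
have Nt'' (y : N'') : xtors y.
  have : range g y by rewrite g_surj.
  move=> [x _ <-]; have [p p0 px] := Nt x; exists p => //.
  by rewrite -linearZ px raddf0.
have main (s' : seq (restrC N')) (s'' : seq (restrC N'')) :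
    (lrt muX (spanS s') + lrt muX (spanS s'') <= ent N)%E.
  have /choice[lift liftP] : forall y : N'', exists x, g x = y.
    move=> y; have : range g y by rewrite g_surj.
    by move=> [x _ <-]; exists x.
  pose fs := [seq restrC_map f x | x <- s'].
  pose s : seq (restrC N) := fs ++ [seq (lift y : restrC N) | y <- s''].
  have [n1 n1P] := span_rate_fin Lv_length (s := s') (fun x _ => Nt' x).
  have [n2 n2P] := span_rate_fin Lv_length (s := s) (fun x _ => Nt x).
  have fi : injective (restrC_map f) by [].
  pose H := imgS (restrC_map f) (spanS s').
  have Hin : (rt muX H n1 < +oo)%E by rewrite (rate_inj HL (restrC_mapX f) _ _ fi).
  have HF : {subset H <= spanS s}.
    by apply: imgS_spanS => x xs; apply: mem_spanS; rewrite mem_cat map_f.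
  have Hg : {subset H <= preS (restrC_map g) (zeroS _)}.
    by move=> y /imgSP[z _ ->]; rewrite preSE [restrC_map g _]gf rpred0.
  have gs : imgS (restrC_map g) (spanS s) =i spanS s''.
    move=> y; apply/idP/idP.
      move: y; apply: imgS_spanS => x; rewrite mem_cat => /orP[] /mapP[z zs ->].
        by rewrite [restrC_map g _]gf rpred0.
      by rewrite [restrC_map g _]liftP mem_spanS.
    move: y; apply: spanS_le => y ys; rewrite -[y]liftP.
    apply: (@imgS_f _ _ _ (restrC_map g)); apply: mem_spanS.
    by rewrite mem_cat; apply/orP; right; exact: map_f.
  rewrite -(limrate_eqm gs) -(limrate_inj HL (restrC_mapX f) _ fi).
  apply: le_trans (ent_ge_span s Nt).
  exact: (limrate_superadd_fg HF (fun _ => id) Hg Hin n2P).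
case E : (ent N) main => [c| |] main; last 2 first.
- by rewrite leey.
- by have := ent_ge0 Lv_length N; rewrite E.
have step1 s'' : (ent N' + lrt muX (spanS s'' : submodClosed (restrC N'')) <= c%:E)%E.
  have bfin : lrt muX (spanS s'' : submodClosed (restrC N'')) \is a fin_num.
    rewrite ge0_fin_numE ?limrate_ge0 //; apply: le_lt_trans (ltry c).
    by apply: le_trans (main [::] s''); rewrite leeDr // limrate_ge0.
  rewrite -leeBrDr //; apply: ent_fg_le => s'; rewrite leeBrDr //; exact: main.
have afin : ent N' \is a fin_num.
  rewrite ge0_fin_numE ?(ent_ge0 Lv_length) //; apply: le_lt_trans (ltry c).
  by apply: le_trans (step1 [::]); rewrite leeDl // limrate_ge0.
rewrite addeC -leeBrDr //; apply: ent_fg_le => s''; rewrite leeBrDr // addeC.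
exact: step1.
Qed.

End Additivity.
End Entropy.

Section Entropy.
Variables (K : realType) (Q : fieldType) (v : valuation K Q).
Hypothesis v_nd : non_discrete v.
Local Notation R := (valring v).
Local Notation io := (valring_val v).
Variable Lv : lmodType R -> \bar K.
Hypothesis Lv_length : valuation_length Lv.
Let HL : length_function Lv := proj1 Lv_length.
Implicit Types N : lmodType {poly R}.
Local Notation muX := (@mulX R _).
Local Notation ent := (intrinsic_entropy Lv).
Local Notation rt := (rate Lv).
Local Notation lrt := (limrate Lv).

Lemma ent_additive : additive_fun ent.
Proof.
move=> N' N N'' f g f_inj g_surj fg.
apply/eqP; rewrite eq_le (ent_subadd Lv_length f_inj fg) /=.
have [Nt|] := pselect (forall x : N, xtors x).
  exact: (ent_superadd Lv_length f_inj g_surj fg).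
move=> /existsNP[x xfree].
by rewrite [X in (_ <= X)%E](ent_free v_nd Lv_length xfree) leey.
Qed.

Lemma ent_zero N : (forall x : N, x = 0) -> ent N = 0%E.
Proof.
move=> N0; apply/eqP; rewrite eq_le (ent_ge0 Lv_length) andbT.
apply: (ent_le Lv_length) => H _; apply: le_trans (limrate_le _ _ _ 0) _.
by rewrite /rate (len0 HL) // => x _; rewrite (N0 x) rpred0.
Qed.

Lemma ent_iso N N' (f : {linear N -> N'}) : bijective f -> ent N = ent N'.
Proof.
move=> fb; have f_inj := bij_inj fb.
apply/eqP; rewrite eq_le (ent_inj Lv_length f_inj) /=.
case: fb => h hK Kh.
have h_lin : linear h by move=> a x y; apply: f_inj; rewrite linearP !Kh.
pose h' : {linear N' -> N} := HB.pack h (GRing.isLinear.Build _ _ _ _ h h_lin).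
by apply: (ent_inj Lv_length (f := h')); exact: can_inj Kh.
Qed.

(** In the torsion case the R-span of s lies in the R[X]-span of s, so it
    contributes to the entropy of a finitely generated submodule.  A free
    element x makes already the entropy of R[X] x infinite. *)
Lemma ent_upper_continuous N :
  ent N = ereal_sup [set ent (submod F) | F in [set F : submodClosed N | fingenS F]].
Proof.
apply/eqP; rewrite eq_le; apply/andP; split; last first.
  apply: ge_ereal_sup => _ [F _ <-].
  by apply: (ent_inj Lv_length (f := val : {linear submod F -> N})); exact: val_inj.
have [Nt|] := pselect (forall x : N, xtors x); last first.
  move=> /existsNP[x xfree]; apply: (@le_trans _ _ (ent (submod (lineS x)))).
    have xl : x \in lineS x by apply/lineSP; exists 1; rewrite scale1r.
    rewrite [X in (_ <= X)%E](_ : _ = +oo%E) ?leey //.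
    apply: (ent_free v_nd Lv_length (x := Sub x xl)) => -[p p0 px]; apply: xfree.
    exists p => //.
    have -> : p *: x = (val : {linear submod (lineS x) -> N}) (p *: Sub x xl).
      by rewrite linearZ; congr (_ *: _); exact/esym/SubK.
    by rewrite px raddf0.
  apply: ereal_sup_ubound; exists (lineS x) => //.
  have [n [g gP]] := fingen_spanS [:: x]; exists n, g => y; rewrite -gP.
  split; first exact: addSl.
  by move=> /addSP[z [_ [zx /zeroSP -> ->]]]; rewrite addr0.
apply: (ent_fg_le Lv_length) => s.
pose G : submodClosed N := spanS (s : seq N).
apply: (@le_trans _ _ (ent (submod G))); last first.
  by apply: ereal_sup_ubound; exists G => //; exact: fingen_spanS.
pose f : {linear submod G -> N} := val.
have fi : injective (restrC_map f) by move=> x y; exact: val_inj.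
pose H := preS (restrC_map f) (spanS s).
have sG : {subset spanS s <= G}.
  move=> x; suff : {subset spanS s <= imgS (restrC_map f) (fullS _)}.
    by move=> H1 /H1 /imgSP[y _ ->]; exact: valP.
  apply: spanS_le => y ys; apply/imgSP; have yG : y \in G by exact: mem_spanS.
  by exists (Sub y yG : submod G) => //; exact/esym/SubK.
have HE : imgS (restrC_map f) H =i spanS s.
  move=> x; apply/idP/idP; first by move=> /imgSP[y + ->]; rewrite preSE.
  move=> xs; have E : restrC_map f (Sub x (sG x xs) : submod G) = x by exact: SubK.
  by apply/imgSP; exists (Sub x (sG x xs) : submod G); rewrite ?preSE E.
have [n sn] := span_rate_fin Lv_length (s := s) (fun x _ => Nt x).
rewrite -(limrate_eqm Lv_length HE) (limrate_inj HL (restrC_mapX f) H fi).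
apply: (ent_ge Lv_length (n := n)).
rewrite -(rate_inj HL (restrC_mapX f) H n fi); apply: le_lt_trans sn.
by apply: (len_le HL) => x; apply: traj_mono => // y; rewrite HE.
Qed.

Theorem ent_length_function : length_function ent.
Proof.
split; [exact: (ent_ge0 Lv_length) | exact: ent_zero | exact: ent_iso |
  exact: ent_additive | exact: ent_upper_continuous].
Qed.

End Entropy.

(** * Modules induced from the base ring *)

Section PolyTensor.
Variables (R : comNzRingType) (M : lmodType R).
Local Notation T := (tensor M {poly R}).
Local Notation muX := (@mulX R _).

Lemma tpi_sum (s : seq (M * {poly R})) : tpi s = \sum_(u <- s) tmk u.1 u.2.
Proof.
elim: s => [|[m p] s IH]; first by rewrite big_nil.
by rewrite big_cons -IH; exact/esym/tpiD.
Qed.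

Section Extension.
Variables (N : lmodType {poly R}) (h : {linear M -> restrC N}).

(** The bilinear map behind the R[X]-linear extension of h to M (x) R[X]. *)
Definition ext_bil (m : M) (p : {poly R}) : restrC N := p *: (h m : N).

Lemma ext_bil_bilinear : bilinear_for *:%R *:%R ext_bil.
Proof.
split=> [p a x y|m a p q]; rewrite /ext_bil.
  by rewrite linearP scalerDr [a *: h x]restrC_scale !scalerA mulrC -scalerA.
rewrite scalerDl -mul_polyC -scalerA; congr (_ + _).
Qed.

HB.instance Definition _ := bilinear_isBilinear.Build R M {poly R} (restrC N)
  _ _ ext_bil ext_bil_bilinear.

Definition ext_map (x : T) : N := \sum_(u <- repr x) ext_bil u.1 u.2.

Lemma ext_map_tpi s : ext_map (tpi s) = \sum_(u <- s) u.2 *: (h u.1 : N).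
Proof. exact: (repr_tpi s ext_bil). Qed.

Lemma ext_map_linear : linear ext_map.
Proof.
move=> c x y; have [s ->] := tpiP x; have [t ->] := tpiP y.
rewrite [c *: tpi s](tpiZ c s) [_ + _](tpiD _ t) !ext_map_tpi big_cat big_map /=.
rewrite scaler_sumr; congr (_ + _); apply: eq_bigr => u _.
by rewrite scalerA.
Qed.

HB.instance Definition _ := GRing.isLinear.Build {poly R} T N _ ext_map
  ext_map_linear.

Lemma ext_map_tmk m p : ext_map (tmk m p) = p *: (h m : N).
Proof. by rewrite ext_map_tpi big_seq1. Qed.

End Extension.

Section Coefficients.
Variable i : nat.

(** The bilinear map behind the i-th coefficient of an element of M (x) R[X],
    regarded as a polynomial with coefficients in M. *)
Definition coef_bil (m : M) (p : {poly R}) : M := p`_i *: m.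

Lemma coef_bil_bilinear : bilinear_for *:%R *:%R coef_bil.
Proof.
split=> [p a x y|m a p q]; rewrite /coef_bil.
  by rewrite scalerDr !scalerA mulrC -scalerA.
by rewrite coefD coefZ scalerDl -scalerA.
Qed.

HB.instance Definition _ := bilinear_isBilinear.Build R M {poly R} M
  _ _ coef_bil coef_bil_bilinear.

Definition tcoef (x : restrC T) : M := \sum_(u <- repr (x : T)) coef_bil u.1 u.2.

Lemma tcoef_tpi s : tcoef (tpi s) = \sum_(u <- s) u.2`_i *: u.1.
Proof. exact: (repr_tpi s coef_bil). Qed.

Lemma tcoef_linear : linear tcoef.
Proof.
move=> c x y; have [s ->] := tpiP x; have [t ->] := tpiP y.
rewrite [c *: _](tpiZ c%:P s) [_ + _](tpiD _ t) !tcoef_tpi big_cat big_map /=.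
rewrite scaler_sumr; congr (_ + _); apply: eq_bigr => u _.
by rewrite coefCM scalerA.
Qed.

HB.instance Definition _ := GRing.isLinear.Build R (restrC T) M _ tcoef tcoef_linear.

Lemma tcoef_tmk m p : tcoef (tmk m p) = p`_i *: m.
Proof. by rewrite tcoef_tpi big_seq1. Qed.

End Coefficients.

Lemma tcoefX i (x : restrC T) : tcoef i (muX x) = if i is j.+1 then tcoef j x else 0.
Proof.
have [s ->] := tpiP x; rewrite [muX _](tpiZ 'X s) tcoef_tpi big_map /=.
case: i => [|j].
  by rewrite big1 // => u _; rewrite coefXM scale0r.
by rewrite tcoef_tpi; apply: eq_bigr => u _; rewrite coefXM.
Qed.

Lemma tcoef_finite (x : restrC T) : exists n, forall i, (n <= i)%N -> tcoef i x = 0.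
Proof.
have [s ->] := tpiP x; exists (\max_(u <- s) size u.2)%N => i ni.
rewrite tcoef_tpi big_seq big1 // => u us; rewrite nth_default ?scale0r //.
by apply: leq_trans ni; exact: (leq_bigmax_seq (F := fun u : M * {poly R} => size u.2)).
Qed.

(** Expand each polynomial factor into monomials: every bilinear map b takes
    the value \sum_i b (tcoef i x) 'X^i at x. *)
Lemma tcoef_eq0 (x : restrC T) : (forall i, tcoef i x = 0) -> x = 0.
Proof.
have [s ->] := tpiP x => s0; apply/tpi_eq => U b; rewrite big_nil.
pose n := (\max_(u <- s) size u.2)%N.
transitivity (\sum_(u <- s) \sum_(i < n) b (u.2`_i *: u.1) 'X^i).
  rewrite !big_seq; apply: eq_bigr => u us.
  have un : (size u.2 <= n)%N.
    exact: (leq_bigmax_seq (F := fun u : M * {poly R} => size u.2)).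
  rewrite -{1}[u.2]coefK poly_def linear_sumr.
  rewrite (big_ord_widen n (fun i => b u.1 (u.2`_i *: 'X^i)) un) big_mkcond /=.
  apply: eq_bigr => i _; rewrite linearZl_LR; case: ltnP => [_|/(nth_default 0) ->].
    by rewrite linearZr_LR.
  by rewrite scale0r.
rewrite exchange_big big1 // => i _ /=.
by have := s0 i; rewrite tcoef_tpi => E; rewrite -linear_sumlz E linear0l.
Qed.

Definition temb (m : M) : restrC T := tmk m 1.

Lemma temb_linear : linear temb.
Proof.
move=> a x y; rewrite /temb.
have -> : a *: (tmk x 1 : restrC T) + tmk y 1 = tpi [:: (x, a%:P * 1); (y, 1)].
  by rewrite [a *: _](tpiZ a%:P [:: (x, 1)]) [_ + _](tpiD _ [:: (y, 1)]).
apply/tpi_eq => U b; rewrite !big_cons !big_nil /= !addr0 linearPl mulr1.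
by rewrite -alg_polyC linearZr_LR.
Qed.

HB.instance Definition _ := GRing.isLinear.Build R M (restrC T) _ temb temb_linear.

Lemma tmk_temb m p : tmk m p = p *: (temb m : T).
Proof. by rewrite [RHS]tpiZ /tscale_seq /= mulr1. Qed.

Lemma temb_gen (x : restrC T) : exists n, x \in traj muX (imgS temb (fullS M)) n.+1.
Proof.
have [s ->] := tpiP x; exists (\max_(u <- s) size u.2)%N.
rewrite tpi_sum big_seq; apply: rpred_sum => u us; rewrite tmk_temb.
have un : (size u.2 <= (\max_(u <- s) size u.2).+1)%N.
  by apply: leqW; exact: (leq_bigmax_seq (F := fun u : M * {poly R} => size u.2)).
rewrite (poly_scaleE _ un); apply: rpred_sum => i _; apply: rpredZ.
by apply: traj_iter => //; exact: imgS_f.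
Qed.

End PolyTensor.

Section Evaluation.
Variables (R : comNzRingType) (N : lmodType {poly R}).
Local Notation muX := (@mulX R _).

Definition evT (F : submodClosed (restrC N)) : {linear tensor (submod F) {poly R} -> N} :=
  ext_map (val : {linear submod F -> restrC N}).

Lemma evT_temb (F : submodClosed (restrC N)) (m : submod F) : evT F (temb m) = val m.
Proof. by rewrite [LHS]ext_map_tmk scale1r. Qed.

Lemma evT_surj (F : submodClosed (restrC N)) (s : seq N) y :
  (forall x, x \in s -> (x : restrC N) \in F) -> y \in spanS s ->
  exists t, y = evT F t.
Proof.
move=> sF ys; suff : y \in imgS (evT F) (fullS _) by move=> /imgSP[t _ ->]; exists t.
apply: spanS_le ys => x xs; apply/imgSP.
exists (temb (Sub x (sF x xs) : submod F)) => //.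
by rewrite evT_temb; exact/esym/SubK.
Qed.

(** The relations are X (x) t - 1 (x) X t for t in T_(n+1).  They are independent:
    the i-th coefficient of a t is t_(i-1) - X t_i, so if a t = 0 then the
    coefficients of t vanish by descending induction. *)
Lemma traj_presentation (F : submodClosed (restrC N)) n :
  exists2 a : {linear tensor (submod (traj muX F n.+1)) {poly R} ->
                      tensor (submod (traj muX F n.+2)) {poly R}},
    injective a & forall t, evT (traj muX F n.+2) (a t) = 0.
Proof.
pose A := traj muX F n.+1; pose B := traj muX F n.+2.
have AB : {subset A <= B} by exact: traj_mono.
have [i iE] := @sub_map _ _ _ idfun A B AB.
have XAB x : x \in A -> muX x \in B.
  by move=> /(@traj_shift _ _ _ _ _ 1); rewrite addn1.
have [p pE] := sub_map XAB.
pose TB := tensor (submod B) {poly R}; pose TA := tensor (submod A) {poly R}.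
pose h : {linear submod A -> restrC TB} :=
  (@mulX R TB \o (@temb _ _ \o i)) \- (@temb _ _ \o p).
pose a : {linear TA -> TB} := ext_map h.
pose b := evT B.
have aE k (t : restrC TA) : tcoef k (restrC_map a t) =
    (if k is j.+1 then i (tcoef j t) else 0) - p (tcoef k t).
  have [w ->] := tpiP t; rewrite tpi_sum.
  have tS l : tcoef l (\sum_(u <- w) tmk u.1 u.2 : restrC TA) = \sum_(u <- w) u.2`_l *: u.1.
    by rewrite [LHS]linear_sum; apply: eq_bigr => u _; exact: tcoef_tmk.
  have -> : restrC_map a (\sum_(u <- w) tmk u.1 u.2) =
      \sum_(u <- w) (muX (tmk (i u.1) u.2) - tmk (p u.1) u.2) :> restrC TB.
    rewrite [LHS]linear_sum; apply: eq_bigr => u _.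
    rewrite [LHS]ext_map_tmk /= scalerBr -tmk_temb; congr (_ - _).
    by rewrite /mulX !(tmk_temb (i u.1) u.2) !scalerA mulrC.
  rewrite linear_sum tS.
  transitivity (\sum_(u <- w) ((if k is j.+1 then i (u.2`_j *: u.1) else 0) - p (u.2`_k *: u.1))).
    apply: eq_bigr => u _.
    rewrite linearB /= tcoefX tcoef_tmk; congr (_ + - _); last by rewrite linearZ.
    by case: k => // j; rewrite tcoef_tmk linearZ.
  rewrite big_split; congr (_ + _); last by rewrite sumrN; congr (- _); exact/esym/linear_sum.
  case: k => [|k]; first by rewrite big1.
  by rewrite tS linear_sum.
have i_inj : injective i.
  by move=> x y /(congr1 val); rewrite !iE => /val_inj.
have a_inj : injective a.
  apply: (@lin_inj _ _ _ a) => t at0; apply: tcoef_eq0 => k.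
  have [m mP] := tcoef_finite (t : restrC TA).
  have : forall l, (m <= k + l)%N -> tcoef k (t : restrC TA) = 0.
    move=> l; elim: l k => [|l IH] k; first by rewrite addn0 => /mP.
    rewrite addnS -addSn => /IH tk1; apply: i_inj.
    have := aE k.+1 t; rewrite tk1 !raddf0 addr0 => <-.
    by rewrite [restrC_map a t]at0 raddf0.
  by apply; exact: leq_addl.
have ba t : b (a t) = 0.
  have [w ->] := tpiP t; rewrite tpi_sum.
  have -> : b (a (\sum_(u <- w) tmk u.1 u.2)) = \sum_(u <- w) b (a (tmk u.1 u.2)).
    have -> : a (\sum_(u <- w) tmk u.1 u.2) = \sum_(u <- w) a (tmk u.1 u.2).
      exact: linear_sum.
    exact: linear_sum.
  rewrite big1 // => u _.
  have -> : a (tmk u.1 u.2) = u.2 *: (h u.1 : TB) by exact: ext_map_tmk.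
  have bE := evT_temb (F := B).
  have bh : b (h u.1) = 0.
    transitivity (b ('X *: (temb (i u.1) : TB) - (temb (p u.1) : TB))); first by [].
    by rewrite linearB linearZ !bE iE pE; exact: subrr.
  by rewrite linearZ [b _]bh; exact: scaler0.
by exists a.
Qed.

End Evaluation.

Section Entropy.
Variables (K : realType) (Q : fieldType) (v : valuation K Q).
Hypothesis v_nd : non_discrete v.
Local Notation R := (valring v).
Local Notation io := (valring_val v).
Variable Lv : lmodType R -> \bar K.
Hypothesis Lv_length : valuation_length Lv.
Let HL : length_function Lv := proj1 Lv_length.
Implicit Types N : lmodType {poly R}.
Local Notation muX := (@mulX R _).
Local Notation ent := (intrinsic_entropy Lv).
Local Notation rt := (rate Lv).
Local Notation lrt := (limrate Lv).

Section Induced.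
Variable M : lmodType R.
Local Notation T := (tensor M {poly R}).
Local Notation H0 := (imgS (@temb R M) (fullS M)).

Lemma tcoef_iter i n (x : restrC T) :
  tcoef i (iter n muX x) = if (i < n)%N then 0 else tcoef (i - n) x.
Proof.
elim: n i => [|n IH] i /=; first by rewrite subn0.
by rewrite tcoefX; case: i => // i; rewrite IH ltnS subSS.
Qed.

Lemma traj_temb_coef n i (x : restrC T) :
  (n <= i)%N -> x \in traj muX H0 n -> tcoef i x = 0.
Proof.
move=> ni xT; apply/zeroSP; suff : x \in preS (tcoef i) (zeroS M) by [].
apply: traj_ind xT => j _ jn /imgSP[m _ ->]; rewrite preSE; apply/zeroSP.
rewrite [LHS]tcoef_iter ltnNge (ltnW (leq_trans jn ni)) /= tcoef_tmk coefC.
by rewrite subn_eq0 leqNgt (leq_trans jn ni) scale0r.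
Qed.

Lemma len_temb : (len Lv H0 (zeroS _) <= Lv M)%E.
Proof.
rewrite -(len_full HL).
apply: (@len_surj _ _ _ HL _ _ (@temb R M)) => [x _|x _ /zeroSP ->|_ /imgSP[x _ ->]].
- exact: imgS_f.
- by rewrite raddf0 rpred0.
- by exists x; [|rewrite subrr rpred0].
Qed.

Lemma rate_temb n : rt muX H0 n = Lv M.
Proof.
apply/eqP; rewrite eq_le; apply/andP; split.
  exact: le_trans (rate_le_len HL _ _ _) len_temb.
rewrite -(len_full HL) /rate.
apply: (@len_inj _ _ _ HL _ _ (iter n.+1 muX \o @temb R M)) => [m _|m _|m _].
- by apply: traj_iter => //; exact: imgS_f.
- by move=> /zeroSP ->; rewrite raddf0 rpred0.
- move=> /(traj_temb_coef (leqnn _)) E; apply/zeroSP; rewrite -[RHS]E.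
  by rewrite [RHS]tcoef_iter ltnn subnn tcoef_tmk coefC /= scale1r.
Qed.

(** Every finitely generated submodule lies in a trajectory of M (x) 1.  The
    trajectory has finite length, so it has the larger limit rate, which is
    the limit rate of M (x) 1. *)
Lemma ent_tensor : (Lv M < +oo)%E -> ent T = Lv M.
Proof.
move=> Mfin.
have lrtE : lrt muX H0 = Lv M.
  apply/eqP; rewrite eq_le -{1}(rate_temb 0) limrate_le /=.
  by apply: le_ereal_inf_tmp => _ [n _ <-]; rewrite rate_temb.
apply/eqP; rewrite eq_le; apply/andP; split; last first.
  by rewrite -lrtE; apply: (ent_ge Lv_length (n := 0)); rewrite rate_temb.
apply: (ent_fg_le Lv_length) => s.
have [m sm] : exists m, {subset spanS s <= traj muX H0 m.+1}.
  exact: span_sub_traj (@temb_gen R M).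
rewrite -lrtE -(limrate_traj HL muX H0 m).
apply: (limrate_mono_fin HL muX sm); apply: (len_traj0_fin HL).
exact: le_lt_trans len_temb Mfin.
Qed.

End Induced.
End Entropy.

(** * Primitive polynomials and Gauss's lemma *)

Section Gauss.
Variables (K : realType) (Q : fieldType) (v : valuation K Q).
Local Notation R := (valring v).
Local Notation io := (valring_val v).

Definition integral (p : {poly Q}) := forall i, (0 <= v p`_i)%E.

Definition primitive (p : {poly Q}) := integral p /\ exists i, v p`_i = 0%E.

Lemma val_sum_gt0 (I : finType) (P : pred I) (F : I -> Q) :
  (forall i, P i -> (0 < v (F i))%E) -> (0 < v (\sum_(i | P i) F i)%R)%E.
Proof.
move=> F0; apply: (big_ind (fun x => (0 < v x)%E)) => // [|x y x0 y0].
  by rewrite (_ : v 0 = +oo%E) //; exact/val_eqy.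
by apply: lt_le_trans (Defs.valD v x y); rewrite lt_min x0.
Qed.

Lemma val_sum_ge0 (I : finType) (P : pred I) (F : I -> Q) :
  (forall i, P i -> (0 <= v (F i))%E) -> (0 <= v (\sum_(i | P i) F i)%R)%E.
Proof.
move=> F0; apply: (big_ind (fun x => (0 <= v x)%E)) => // [|x y x0 y0].
  by rewrite (_ : v 0 = +oo%E) //; exact/val_eqy.
by apply: le_trans (Defs.valD v x y); rewrite le_min x0.
Qed.

Lemma val_eq0D x y : v x = 0%E -> (0 < v y)%E -> v (x + y) = 0%E.
Proof.
move=> x0 y0; apply/eqP; rewrite eq_le; apply/andP; split; last first.
  by apply: le_trans (Defs.valD v x y); rewrite le_min x0 lexx ltW.
rewrite leNgt; apply/negP => xy0.
have := Defs.valD v (x + y) (- y); rewrite addrK x0 Defs.valN.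
by rewrite leNgt lt_min xy0 y0.
Qed.

Lemma integralM p q : integral p -> integral q -> integral (p * q).
Proof.
move=> p0 q0 i; rewrite coefM; apply: val_sum_ge0 => j _.
by rewrite Defs.valM adde_ge0.
Qed.

(** If i and j are the first indices at which p and q have a coefficient of
    value 0, then in the coefficient of p q at i + j only the term
    p_i q_j has value 0. *)
Lemma primitiveM p q : primitive p -> primitive q -> primitive (p * q).
Proof.
move=> [p0 pz] [q0 qz]; split; first exact: integralM.
have {}pz : exists i, v p`_i == 0%E by have [i E] := pz; exists i; rewrite E.
have {}qz : exists i, v q`_i == 0%E by have [i E] := qz; exists i; rewrite E.
case: (ex_minnP pz) => i /eqP pi imin; case: (ex_minnP qz) => j /eqP qj jmin.
have plt k : (k < i)%N -> (0 < v p`_k)%E.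
  move=> ki; rewrite lt_neqAle p0 andbT eq_sym; apply/negP => /imin.
  by rewrite leqNgt ki.
have qlt k : (k < j)%N -> (0 < v q`_k)%E.
  move=> kj; rewrite lt_neqAle q0 andbT eq_sym; apply/negP => /jmin.
  by rewrite leqNgt kj.
exists (i + j)%N; rewrite coefM.
have ilt : (i < (i + j).+1)%N by rewrite ltnS leq_addr.
rewrite (bigD1 (Ordinal ilt)) //=; apply: val_eq0D.
  by rewrite Defs.valM addKn pi qj adde0.
apply: val_sum_gt0 => -[k kij]; rewrite -val_eqE /= => ki.
rewrite Defs.valM; case: (ltngtP k i) ki => // [ki _|ik _].
  by apply: lt_le_trans (plt _ ki) _; rewrite leeDl.
have kj : (i + j - k < j)%N by rewrite ltn_subLR // ltn_add2r.
by apply: lt_le_trans (qlt _ kj) _; rewrite leeDr.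
Qed.

Lemma val_div_ge0 x y : y != 0 -> (v y <= v x)%E -> (0 <= v (x / y)%R)%E.
Proof.
move=> y0 yx; have yf := val_fin v y0.
have := Defs.valM v (x / y) y; rewrite divfK // => E.
by rewrite E in yx; rewrite -(leeD2rE _ _ yf) add0e.
Qed.

Lemma primitive_scale p : p != 0 -> exists2 a, a != 0 & primitive (a *: p).
Proof.
move=> p0; have sp : (0 < size p)%N by rewrite lt0n size_poly_eq0.
pose i0 : 'I_(size p) := Ordinal sp.
case: (@arg_minP _ _ _ i0 xpredT (fun i : 'I_(size p) => v p`_i)) => // k _ kmin.
have szp : ((size p).-1 < size p)%N by rewrite prednK.
have pk0 : p`_k != 0.
  apply/eqP => E; have := kmin (Ordinal szp) isT; rewrite E (_ : v 0 = +oo%E); last exact/val_eqy.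
  rewrite leye_eq => /eqP/(val_eqy v); move/eqP; rewrite -lead_coefE lead_coef_eq0.
  by apply/negP.
exists (p`_k)^-1; first by rewrite invr_eq0.
split=> [i|]; last by exists k; rewrite coefZ mulVf // Defs.val1.
rewrite coefZ mulrC; case: (ltnP i (size p)) => ip.
  by apply: val_div_ge0 => //; exact: (kmin (Ordinal ip)).
by rewrite nth_default // mul0r (_ : v 0 = +oo%E) //; exact/val_eqy.
Qed.

Lemma primitive_integral_le p a b :
  primitive (a *: p) -> integral (b *: p) -> (v a <= v b)%E.
Proof.
move=> [_ [i]] + /(_ i); rewrite !coefZ !Defs.valM => E.
have pf : v p`_i \is a fin_num.
  apply/negPn/negP; rewrite fin_numE val_neqNy /= negbK => /eqP vp.
  have := val_neqNy v a; move: E; rewrite vp.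
  by case: (v a).
by rewrite -E leeD2rE.
Qed.

Lemma primitive_unique p a b : primitive (a *: p) -> primitive (b *: p) -> v a = v b.
Proof.
by move=> pa pb; apply/eqP; rewrite eq_le !(primitive_integral_le (p := p)) //;
  [case: pa|case: pb].
Qed.

(** Divide q by a coefficient of least value: p q becomes primitive, so this
    least value cannot be negative. *)
Lemma primitive_cofactor p q : primitive p -> integral (p * q) -> integral q.
Proof.
have [->|q0] := eqVneq q 0.
  by move=> _ _ i; rewrite coef0 (_ : v 0 = +oo%E) //; exact/val_eqy.
move=> pp pq; have [b b0 bq] := primitive_scale q0.
have pbq : primitive (b *: (p * q)) by rewrite scalerAr; exact: primitiveM.
have vb : (v b <= 0)%E.
  by rewrite -(Defs.val1 v); apply: primitive_integral_le pbq _; rewrite scale1r.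
move=> i; have := (proj1 bq) i; rewrite coefZ Defs.valM => vbq.
by apply: le_trans vbq _; rewrite -[leRHS]add0e leeD2r.
Qed.

Lemma integral_lift p : integral p -> exists P : {poly R}, map_poly io P = p.
Proof.
move=> p0; exists (\poly_(i < size p) (Sub p`_i (p0 i) : R)).
apply/polyP => i; rewrite coef_map coef_poly; case: ltnP => ip; first exact: SubK.
by rewrite nth_default // rmorph0.
Qed.

Lemma ioSub x (vx : (0 <= v x)%E) : io (Sub x vx : R) = x.
Proof. exact: SubK. Qed.

Lemma integral_map (P : {poly R}) : integral (map_poly io P).
Proof. by move=> i; rewrite coef_map; exact: valR_ge0. Qed.

Section CharpolyOver.
Variables (V : vectType Q) (phi : {linear V -> V}).

Lemma charpoly_monic : charpoly phi \is monic.
Proof. exact: char_poly_monic. Qed.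

(** Minimality of s means exactly that s p is primitive, and the leading
    coefficient of s p is s since p is monic. *)
Lemma charpoly_over_lead (P : {poly R}) a :
  charpoly_over phi P -> primitive (a *: charpoly phi) -> v (io (lead_coef P)) = v a.
Proof.
move=> [s [sP smin]] pa.
have -> : io (lead_coef P) = io s.
  have := congr1 lead_coef sP; rewrite lead_coefZ (monicP charpoly_monic) mulr1 => <-.
  by rewrite lead_coef_map_inj //; exact: (@io_inj _ _ v).
have [A AE] := integral_lift (proj1 pa).
have va : (0 <= v a)%E.
  have := (proj1 pa) (size (charpoly phi)).-1; rewrite coefZ -lead_coefE.
  by rewrite (monicP charpoly_monic) mulr1.
apply/eqP; rewrite eq_le; apply/andP; split.
  have := smin (Sub a va : R) A; rewrite ioSub; apply.
  by rewrite /clears AE ioSub.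
apply: primitive_integral_le pa _; rewrite -sP; exact: integral_map.
Qed.

Lemma charpoly_over_exists : exists P : {poly R}, charpoly_over phi P.
Proof.
have [a a0 pa] := primitive_scale (monic_neq0 charpoly_monic).
have [A AE] := integral_lift (proj1 pa).
have va : (0 <= v a)%E.
  have := (proj1 pa) (size (charpoly phi)).-1; rewrite coefZ -lead_coefE.
  by rewrite (monicP charpoly_monic) mulr1.
exists A, (Sub a va); split; first by rewrite /clears AE ioSub.
move=> t P' tP; rewrite ioSub; apply: primitive_integral_le pa _.
by rewrite -tP; exact: integral_map.
Qed.

End CharpolyOver.
End Gauss.

(** * Linear transformations of finite dimensional spaces *)

Section CharPolyMatrices.
Variable F : fieldType.

Lemma char_poly_sim n m (A : 'M[F]_n) (B : 'M[F]_m) (U : 'M[F]_(m, n)) (W : 'M[F]_(n, m)) :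
  U *m W = 1%:M -> W *m U = 1%:M -> U *m A = B *m U -> char_poly A = char_poly B.
Proof.
move=> UW WU UA.
have mn : m = n by apply/eqP; rewrite eqn_leq (mulmx1_min UW) (mulmx1_min WU).
subst n; pose c := map_mx (@polyC F).
have cUA : c _ _ U *m char_poly_mx A = char_poly_mx B *m c _ _ U.
  rewrite /char_poly_mx mulmxBr mulmxBl -!map_mxM UA; congr (_ - _).
  by rewrite -scalar_mxC.
have := congr1 determinant cUA; rewrite !det_mulmx mulrC.
have dU : \det (c _ _ U) != 0.
  rewrite det_map_mx polyC_eq0 -unitfE -unitmxE.
  by case/mulmx1_unit: UW.
by move/(mulIf dU).
Qed.

Lemma char_poly_block m n (A : 'M[F]_m) (C : 'M[F]_(n, m)) (B : 'M[F]_n) :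
  char_poly (block_mx A 0 C B) = char_poly A * char_poly B.
Proof.
rewrite /char_poly /char_poly_mx scalar_mx_block map_block_mx opp_block_mx add_block_mx.
by rewrite map_mx0 oppr0 addr0 det_lblock.
Qed.

End CharPolyMatrices.

Section RestrQ.
Variables (K : realType) (Q : fieldType) (v : valuation K Q).
Local Notation R := (valring v).
Local Notation io := (valring_val v).

Lemma restrQ_scaleE (V : lmodType Q) (phi : {linear V -> V}) (p : {poly R}) (x : V) :
  p *: (x : restrQ v phi) = \sum_(i < size p) io p`_i *: iter i phi x.
Proof. by []. Qed.

Lemma restrQ_restrC (V : lmodType Q) (phi : {linear V -> V}) (a : R) (x : V) :
  a *: (x : restrC (restrQ v phi)) = io a *: x.
Proof. exact: polymodC. Qed.

Lemma restrQ_iter (V : lmodType Q) (phi : {linear V -> V}) i (x : V) :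
  iter i (@mulX R (restrQ v phi)) x = iter i phi x.
Proof. by elim: i => //= i IH; rewrite IH [LHS]polymodX. Qed.

Section Map.
Variables (V W : lmodType Q) (phi : {linear V -> V}) (psi : {linear W -> W}).
Variable f : {linear V -> W}.
Hypothesis fC : forall x, f (phi x) = psi (f x).

Lemma restrQ_linear : linear (f : restrQ v phi -> restrQ v psi).
Proof.
move=> p x y; rewrite [LHS](raddfD f); congr (_ + _).
rewrite restrQ_scaleE [LHS]linear_sum restrQ_scaleE; apply: eq_bigr => i _.
have -> : f (io p`_i *: iter i phi x) = io p`_i *: f (iter i phi x) by exact: linearZ.
have -> : f (iter i phi x) = iter i psi (f x); last by [].
by elim: (i : nat) => //= k <-; rewrite fC.
Qed.

Definition restrQ_map : {linear restrQ v phi -> restrQ v psi} :=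
  HB.pack (f : restrQ v phi -> restrQ v psi)
    (GRing.isLinear.Build _ _ _ _ (f : restrQ v phi -> restrQ v psi) restrQ_linear).

End Map.
End RestrQ.

Section Entropy.
Variables (K : realType) (Q : fieldType) (v : valuation K Q).
Hypothesis v_nd : non_discrete v.
Local Notation R := (valring v).
Local Notation io := (valring_val v).
Variable Lv : lmodType R -> \bar K.
Hypothesis Lv_length : valuation_length Lv.
Let HL : length_function Lv := proj1 Lv_length.
Implicit Types N : lmodType {poly R}.
Local Notation muX := (@mulX R _).
Local Notation ent := (intrinsic_entropy Lv).
Local Notation rt := (rate Lv).
Local Notation lrt := (limrate Lv).

Lemma ent_restrQ_sim (V W : lmodType Q) (phi : {linear V -> V}) (psi : {linear W -> W})
    (f : {linear V -> W}) : (forall x, f (phi x) = psi (f x)) -> bijective f ->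
  ent (restrQ v phi) = ent (restrQ v psi).
Proof. by move=> fC fb; apply: (ent_iso Lv_length (f := restrQ_map v fC)). Qed.

Local Notation modA A := (restrQ v (mulmxr A : {linear 'rV_ _ -> 'rV_ _})).

Section Cyclic.
Variables (n : nat) (A : 'M[Q]_n.+1) (x : 'rV[Q]_n.+1).
Hypothesis x_cyc : forall f : {poly Q}, (size f <= n.+1)%N ->
  x *m horner_mx A f = 0 -> f = 0.
Local Notation N := (restrQ v (mulmxr A : {linear 'rV_n.+1 -> 'rV_n.+1})).
Local Notation X := (@mulX R N).

Lemma cyc_iter i (y : 'rV[Q]_n.+1) : iter i X y = y *m A ^+ i.
Proof.
rewrite restrQ_iter; elim: i => [|i IH]; first by rewrite expr0 mulmx1.
by rewrite /= IH -mulmxA exprSr.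
Qed.

Lemma horner_sum (c : nat -> R) k :
  x *m horner_mx A (\poly_(i < k) io (c i)) = \sum_(i < k) (c i *: (iter i X x : restrC N)).
Proof.
rewrite poly_def rmorph_sum mulmx_sumr; apply: eq_bigr => i _.
rewrite restrQ_restrC cyc_iter -mul_polyC rmorphM rmorphXn /= horner_mx_C horner_mx_X.
by rewrite -mulmxE mul_scalar_mx scalemxAr.
Qed.

Lemma cyc_ann f : x *m horner_mx A f = 0 -> char_poly A %| f.
Proof.
move=> xf; rewrite /Pdiv.Field.dvdp; apply/eqP/x_cyc.
  by rewrite -ltnS -(size_char_poly A) ltn_modp monic_neq0 // char_poly_monic.
have := congr1 (fun g => x *m horner_mx A g) (divp_eq f (char_poly A)).
by rewrite /= xf rmorphD rmorphM /= Cayley_Hamilton mulr0 add0r => <-.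
Qed.

Variable s : R.
Hypothesis sP : primitive v (io s *: char_poly A).

Lemma cyc_trajP m (y : restrC N) : y \in traj X (lineS (x : restrC N)) m <->
  exists c : nat -> R, y = \sum_(i < m) c i *: iter i X x.
Proof.
rewrite trajP; split.
  move=> [h hx ->]; have /choice[c cP] : forall i, exists a : R, h i = a *: (x : restrC N).
    by move=> i; apply/lineSP.
  by exists c; apply: eq_bigr => i _; rewrite cP linearZ.
move=> [c ->]; exists (fun i => c i *: (x : restrC N)).
  by move=> i; apply/lineSP; exists (c i).
by apply: eq_bigr => i _; rewrite linearZ.
Qed.

(** If c X^(m+1) x is an R-combination of lower powers, the resulting integral
    polynomial f is a multiple of the characteristic polynomial p, and f is an
    integral multiple of the primitive polynomial s p by Gauss's lemma.
    Conversely, s p itself gives the relation for c = s in degree n + 1. *)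
Lemma cyc_lead m c : (n <= m)%N ->
  c *: (iter m.+1 X x : restrC N) \in traj X (lineS (x : restrC N)) m.+1 <->
  exists b : R, c = b * s.
Proof.
move=> nm; split; last first.
  move=> [b ->]; rewrite -scalerA; apply: rpredZ.
  have [P PE] := integral_lift (proj1 sP).
  have Ps i : io P`_i = io s * (char_poly A)`_i by rewrite -coef_map PE coefZ.
  have PX : \sum_(i < n.+2) P`_i *: (iter i X x : restrC N) = 0.
    rewrite -horner_sum (_ : \poly_(i < n.+2) _ = io s *: char_poly A).
      by rewrite linearZ /= Cayley_Hamilton scaler0 mulmx0.
    apply/polyP => i; rewrite coef_poly coefZ -Ps; case: ltnP => // ni.
    by rewrite Ps [in RHS]nth_default ?mulr0 // size_char_poly.
  have Pn : P`_n.+1 = s.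
    apply: (@io_inj _ _ v); rewrite Ps.
    have := char_poly_monic A => /monicP; rewrite lead_coefE size_char_poly => ->.
    by rewrite mulr1.
  have E : s *: (iter n.+1 X x : restrC N) = - \sum_(i < n.+1) P`_i *: (iter i X x : restrC N).
    apply/eqP; rewrite -addr_eq0 addrC -Pn; apply/eqP.
    by rewrite big_ord_recr in PX.
  have -> : iter m.+1 X x = iter (m - n) X (iter n.+1 X x).
    by rewrite -iterD addnS subnK.
  rewrite -linearZ E linearN; apply: memSN.
  rewrite -{2}(subnKC nm) -addSn; apply: traj_shift; apply/cyc_trajP.
  by exists (fun i => P`_i).
move=> /cyc_trajP[d dE].
(* the relation as a polynomial f with coefficients h that annihilates x *)
pose h i := if i == m.+1 then c else - d i.
pose f := \poly_(i < m.+2) io (h i).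
have fx : x *m horner_mx A f = 0.
  rewrite horner_sum big_ord_recr /= /h eqxx dE -big_split /= big1 // => i _.
  by rewrite ltn_eqF // scaleNr addNr.
have /dvdpP[g fE] := cyc_ann fx.
have [s0|s0] := eqVneq s 0.
  have [_ [i]] := sP; rewrite s0 rmorph0 scale0r coef0 => E.
  have v0 : v 0 = +oo%E by exact/val_eqy.
  by rewrite v0 in E.
have ios0 : io s != 0 by rewrite io_eq0.
have fE' : f = (io s *: char_poly A) * ((io s)^-1 *: g).
  by rewrite -scalerAl -scalerAr scalerA mulfV // scale1r mulrC.
have fint : integral v f.
  move=> i; rewrite coef_poly; case: ifP => _; first exact: valR_ge0.
  by rewrite (_ : v 0 = +oo%E) //; exact/val_eqy.
have gint : integral v ((io s)^-1 *: g).
  by apply: primitive_cofactor sP _; rewrite -fE'.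
have [G GE] := integral_lift gint.
have fm : f`_m.+1 = io c by rewrite coef_poly ltnSn /h eqxx.
have [c0|c0] := eqVneq c 0; first by exists 0; rewrite mul0r.
have szf : size f = m.+2.
  apply/eqP; rewrite eqn_leq size_poly /=; rewrite ltnNge; apply/negP => fs.
  by move: fm; rewrite nth_default // => /esym/eqP; rewrite io_eq0 (negPf c0).
exists (lead_coef G); apply: (@io_inj _ _ v); rewrite rmorphM.
have <- : lead_coef f = io c by rewrite lead_coefE szf fm.
rewrite -(lead_coef_map_inj (@io_inj _ _ v) (rmorph0 _)) GE fE' lead_coefM lead_coefZ.
by rewrite (monicP (char_poly_monic A)) mulr1 mulrC.
Qed.

Lemma cyc_rate m : (n <= m)%N -> rt X (lineS (x : restrC N)) m = v (io s).
Proof.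
move=> nm; rewrite -(len_lineS Lv_length) /rate; apply/eqP; rewrite eq_le; apply/andP; split.
  apply: (@len_surj _ _ _ HL _ _ (scalev (iter m.+1 X x : restrC N))) => [a _|a _|].
  - by apply: rpredZ; apply: traj_iter => //; apply/lineSP; exists 1; rewrite scale1r.
  - by move=> /lineSP[b ->]; apply/(cyc_lead _ nm); exists b.
  - move=> _ /trajS[y [_ [yT /lineSP[a ->] ->]]]; exists a => //.
    by rewrite linearZ addrK.
apply: (@len_inj _ _ _ HL _ _ (scalev (iter m.+1 X x : restrC N))) => [a _|a _|a _].
- by apply: rpredZ; apply: traj_iter => //; apply/lineSP; exists 1; rewrite scale1r.
- by move=> /lineSP[b ->]; apply/(cyc_lead _ nm); exists b.
- by move=> /(cyc_lead _ nm)[b ->]; apply/lineSP; exists b.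
Qed.

End Cyclic.
End Entropy.

Section Krylov.
Variables (F : fieldType) (n : nat) (A : 'M[F]_n.+1) (x : 'rV[F]_n.+1).

Definition krylov d : 'M[F]_(d, n.+1) := \matrix_(i < d) (x *m A ^+ i).

Lemma mul_krylov d (u : 'rV[F]_d) : u *m krylov d = x *m horner_mx A (rVpoly u).
Proof.
rewrite mulmx_sum_row /rVpoly poly_def rmorph_sum mulmx_sumr; apply: eq_bigr => i _.
rewrite rowK valK /= -mul_polyC rmorphM rmorphXn /= horner_mx_C horner_mx_X.
by rewrite -mulmxE mul_scalar_mx scalemxAr.
Qed.

Lemma krylov_free d : (forall f : {poly F}, (size f <= d)%N ->
  x *m horner_mx A f = 0 -> f = 0) -> row_free (krylov d).
Proof.
move=> fP; apply: inj_row_free => u; rewrite mul_krylov => /fP u0.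
by rewrite -[u]rVpolyK u0 ?linear0 // size_poly.
Qed.

End Krylov.

Section Entropy.
Variables (K : realType) (Q : fieldType) (v : valuation K Q).
Hypothesis v_nd : non_discrete v.
Local Notation R := (valring v).
Local Notation io := (valring_val v).
Variable Lv : lmodType R -> \bar K.
Hypothesis Lv_length : valuation_length Lv.
Let HL : length_function Lv := proj1 Lv_length.
Implicit Types N : lmodType {poly R}.
Local Notation muX := (@mulX R _).
Local Notation ent := (intrinsic_entropy Lv).
Local Notation rt := (rate Lv).
Local Notation lrt := (limrate Lv).

Lemma denominator (p : {poly Q}) : exists2 r : R, r != 0 & integral v (io r *: p).
Proof.
have [->|p0] := eqVneq p 0.
  exists 1; first exact: oner_neq0.
  by move=> i; rewrite scaler0 coef0 (_ : v 0 = +oo%E) //; exact/val_eqy.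
have [a a0 [ap _]] := primitive_scale v p0.
have [va|/ltW va] := leP 0%E (v a).
  by exists (Sub a va); rewrite -?io_eq0 ioSub.
exists 1; first exact: oner_neq0.
move=> i; rewrite rmorph1 scale1r; have := ap i; rewrite coefZ Defs.valM => vi.
by apply: le_trans vi _; rewrite -[leRHS]add0e leeD2r.
Qed.

(** The span F of x, ..., x A^n is a lattice, so any finitely generated
    R-submodule is carried into F by some r.  Multiplication by r does not
    change the limit rate, and limit rates are monotone on finitely generated
    submodules. *)
Lemma ent_cyclic n (A : 'M[Q]_n.+1) (x : 'rV[Q]_n.+1) a :
  (forall f : {poly Q}, (size f <= n.+1)%N -> x *m horner_mx A f = 0 -> f = 0) ->
  primitive v (a *: char_poly A) ->
  ent (restrQ v (mulmxr A : {linear 'rV_n.+1 -> 'rV_n.+1})) = v a.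
Proof.
move=> x_cyc pa.
have cm := char_poly_monic A.
have va : (0 <= v a)%E.
  have := (proj1 pa) (size (char_poly A)).-1; rewrite coefZ -lead_coefE.
  by rewrite (monicP cm) mulr1.
pose s : R := Sub a va; have sa : io s = a by exact: ioSub.
rewrite -sa in pa *; set N := restrQ v _; pose X := @mulX R N.
have s0 : s != 0.
  apply/eqP => s0; have [_ [i]] := pa; rewrite s0 rmorph0 scale0r coef0.
  by rewrite (_ : v 0 = +oo%E) //; exact/val_eqy.
have vs : (v (io s) < +oo)%E by rewrite ltey_eq val_fin // io_eq0.
pose Hx := lineS (x : restrC N).
have rx m : (n <= m)%N -> rt X Hx m = v (io s) by exact: (cyc_rate Lv_length x_cyc pa).
have lx : lrt X Hx = v (io s).
  apply/eqP; rewrite eq_le -{1}(rx n (leqnn n)) limrate_le /=.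
  apply: le_ereal_inf_tmp => _ [m _ <-]; rewrite -(rx (m + n)%N (leq_addl _ _)).
  by apply: rate_noninc => //; exact: leq_addr.
apply/eqP; rewrite eq_le; apply/andP; split; last first.
  by rewrite -lx; apply: (ent_ge Lv_length (n := n)); rewrite rx.
apply: (ent_fg_le Lv_length) => t.
pose F := traj X Hx n.+1.
have den (y : restrC N) : exists2 r : R, r != 0 & r *: y \in F.
  have kf : row_full (krylov A x n.+1).
    by rewrite /row_full; have := krylov_free x_cyc; rewrite /row_free.
  have /submxP[u yu] := submx_full (y : 'rV_n.+1) kf.
  have [r r0 rP] := denominator (rVpoly u).
  exists r => //; have [P PE] := integral_lift rP.
  apply/(cyc_trajP (A := A) x); exists (fun i => P`_i).
  rewrite -(horner_sum A x) (_ : \poly_(i < n.+1) _ = io r *: rVpoly u).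
    rewrite linearZ /= -scalemxAr -mul_krylov -yu; exact: restrQ_restrC.
  apply/polyP => i; rewrite coef_poly -coef_map PE; case: ltnP => // ni.
  by rewrite coefZ [in RHS]nth_default ?mulr0 // (leq_trans (size_poly _ _)).
have [r r0 rt0] : exists2 r : R, r != 0 & forall y, y \in t -> r *: y \in F.
  elim: t => [|y t [r r0 rP]]; first by exists 1; rewrite ?oner_neq0.
  have [q q0 qP] := den y; exists (r * q); first exact: valR_mul_neq0.
  move=> z; rewrite inE => /orP[/eqP ->|zt]; first by rewrite -scalerA rpredZ.
  by rewrite mulrC -scalerA; apply: rpredZ; exact: rP.
have Nt (y : N) : xtors y.
  have [P PE] := integral_lift (proj1 pa); exists P.
    apply/eqP => P0; move/eqP: PE; rewrite P0 rmorph0 eq_sym scaler_eq0 io_eq0 (negPf s0).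
    by rewrite (negPf (monic_neq0 cm)).
  rewrite (poly_scaleE (y : restrC N) (leqnn _)) -(horner_sum A y (fun i => P`_i)).
  rewrite (_ : \poly_(i < size P) _ = io s *: char_poly A).
    by rewrite linearZ /= Cayley_Hamilton scaler0 mulmx0.
  apply/polyP => i; rewrite coef_poly -PE coef_map; case: ltnP => // ni.
  by rewrite nth_default // rmorph0.
have [m tm] := span_rate_fin Lv_length (s := t) (fun y _ => Nt y).
pose g : {linear restrC N -> restrC N} := scaleS r.
have g_inj : injective g.
  apply: (@lin_inj _ _ _ g) => y gy.
  have /eqP : io r *: (y : 'rV[Q]_n.+1) = 0 by rewrite -[RHS]gy; exact/esym/restrQ_restrC.
  by rewrite scaler_eq0 io_eq0 (negPf r0) => /eqP.
have gC y : g (X y) = X (g y) by exact: scaleSC.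
rewrite -(limrate_inj HL gC _ g_inj) -lx -(limrate_traj HL X Hx n).
have [w wP] := traj_spanS X [:: (x : restrC N)] n.+1.
apply: (limrate_mono_fg Lv_length (t := w) (n1 := m) (n2 := 0)).
- by apply: imgS_spanS => y /rt0.
- move=> y yF; apply: wP; apply: traj_mono yF => // z; exact: addSl.
- by rewrite (rate_inj HL gC).
- by rewrite (rate_traj HL) rx.
Qed.

End Entropy.
Section Entropy.
Variables (K : realType) (Q : fieldType) (v : valuation K Q).
Hypothesis v_nd : non_discrete v.
Local Notation R := (valring v).
Local Notation io := (valring_val v).
Variable Lv : lmodType R -> \bar K.
Hypothesis Lv_length : valuation_length Lv.
Let HL : length_function Lv := proj1 Lv_length.
Implicit Types N : lmodType {poly R}.
Local Notation muX := (@mulX R _).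
Local Notation ent := (intrinsic_entropy Lv).
Local Notation rt := (rate Lv).
Local Notation lrt := (limrate Lv).

Lemma ent_block m n (A : 'M[Q]_m) (C : 'M[Q]_(n, m)) (B : 'M[Q]_n) :
  ent (restrQ v (mulmxr (block_mx A 0 C B) : {linear 'rV_(m + n) -> 'rV_(m + n)})) =
  (ent (restrQ v (mulmxr A : {linear 'rV_m -> 'rV_m})) +
   ent (restrQ v (mulmxr B : {linear 'rV_n -> 'rV_n})))%E.
Proof.
pose f0 (u : 'rV[Q]_m) : 'rV[Q]_(m + n) := row_mx u 0.
have f0_lin : linear f0.
  by move=> a x y; rewrite /f0 scale_row_mx add_row_mx scaler0 addr0.
pose f : {linear 'rV[Q]_m -> 'rV[Q]_(m + n)} := HB.pack f0 (GRing.isLinear.Build _ _ _ _ f0 f0_lin).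
pose g : {linear 'rV[Q]_(m + n) -> 'rV[Q]_n} := rsubmx.
have fC x : f (mulmxr A x) = mulmxr (block_mx A 0 C B) (f x).
  by rewrite /= /f0 mul_row_block !mul0mx mulmx0 !addr0.
have gC x : g (mulmxr (block_mx A 0 C B) x) = mulmxr B (g x).
  by rewrite /= -[x]hsubmxK mul_row_block !row_mxKr mulmx0 add0r.
apply: (ent_additive v_nd Lv_length (f := restrQ_map v fC) (g := restrQ_map v gC)).
- by move=> x y /= /eq_row_mx[].
- by apply/seteqP; split=> // y _; exists (row_mx 0 y) => //; exact: row_mxKr.
- apply/seteqP; split=> y /=; first by move=> [x _ <-]; exact: row_mxKr.
  by move=> gy; exists (lsubmx (y : 'rV_(m + n))) => //; rewrite -[RHS]hsubmxK; congr row_mx; exact/esym.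
Qed.

Lemma primitive_split p q a : primitive v (a *: (p * q)) -> p != 0 -> q != 0 ->
  exists b c, [/\ primitive v (b *: p), primitive v (c *: q) & v a = (v b + v c)%E].
Proof.
move=> pqa p0 q0; have [b b0 pb] := primitive_scale v p0.
have [c c0 qc] := primitive_scale v q0.
exists b, c; split=> //; rewrite -Defs.valM; apply: (primitive_unique pqa).
by rewrite -scalerA scalerAr scalerAl; exact: primitiveM.
Qed.

(** Let d be the degree of the minimal polynomial of A at a non-zero vector x.
    If d is the dimension then x is cyclic.  Otherwise the Krylov rows of x
    span a proper invariant subspace; in a basis that extends them, A is
    block triangular with smaller blocks. *)
Lemma ent_mx n (A : 'M[Q]_n) a : primitive v (a *: char_poly A) ->
  ent (restrQ v (mulmxr A : {linear 'rV_n -> 'rV_n})) = v a.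
Proof.
elim/ltn_ind: n A a => -[_ A a|n IH A a pa].
  move=> [p0 [i]]; have -> : char_poly A = 1 by rewrite /char_poly det_mx00.
  move=> E; rewrite (ent_zero Lv_length); last by move=> x; exact: thinmx0.
  move: E (p0 0); rewrite !coefZ !coef1; case: i => [|i] /=.
    by rewrite mulr1 => ->.
  have v0 : v 0 = +oo%E by exact/val_eqy.
  by rewrite mulr0 v0.
pose x : 'rV[Q]_n.+1 := delta_mx 0 0.
have x0 : x != 0 by apply/eqP => /matrixP /(_ 0 0) /eqP; rewrite !mxE eqxx oner_eq0.
pose ann d := `[< exists f : {poly Q}, [/\ f != 0, (size f <= d.+1)%N & x *m horner_mx A f = 0] >].
have ex_ann : exists d, ann d.
  exists n.+1; apply/asboolP; exists (char_poly A).
  by rewrite monic_neq0 ?char_poly_monic // size_char_poly Cayley_Hamilton mulmx0.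
case: (ex_minnP ex_ann) => d /asboolP[f [f0 fd xf]] dmin.
have dfree (g : {poly Q}) : (size g <= d)%N -> x *m horner_mx A g = 0 -> g = 0.
  move=> gd xg; apply/eqP/negPn/negP => g0.
  case: d {fd} dmin gd => [|d] dmin gd; first by move: g0; rewrite -size_poly_leq0 gd.
  suff /dmin : ann d by rewrite ltnn.
  by apply/asboolP; exists g.
have dn : (d <= n.+1)%N.
  apply: dmin; apply/asboolP; exists (char_poly A).
  by rewrite monic_neq0 ?char_poly_monic // size_char_poly Cayley_Hamilton mulmx0.
have [dE|dn'] := eqVneq d n.+1.
  by rewrite dE in dfree; exact: (ent_cyclic Lv_length dfree pa).
have {}dn : (d <= n)%N by rewrite -ltnS ltn_neqAle dn' dn.
have d0 : (0 < d)%N.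
  case: d fd {dmin dfree dn dn'} => // f1.
  have fc : f = (f`_0)%:P by apply: size1_polyC.
  move: xf; rewrite fc horner_mx_C mul_mx_scalar => /eqP.
  by rewrite scaler_eq0 (negPf x0) orbF -polyC_eq0 -fc (negPf f0).
pose B := krylov A x d.
have Bfree : row_free B := krylov_free dfree.
have /submxP[N0 NE] : (B *m A <= B)%MS.
  apply/row_subP => i; rewrite row_mul rowK -mulmxA mulmxE -exprSr.
  have [id1|] := ltnP i.+1 d.
    have := row_sub (Ordinal id1) B; by rewrite rowK.
  move=> di; have {di}di : i.+1 = d by apply/eqP; rewrite eqn_leq di ltn_ord.
  have szf : size f = d.+1.
    apply/eqP; rewrite eqn_leq fd ltnNge; apply/negP => fd'.
    by move: f0; rewrite (dfree f fd' xf) eqxx.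
  have fdn : f`_d != 0 by have := f0; rewrite -lead_coef_eq0 lead_coefE szf.
  (* x f(A) = 0 expresses x A^d through the lower iterates *)
  pose h := f - f`_d *: 'X^d.
  have hd : (size h <= d)%N.
    apply/leq_sizeP => j dj; rewrite coefB coefZ coefXn.
    have [->|jd] := eqVneq j d; first by rewrite mulr1 subrr.
    by rewrite mulr0 subr0 nth_default // szf ltn_neqAle eq_sym jd.
  have xh : x *m A ^+ i.+1 = - (f`_d)^-1 *: (x *m horner_mx A h).
    rewrite di rmorphB /= mulmxBr xf sub0r linearZ /= rmorphXn /= horner_mx_X.
    by rewrite -scalemxAr scaleNr scalerN opprK scalerA mulVf // scale1r.
  rewrite xh scalemx_sub //; apply/submxP; exists (poly_rV h).
  by rewrite mul_krylov poly_rV_K.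
pose C := row_base (B^C)%MS; pose U := col_mx B C.
have dl : (d + \rank (B^C)%MS = n.+1)%N.
  by rewrite mxrank_compl; move/eqP: Bfree => ->; rewrite subnKC // leqW.
have Ufull : row_full U.
  rewrite -sub1mx; apply: submx_trans (_ : (1%:M <= B + B^C)%MS) _.
    by rewrite sub1mx addsmx_compl_full.
  by rewrite /U -addsmxE addsmxS // eq_row_base.
have Ufree : row_free U.
  rewrite -row_leq_rank; have -> : \rank U = n.+1 by exact/eqP.
  by rewrite dl.
have /row_freeP[W UW] := Ufree; have /row_fullP[W' W'U] := Ufull.
have {W'U} WU : W *m U = 1%:M.
  by rewrite -W'U; congr (_ *m U); rewrite -[W']mulmx1 -UW mulmxA W'U mul1mx.
have /submxP[E EE] := submx_full (C *m A) Ufull.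
pose D := block_mx N0 0 (lsubmx E) (rsubmx E).
have UA : U *m A = D *m U.
  have E1 : E *m U = lsubmx E *m B + rsubmx E *m C by rewrite -{1}[E]hsubmxK mul_row_col.
  by rewrite /D [in RHS]/U mul_block_col mul0mx addr0 -E1 -EE -NE -mul_col_mx.
have cA : char_poly A = char_poly N0 * char_poly (rsubmx E).
  by rewrite (char_poly_sim UW WU UA) char_poly_block.
rewrite -(ent_restrQ_sim Lv_length (phi := mulmxr D) (f := mulmxr U)); last 2 first.
- by move=> y /=; rewrite -!mulmxA UA.
- by exists (mulmxr W) => y /=; rewrite -mulmxA ?UW ?WU mulmx1.
rewrite ent_block.
rewrite cA in pa; have [b [c [pb pc ->]]] := primitive_split pa
  (monic_neq0 (char_poly_monic _)) (monic_neq0 (char_poly_monic _)).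
congr (_ + _)%E; apply: IH => //.
by rewrite ltnS -(leq_add2l d) dl -addn1 addnC leq_add2r.
Qed.

Lemma ent_restrQ (V : vectType Q) (phi : {linear V -> V}) (P : {poly R}) :
  charpoly_over phi P -> ent (restrQ v phi) = v (io (lead_coef P)).
Proof.
move=> phiP; have [a _ pa] := primitive_scale v (monic_neq0 (charpoly_monic phi)).
rewrite (charpoly_over_lead phiP pa) -(ent_mx pa).
have e_basis := vbasisP {:V}.
pose r0 : V -> 'rV[Q]_(\dim {:V}) := passmx.rVof (vbasis {:V}).
have r0_lin : linear r0 by exact: passmx.rVof_linear.
pose r : {linear V -> 'rV[Q]_(\dim {:V})} := HB.pack r0 (GRing.isLinear.Build _ _ _ _ r0 r0_lin).
apply: (ent_restrQ_sim Lv_length (f := r)).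
  by move=> y; rewrite /= /r0 -passmx.rVof_app ?lfunE.
exact: Bijective (passmx.rVofK e_basis) (passmx.vecofK e_basis).
Qed.

End Entropy.

(** * Uniqueness *)

Section Entropy.
Variables (K : realType) (Q : fieldType) (v : valuation K Q).
Hypothesis v_nd : non_discrete v.
Local Notation R := (valring v).
Local Notation io := (valring_val v).
Variable Lv : lmodType R -> \bar K.
Hypothesis Lv_length : valuation_length Lv.
Let HL : length_function Lv := proj1 Lv_length.
Implicit Types N : lmodType {poly R}.
Local Notation muX := (@mulX R _).
Local Notation ent := (intrinsic_entropy Lv).
Local Notation rt := (rate Lv).
Local Notation lrt := (limrate Lv).

Section Uniqueness.
Variable L : lmodType {poly R} -> \bar K.
Hypothesis LL : length_function L.
Hypothesis L_tensor : forall M : lmodType R, (Lv M < +oo)%E ->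
  L (tensor M {poly R}) = Lv M.
Hypothesis L_restrQ : forall (V : vectType Q) (phi : {linear V -> V}) (P : {poly R}),
  charpoly_over phi P -> L (restrQ v phi) = v (io (lead_coef P)).

(** Multiplication by r embeds R[X] into itself with cokernel
    (R/rR) (x) R[X], so L(R[X]) >= L(R[X]) + v(r) with v(r) > 0. *)
Lemma L_free N (x : N) : ~ xtors x -> L N = +oo%E.
Proof.
move=> xfree; apply/eqP; rewrite -leye_eq.
have f_inj : injective (scalev x : {poly R}^o -> N).
  apply: (@lin_inj _ _ _ (scalev x)) => p px; apply/eqP/negPn/negP => p0.
  by apply: xfree; exists p.
apply: le_trans (L_inj LL f_inj); rewrite leye_eq; apply/eqP.
have [r r0 ry] := exists_small_val v_nd.
have rn0 : r != 0 by rewrite -io_eq0; apply/eqP => /(val_eqy v) E; rewrite E in ry.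
pose P : lmodType {poly R} := {poly R}^o.
pose M : lmodType R := quotmod (lineS (r : R^o)).
have MvE : Lv M = v (io r) by rewrite -(len_quot HL) (len_lineS Lv_length).
pose one : restrC (tensor M {poly R}) := temb (qpi (lineS (r : R^o)) 1).
pose q : {linear P -> tensor M {poly R}} := scalev (one : tensor M {poly R}).
pose f : {linear P -> P} := scaleS r%:P.
pose I := imgS f (fullS P).
have fi : injective f.
  apply: (@lin_inj _ _ _ f) => p; rewrite /f /= /scaleS => pr.
  have {pr} : (r%:P * p : {poly R}) = 0 by [].
  move=> pr; apply/polyP => i; have := congr1 (fun g : {poly R} => g`_i) pr.
  by rewrite coefCM !coef0 => /valR_mul_eq0; apply.
have LP : L P = (len L I (zeroS P) + len L (fullS P) I)%E.
  by rewrite -(len_full LL); apply: (len_add LL) => // z /zeroSP ->; rewrite rpred0.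
have LI : (L P <= len L I (zeroS P))%E.
  rewrite -(len_full LL); apply: (@len_inj _ _ _ LL _ _ f) => [p _|p _ /zeroSP ->|p _ /zeroSP fp].
  - exact: imgS_f.
  - by rewrite raddf0 rpred0.
  - by apply/zeroSP/fi; rewrite raddf0.
have LM : (v (io r) <= len L (fullS P) I)%E.
  have <- : L (tensor M {poly R}) = v (io r) by rewrite L_tensor MvE.
  rewrite -(len_full LL); apply: (@len_surj _ _ _ LL _ _ q) => [//|_ _ /imgSP[p _ ->]|y _].
    apply/zeroSP; rewrite /q /= /scalev /f /= /scaleS.
    have -> : (r%:P *: p : P) = (p : {poly R}) * r%:P by exact: mulrC.
    rewrite -scalerA (_ : r%:P *: (one : tensor M _) = 0) ?scaler0 //.
    rewrite -[LHS]restrC_scale /one -linearZ (_ : r *: _ = 0) ?linear0 //.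
    by rewrite -linearZ; apply/qpi_eq0/lineSP; exists 1; rewrite scale1r; exact: mulr1.
  suff : y \in imgS q (fullS P).
    by move=> /imgSP[p _ ->]; exists p => //; rewrite subrr rpred0.
  have [s ->] := tpiP y; rewrite tpi_sum; apply: rpred_sum => -[m p] _ /=.
  rewrite tmk_temb; apply: rpredZ; have [c ->] := qpi_surj m.
  apply/imgSP; exists ((c : R)%:P : {poly R}) => //; rewrite /q /= /scalev.
  rewrite -[RHS]restrC_scale /one -linearZ -linearZ; congr (temb (qpi _ _)).
  exact/esym/mulr1.
have := L_ge0 LL P; move: LP LI LM (len_ge0 LL I (zeroS P)) (len_ge0 LL (fullS P) I) r0 ry.
move: (L P) (len L I _) (len L (fullS P) I) (v (io r)).
case=> [a| |] [b| |] [c| |] [d| |] //; rewrite -?EFinD ?lee_fin ?lte_fin => //.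
move=> [->]; rewrite gerDl => c0 dc _ _ d0.
by move: (lt_le_trans d0 (le_trans dc c0)); rewrite ltxx.
Qed.

Definition Rtors N := forall x : N, exists2 r : R, r != 0 & r%:P *: x = 0.

Lemma Rtors_inj N N' (f : {linear N -> N'}) : injective f -> Rtors N' -> Rtors N.
Proof.
move=> fi Nt x; have [r r0 rx] := Nt (f x); exists r => //.
by apply: fi; rewrite linearZ /= rx raddf0.
Qed.

Lemma Rtors_span_fin N (s : seq (restrC N)) (A : submodClosed (restrC N)) :
  Rtors N -> {subset A <= spanS s} -> (Lv (submod A) < +oo)%E.
Proof.
move=> Nt As; rewrite -(len_submod HL).
apply: (@le_lt_trans _ _ (len Lv (addS (spanS s) (zeroS _)) (zeroS (restrC N)))).
  apply: (len_le HL) => //; first by move=> x /As; exact: addSl.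
  by move=> x /zeroSP ->; rewrite rpred0.
apply: (len_span_fin Lv_length) => x _; have [r r0 rx] := Nt x.
by exists r => //; apply/zeroSP.
Qed.

(** By [traj_presentation] the image I of T_(n+1) (x) R[X] in T_(n+2) (x) R[X] is
    killed by the evaluation onto N, so L(N) is at most the difference of
    the finite lengths of T_(n+2) and T_(n+1). *)
Lemma L_le_rate N (s : seq N) n : Rtors N -> (forall x, x \in spanS s) ->
  (L N <= rt muX (spanS (s : seq (restrC N))) n)%E.
Proof.
move=> Nt Ns; set F := spanS (s : seq (restrC N)).
pose A := traj muX F n.+1; pose B := traj muX F n.+2.
have AB : {subset A <= B} by exact: traj_mono.
have fin m : (Lv (submod (traj muX F m)) < +oo)%E.
  by have [w wP] := traj_spanS muX s m; apply: Rtors_span_fin wP.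
have [a a_inj ba] := traj_presentation F n.
pose TB := tensor (submod B) {poly R}; pose TA := tensor (submod A) {poly R}.
pose I := imgS a (fullS TA).
have LTB : L TB = (len L I (zeroS TB) + len L (fullS TB) I)%E.
  by rewrite -(len_full LL); apply: (len_add LL) => // z /zeroSP ->; rewrite rpred0.
have LTA : (L TA <= len L I (zeroS TB))%E.
  rewrite -(len_full LL); apply: (@len_inj _ _ _ LL _ _ a) => [q _|q _ /zeroSP ->|q _ /zeroSP fq].
  - exact: imgS_f.
  - by rewrite raddf0 rpred0.
  - by apply/zeroSP/a_inj; rewrite raddf0.
have LN : (L N <= len L (fullS TB) I)%E.
  rewrite -(len_full LL); apply: (@len_surj _ _ _ LL _ _ (evT B)) => [//|_ _ /imgSP[t _ ->]|y _].
    by rewrite ba rpred0.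
  have sB x : x \in s -> (x : restrC N) \in B.
    by move=> xs; apply: (@traj_iter _ _ _ _ _ 0) => //; exact: mem_spanS.
  have [t ->] := evT_surj sB (Ns y).
  by exists t => //; rewrite subrr rpred0.
have rE : (L TB = L TA + rt muX F n)%E.
  rewrite !L_tensor ?fin // -!(len_submod HL) /rate.
  by rewrite (len_add HL (B := A)) // => z /zeroSP ->; rewrite rpred0.
have TAfin : L TA \is a fin_num by rewrite L_tensor ?ge0_fin_numE ?fin // (L_ge0 HL).
rewrite -(leeD2lE _ _ TAfin) -rE LTB; exact: leeD.
Qed.

End Uniqueness.
End Entropy.

Section Entropy.
Variables (K : realType) (Q : fieldType) (v : valuation K Q).
Hypothesis v_nd : non_discrete v.
Local Notation R := (valring v).
Local Notation io := (valring_val v).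
Variable Lv : lmodType R -> \bar K.
Hypothesis Lv_length : valuation_length Lv.
Let HL : length_function Lv := proj1 Lv_length.
Implicit Types N : lmodType {poly R}.
Local Notation muX := (@mulX R _).
Local Notation ent := (intrinsic_entropy Lv).
Local Notation rt := (rate Lv).
Local Notation lrt := (limrate Lv).

Let EL : length_function ent := ent_length_function v_nd Lv_length.

Section Comparison.
Variable L : lmodType {poly R} -> \bar K.
Hypothesis LL : length_function L.
Hypothesis L_tensor : forall M : lmodType R, (Lv M < +oo)%E ->
  L (tensor M {poly R}) = Lv M.

Lemma eq_of_fg N :
  (forall F : submodClosed N, fingenS F -> L (submod F) = ent (submod F)) -> L N = ent N.
Proof.
move=> FE; rewrite (length_upper_continuous LL) (length_upper_continuous EL).
by congr ereal_sup; apply: eq_imagel => F Ff; exact: FE.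
Qed.

Lemma Rtors_xtors N : Rtors N -> forall x : N, xtors x.
Proof.
move=> Nt x; have [r r0 rx] := Nt x; exists r%:P => //.
by rewrite polyC_eq0.
Qed.

(** For R-torsion modules every rate of a finite set of generators bounds L
    by [L_le_rate], hence so does their infimum. *)
Lemma le_ent_tors N : Rtors N -> (L N <= ent N)%E.
Proof.
move=> Nt; rewrite (length_upper_continuous LL).
apply: ge_ereal_sup => _ [F /fingenP[s Fs] <-]; have [t tP] := spanS_lift Fs.
have vi : injective (val : {linear submod F -> N}) by exact: val_inj.
have Ft := Rtors_inj vi Nt.
apply: le_trans (ent_inj Lv_length vi).
apply: le_trans (ent_ge_span Lv_length t (Rtors_xtors Ft)).
by apply: le_ereal_inf_tmp => _ [n _ <-]; exact: (L_le_rate Lv_length LL).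
Qed.

Lemma Rtors_tensor (M : lmodType R) :
  (forall m : M, exists2 r : R, r != 0 & r *: m = 0) -> Rtors (tensor M {poly R}).
Proof.
move=> Mt x; have [s ->] := tpiP x; rewrite tpi_sum.
elim: s => [|[m p] s [r r0 IH]].
  by exists 1; rewrite ?oner_neq0 // big_nil scaler0.
have [q q0 qm] := Mt m; exists (r * q); first exact: valR_mul_neq0.
have qt : q%:P *: tmk m p = 0.
  have qe : q%:P *: (temb m : tensor M {poly R}) = 0.
    transitivity (temb (q *: m)); first exact/esym/linearZ.
    by rewrite qm; exact: linear0.
  by rewrite tmk_temb scalerA mulrC -scalerA qe scaler0.
rewrite big_cons scalerDr polyCM -scalerA qt scaler0 add0r mulrC -scalerA IH.
by rewrite scaler0.
Qed.

(** N is a quotient of M (x) R[X], where M is the R-span of s.  Both functions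
    have the finite value L_v(M) there, and L is at most the entropy on N
    and on the kernel. *)
Lemma eq_tors_fg N (s : seq N) : Rtors N -> (forall x, x \in spanS s) -> L N = ent N.
Proof.
move=> Nt Ns; pose F := spanS (s : seq (restrC N)); pose M := submod F.
have Mfin : (Lv M < +oo)%E by exact: (Rtors_span_fin Lv_length (s := s)).
pose b := evT F.
have b_surj y : exists x, y = b x.
  by apply: evT_surj (Ns y) => x xs; exact: mem_spanS.
have LT := L_ker LL b_surj; have ET := L_ker EL b_surj.
rewrite L_tensor // in LT; rewrite (ent_tensor Lv_length) // in ET.
have Tt : Rtors (tensor M {poly R}).
  apply: Rtors_tensor => m; have [r r0 rm] := Nt (val m).
  exists r; [exact: r0|exact: submod_scale_eq0].
have Kt : Rtors (submod (preS b (zeroS N))).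
  by apply: Rtors_inj Tt; exact: val_inj.
apply: (add_eq_le (le_ent_tors Kt) (le_ent_tors Nt) (L_ge0 LL _) (L_ge0 LL _)).
  by rewrite -LT.
by rewrite -LT -ET.
Qed.

Lemma eq_tors N : Rtors N -> L N = ent N.
Proof.
move=> Nt; apply: eq_of_fg => F /fingenP[s Fs]; have [t tP] := spanS_lift Fs.
by apply: eq_tors_fg tP; apply: Rtors_inj Nt; exact: val_inj.
Qed.

Lemma len_eq_tors N (A B : submodClosed N) :
  (forall x, x \in A -> exists2 r : R, r != 0 & r%:P *: x \in B) ->
  len L A B = len ent A B.
Proof.
move=> AB; apply: eq_tors => u; have [x ->] := clsP u.
have [r r0 rx] := AB _ (valP x); exists r => //.
by rewrite -linearZ; apply/cls_eq0; rewrite linearZ.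
Qed.

End Comparison.
End Entropy.

(** The quotient Q[X] / (p0) as a coordinate space: a class is represented by
    its remainder, so that the multiplication by X is a linear transformation
    of a finite dimensional vector space. *)
Section Reduction.
Variables (F : fieldType) (p0 : {poly F}) (d : nat).
Hypothesis p0_size : size p0 = d.+1.

Lemma red_size (p : {poly F}) : (size (p %% p0)%R <= d)%N.
Proof. by rewrite -ltnS -p0_size ltn_modp -size_poly_eq0 p0_size. Qed.

Definition red (p : {poly F}) : 'rV[F]_d := poly_rV (p %% p0).

Lemma red_linear : linear red.
Proof. by move=> a p q; rewrite /red modpD modpZl linearP. Qed.

HB.instance Definition _ := GRing.isLinear.Build F {poly F} 'rV[F]_d _ red red_linear.

Lemma rVpoly_red (p : {poly F}) : rVpoly (red p) = p %% p0.
Proof. by rewrite poly_rV_K // red_size. Qed.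

Lemma red_rVpoly u : red (rVpoly u) = u.
Proof. by rewrite /red modp_small ?rVpolyK // p0_size ltnS size_poly. Qed.

Lemma red_eq0 (p : {poly F}) : red p = 0 -> p0 %| p.
Proof. by rewrite /dvdp -rVpoly_red => ->; rewrite linear0. Qed.

Definition redX (u : 'rV[F]_d) : 'rV[F]_d := red (rVpoly u * 'X).

Lemma redX_linear : linear redX.
Proof. by move=> a u w; rewrite /redX linearP mulrDl -scalerAl linearP. Qed.

HB.instance Definition _ := GRing.isLinear.Build F 'rV[F]_d 'rV[F]_d _ redX redX_linear.

Lemma redX_red (p : {poly F}) : redX (red p) = red (p * 'X).
Proof. by rewrite /redX rVpoly_red /red mulrC modp_mul mulrC. Qed.

Lemma iter_redX i (p : {poly F}) : iter i redX (red p) = red (p * 'X^i).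
Proof.
elim: i => [|i IH]; first by rewrite expr0 mulr1.
by rewrite /= IH redX_red -mulrA exprSr.
Qed.

End Reduction.

Section Entropy.
Variables (K : realType) (Q : fieldType) (v : valuation K Q).
Hypothesis v_nd : non_discrete v.
Local Notation R := (valring v).
Local Notation io := (valring_val v).
Variable Lv : lmodType R -> \bar K.
Hypothesis Lv_length : valuation_length Lv.
Let HL : length_function Lv := proj1 Lv_length.
Implicit Types N : lmodType {poly R}.
Local Notation muX := (@mulX R _).
Local Notation ent := (intrinsic_entropy Lv).
Local Notation rt := (rate Lv).
Local Notation lrt := (limrate Lv).

Let EL : length_function ent := ent_length_function v_nd Lv_length.

Section Comparison.
Variable L : lmodType {poly R} -> \bar K.
Hypothesis LL : length_function L.
Hypothesis L_tensor : forall M : lmodType R, (Lv M < +oo)%E ->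
  L (tensor M {poly R}) = Lv M.
Hypothesis L_restrQ : forall (V : vectType Q) (phi : {linear V -> V}) (P : {poly R}),
  charpoly_over phi P -> L (restrQ v phi) = v (io (lead_coef P)).

Lemma eq_restrQ (V : vectType Q) (phi : {linear V -> V}) :
  L (restrQ v phi) = ent (restrQ v phi) /\ (ent (restrQ v phi) < +oo)%E.
Proof.
have [P phiP] := charpoly_over_exists v phi.
rewrite (L_restrQ phiP) (ent_restrQ v_nd Lv_length phiP); split=> //.
have [a a0 pa] := primitive_scale v (monic_neq0 (charpoly_monic phi)).
by rewrite (charpoly_over_lead phiP pa) ltey_eq val_fin.
Qed.

Lemma denominator2 (p q : {poly Q}) :
  exists2 r : R, r != 0 & integral v (io r *: p) /\ integral v (io r *: q).
Proof.
have [r r0 rp] := denominator v p; have [t t0 tq] := denominator v q.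
exists (r * t); first exact: valR_mul_neq0.
rewrite rmorphM; split=> i; last by rewrite -scalerA coefZ Defs.valM adde_ge0 // valR_ge0.
by rewrite mulrC -scalerA coefZ Defs.valM adde_ge0 // valR_ge0.
Qed.

(** Let J be the R-saturation of the annihilator of x and p0 a non-zero
    element of J of least degree.  By division with remainder in Q[X], J is the
    kernel of R[X] -> Q[X] / (p0).  The quotient of J by the annihilator and the
    cokernel of R[X] -> Q[X] / (p0) are R-torsion. *)
Lemma eq_cyclic N (x : N) : (forall y, exists p : {poly R}, y = p *: x) -> L N = ent N.
Proof.
move=> xgen; have [xt|xfree] := pselect (xtors x); last first.
  by rewrite (L_free v_nd Lv_length LL L_tensor xfree) (ent_free v_nd Lv_length xfree).
pose J (p : {poly R}) := exists2 r : R, r != 0 & (r%:P * p) *: x = 0.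
pose hasJ d := `[< exists p : {poly R}, [/\ p != 0, J p & size p = d.+1] >].
have ex_d : exists d, hasJ d.
  have [p p0 px] := xt; exists (size p).-1; apply/asboolP; exists p; split=> //.
    by exists 1; rewrite ?oner_neq0 // mul1r.
  by rewrite prednK // lt0n size_poly_eq0.
case: (ex_minnP ex_d) => d /asboolP[p0 [p0n [t0 t0n t0x] p0d]] dmin.
have Jmin (p : {poly R}) : J p -> (size p <= d)%N -> p = 0.
  move=> Jp pd; apply/eqP/negPn/negP => pn.
  have ps : size p = (size p).-1.+1 by rewrite prednK // lt0n size_poly_eq0.
  have : (d <= (size p).-1)%N by apply: dmin; apply/asboolP; exists p.
  by rewrite leqNgt -ltnS -ps ltnS pd.
pose P0 := map_poly io p0.
have P0d : size P0 = d.+1 by rewrite (size_map_inj_poly (@io_inj _ _ v) (rmorph0 _)).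
(* d = 0 may occur: then N is R-torsion and V is the zero space *)
pose V := restrQ v (redX P0 (d := d)).
have map_inj (p q : {poly R}) : map_poly io p = map_poly io q -> p = q.
  by move=> /polyP E; apply/polyP => i; apply: (@io_inj _ _ v); have := E i; rewrite !coef_map.
have mapM (p q : {poly R}) : map_poly io (p * q) = map_poly io p * map_poly io q.
  exact: rmorphM.
have mapD (p q : {poly R}) : map_poly io (p + q) = map_poly io p + map_poly io q.
  exact: rmorphD.
have mapC r : map_poly io r%:P = (io r)%:P by exact: map_polyC.
pose h0 (p : {poly R}^o) : V := red P0 d (map_poly io (p : {poly R})).
have h0_lin : linear h0.
  move=> p q w; have -> : h0 (p *: q + w) =
      red P0 d (map_poly io (p : {poly R}) * map_poly io (q : {poly R})) + h0 w :> V.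
    by rewrite /h0 [p *: q]/(p * q : {poly R}) rmorphD rmorphM linearD.
  congr (_ + _); rewrite [RHS]restrQ_scaleE.
  rewrite -{1}[map_poly io p]coefK poly_def mulr_suml linear_sum.
  rewrite (size_map_inj_poly (@io_inj _ _ v) (rmorph0 _)).
  apply: eq_bigr => i _; rewrite iter_redX // -scalerAl linearZ coef_map.
  by rewrite mulrC.
pose h : {linear {poly R}^o -> V} := HB.pack h0 (GRing.isLinear.Build _ _ _ _ h0 h0_lin).
pose q : {linear {poly R}^o -> N} := scalev x.
pose Jt := preS h (zeroS V); pose I := preS q (zeroS N).
have hJ (p : {poly R}) : (p : {poly R}^o) \in Jt <-> J p.
  rewrite preSE; split.
    move=> /zeroSP rp; have /dvdpP[g gE] := red_eq0 P0d rp.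
    have [r r0 rg] := denominator v g; have [G GE] := integral_lift rg.
    have E : r%:P * p = G * p0.
      by apply: map_inj; rewrite !mapM mapC gE GE -/P0 mul_polyC scalerAl.
    exists (t0 * r); first exact: valR_mul_neq0.
    by rewrite polyCM -mulrA E mulrCA -scalerA t0x scaler0.
  move=> [t tn tx]; apply/zeroSP; rewrite /h /= /h0 /red.
  have [r r0 [rg rm]] := denominator2 (map_poly io p %/ P0) (map_poly io p %% P0).
  have [G GE] := integral_lift rg; have [W WE] := integral_lift rm.
  have E : r%:P * p = G * p0 + W.
    apply: map_inj; rewrite mapD !mapM mapC GE WE -/P0 mul_polyC.
    by rewrite {1}(divp_eq (map_poly io p) P0) scalerDr scalerAl.
  have W0 : W = 0.
    apply: Jmin; last first.
      rewrite -(size_map_inj_poly (@io_inj _ _ v) (rmorph0 _)) WE.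
      by apply: leq_trans (size_scale_leq _ _) _; exact: red_size.
    exists (t0 * t); first exact: valR_mul_neq0.
    have -> : (t0 * t)%:P * W = (r * t0)%:P * (t%:P * p) - (t%:P * G) * (t0%:P * p0).
      have -> : W = r%:P * p - G * p0 by rewrite E addrC addKr.
      rewrite !polyCM mulrBr (mulrACA t0%:P t%:P r%:P p) (mulrC r%:P).
      by rewrite [t0%:P * t%:P]mulrC (mulrACA t%:P t0%:P).
    by rewrite scalerBl -scalerA tx scaler0 -scalerA t0x scaler0 subrr.
  have rn : io r != 0 by rewrite io_eq0.
  have -> : map_poly io p %% P0 = 0.
    by have /eqP := WE; rewrite W0 rmorph0 eq_sym scaler_eq0 (negPf rn) => /eqP.
  exact: linear0.
have IJ : {subset I <= Jt}.
  by move=> p; rewrite preSE => /zeroSP px; apply/hJ; exists 1; rewrite ?oner_neq0 // mul1r.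
pose P : lmodType {poly R} := {poly R}^o.
have red_len (E : lmodType {poly R} -> \bar K) : length_function E ->
    E N = (len E Jt I + len E (imgS h (fullS P)) (zeroS V))%E /\
    E V = (len E (imgS h (fullS P)) (zeroS V) + len E (fullS V) (imgS h (fullS P)))%E.
  move=> EE; split; last first.
    by rewrite -(len_full EE); apply: (len_add EE) => // z /zeroSP ->; rewrite rpred0.
  have -> : E N = len E (fullS P) I.
    rewrite -(len_full EE); apply/eqP; rewrite eq_le; apply/andP; split.
      apply: (@len_surj _ _ _ EE _ _ q) => // y _; have [p ->] := xgen y.
      by exists p => //; rewrite subrr rpred0.
    exact: (@len_inj _ _ _ EE _ _ q).
  rewrite (len_add EE (A := fullS P) (B := Jt)) //; congr (_ + _)%E.
  apply/eqP; rewrite eq_le; apply/andP; split.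
    by apply: (@len_inj _ _ _ EE _ _ h) => // p _; exact: imgS_f.
  apply: (@len_surj _ _ _ EE _ _ h) => // [p _|_ /imgSP[p _ ->]]; first exact: imgS_f.
  by exists p => //; rewrite subrr rpred0.
have [LN LV] := red_len _ LL; have [EN EV] := red_len _ EL.
have [VE Vfin] := eq_restrQ (redX P0 (d := d)).
have JI : len L Jt I = len ent Jt I.
  apply: (len_eq_tors v_nd Lv_length LL L_tensor) => p /hJ[r r0 rp]; exists r => //.
  by rewrite preSE; apply/zeroSP.
have VI : len L (fullS V) (imgS h (fullS P)) = len ent (fullS V) (imgS h (fullS P)).
  apply: (len_eq_tors v_nd Lv_length LL L_tensor) => u _.
  have [r r0 ru] := denominator v (rVpoly (u : 'rV_d)); exists r => //.
  have [G GE] := integral_lift ru; apply/imgSP; exists (G : P) => //.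
  rewrite /h /= /h0 GE linearZ /= red_rVpoly //.
  exact: restrQ_restrC.
have IV : len L (imgS h (fullS P)) (zeroS V) = len ent (imgS h (fullS P)) (zeroS V).
  have := VE; rewrite /V LV EV VI; move: Vfin; rewrite EV.
  move: (len_ge0 LL (imgS h (fullS P)) (zeroS V)) (len_ge0 EL (imgS h (fullS P)) (zeroS V))
    (len_ge0 EL (fullS V) (imgS h (fullS P))).
  case: (len L _ _) (len ent _ _) (len ent _ _) => [a| |] [b| |] [c| |] //.
  by rewrite -!EFinD => _ _ _ _ [] /addIr ->.
by rewrite LN EN JI IV.
Qed.

Lemma eq_fg N (s : seq N) : (forall x, x \in spanS s) -> L N = ent N.
Proof.
have [n sn] : {n | size s = n} by exists (size s).
elim: n N s sn => [|n IH] N [|x s] //= sn Ns.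
  have N0 (y : N) : y = 0 by have /zeroSP := Ns y.
  by rewrite (length_zero LL N0) (length_zero EL N0).
have split_len (E : lmodType {poly R} -> \bar K) : length_function E ->
    E N = (E (submod (lineS x)) + E (quotmod (lineS x)))%E.
  move=> EE; rewrite -(len_full EE) -(len_submod EE) -(len_quot EE).
  by apply: (len_add EE) => // z /zeroSP ->; rewrite rpred0.
rewrite (split_len _ LL) (split_len _ EL); congr (_ + _)%E.
  have xl : x \in lineS x by apply/lineSP; exists 1; rewrite scale1r.
  apply: (@eq_cyclic _ (Sub x xl)) => y.
  have /lineSP[p yE] := valP y; exists p; apply: val_inj.
  by rewrite yE linearZ; congr (_ *: _); exact/esym/SubK.
apply: (IH _ [seq qpi (lineS x) y | y <- s]) => [|y].
  by rewrite size_map; case: sn.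
have [z ->] := qpi_surj y.
have /addSP[w [u [wx us ->]]] := Ns z.
rewrite linearD; apply: rpredD; first by rewrite (proj2 (qpi_eq0 _ _) wx) rpred0.
have : u \in preS (qpi (lineS x)) (spanS [seq qpi (lineS x) y | y <- s]).
  by apply: spanS_le us => t ts; rewrite preSE; exact/mem_spanS/map_f.
by rewrite preSE.
Qed.

Lemma eq_ent N : L N = ent N.
Proof.
apply: (eq_of_fg v_nd Lv_length LL) => F /fingenP[s Fs].
have [t tP] := spanS_lift Fs; exact: eq_fg tP.
Qed.

End Comparison.
End Entropy.

Theorem theorem6p2 (K : realType) (Q : fieldType) (v : valuation K Q)
    (v_nd : non_discrete v)
    (Lv : lmodType (valring v) -> \bar K) (Lv_length : valuation_length Lv) :
  let characterized (L : lmodType {poly valring v} -> \bar K) :=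
    [/\ length_function L,
        forall M : lmodType (valring v), (Lv M < +oo)%E ->
          L (tensor M {poly valring v}) = Lv M
      & forall (V : vectType Q) (phi : {linear V -> V}) (P : {poly valring v}),
          charpoly_over phi P ->
          L (restrQ v phi) = v (valring_val v (lead_coef P))] in
  characterized (intrinsic_entropy Lv) /\
  forall L, characterized L -> L = intrinsic_entropy Lv.
Proof.
move=> characterized; split.
  split; [exact: ent_length_function | exact: ent_tensor | exact: ent_restrQ].
move=> L [LL L_tensor L_restrQ]; apply/funext => N.
exact: eq_ent.
Qed.
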